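(* Let $k\ge 1$ be an integer, let $H=(d_0,d_1,d_2,\ldots)$ be a sequence of non-negative integers with $n:=\sum_{i\ge 0}d_i<\infty$, and let $\eta=\eta(H)$. If $(\mathbb C^2)^{[n]}_{1,k}(H)\neq\emptyset$, then in $K_0(\nu_{\mathbb C})$ $$\left[(\mathbb C^2)^{[n]}_{1,k}(H)\right]=\prod_{i\ge\eta}G\bigl(d_i-d_{i+1}+\tau(i),\,d_{i+1}-d_{i+1+k}\bigr)_{\mathbb L}.$$
   Context: $(\mathbb C^2)^{[n]}$ is the Hilbert scheme of $n$ points on the plane, parametrizing ideals $I\subset\mathbb C[x,y]$ with $\dim_{\mathbb C}\mathbb C[x,y]/I=n$. The torus $T=(\mathbb C^* )^2$ acts on $\mathbb C^2$ by $(t_1,t_2)(x,y)=(t_1x,t_2y)$, and this lifts to $(\mathbb C^2)^{[n]}$. Let $T_{1,k}=\{(t,t^k)\mid t\in\mathbb C^*\}\subset T$, and let $(\mathbb C^2)^{[n]}_{1,k}$ be the (smooth) variety of fixed points of $T_{1,k}$ on $(\mathbb C^2)^{[n]}$; it parametrizes ideals of colength $n$ that are quasi-homogeneous for the grading in which $x^iy^j$ has degree $i+kj$. Let $\mathbb C[x,y]^d_{1,k}$ be the space of quasi-homogeneous polynomials of degree $d$ for this grading. For $H=(d_0,d_1,\ldots)$ with $\sum d_i=n$, $(\mathbb C^2)^{[n]}_{1,k}(H)\subset(\mathbb C^2)^{[n]}_{1,k}$ is the set of points corresponding to quasi-homogeneous ideals $I$ with $\dim\bigl(\mathbb C[x,y]^i_{1,k}/(I\cap\mathbb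 C[x,y]^i_{1,k})\bigr)=d_i$ for all $i\ge0$. $K_0(\nu_{\mathbb C})$ is the Grothendieck ring of complex quasi-projective varieties: the abelian group generated by classes $[X]$ of complex quasi-projective varieties modulo $[X]=[Y]$ for isomorphic $X,Y$ and $[X]=[Y]+[X\setminus Y]$ for $Y\subset X$ Zariski closed, with product $[X_1]\cdot[X_2]=[X_1\times X_2]$. $\mathbb L=[\mathbb A^1_{\mathbb C}]$. For integers $M,N\ge 0$, $G(M,N)_q=\dfrac{\prod_{i=1}^{M+N}(1-q^i)}{\prod_{i=1}^{M}(1-q^i)\prod_{i=1}^{N}(1-q^i)}$ (a polynomial in $q$; $G(M,N)_{\mathbb L}$ is its value at $q=\mathbb L$). $\eta(H)$ is the largest $i$ such that $d_i=\lfloor i/k\rfloor+1$; conventions: $\eta(H)=-1$ if $H=(0,0,\ldots)$, and $d_{-1}=0$. The function $\tau$ is defined by $\tau(i)=1$ if $k\mid i+1$ and $\tau(i)=0$ if $k\nmid i+1$. *)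

(* Defs.v *)
From HB Require Import structures.
From mathcomp Require Import all_boot all_order all_algebra.
From mathcomp Require Import generic_quotient ring_quotient.
From mathcomp Require Import boolp classical_sets cardinality fsbigop reals.
From mathcomp Require Import freeg mpoly complex ring.

Set Implicit Arguments.
Unset Strict Implicit.
Unset Printing Implicit Defensive.

Import Order.TTheory GRing.Theory Num.Theory.
Local Open Scope ring_scope.
Local Open Scope quotient_scope.
Local Open Scope classical_set_scope.

Section Projective.
Variable F : closedFieldType.
Implicit Types m l : nat.

(* Points of the projective space P^(m-1) over F are nonzero row vectors in
   F^m up to [proj_eq]; subsets of P^(m-1) are represented by their cones of
   nonzero representatives. *)
Definition proj_eq m (u v : 'rV[F]_m) := exists2 c : F, c != 0 & u = c *: v.

Definition closed_cone m (E : set {mpoly F[m]}) : set 'rV[F]_m :=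
  [set v : 'rV[F]_m | v != 0 /\ forall f, E f -> f.@[v 0] = 0].

Definition proj_closed m (A : set 'rV[F]_m) :=
  exists2 E : set {mpoly F[m]},
    forall f, E f -> f \is homog mdeg & A = closed_cone E.

Definition locally_closed m (X : set 'rV[F]_m) :=
  exists A B, [/\ proj_closed A, proj_closed B & X = A `\` B].

(* Reduced, possibly reducible quasi-projective varieties in P^(m-1): F is
   algebraically closed, so they are given by their F-points. *)
Record qproj m := QProj {
  qpts :> set 'rV[F]_m;
  qprojP : locally_closed qpts }.

(* [phi] acts on representatives; around each point it is given, up to scalars,
   by forms [G j] of one common degree, on the open neighbourhood [h != 0].
   These forms have no common zero there, because [phi v] lies in [Y]. *)
Definition regular_map m l (X : set 'rV[F]_m) (Y : set 'rV[F]_l)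
    (phi : 'rV[F]_m -> 'rV[F]_l) :=
  (forall v, X v -> Y (phi v)) /\
  forall p, X p -> exists (d : nat) (G : 'I_l -> {mpoly F[m]}) (h : {mpoly F[m]}),
    [/\ forall j, G j \is d.-homog, h \is homog mdeg, h.@[p 0] != 0 &
        forall v, X v -> h.@[v 0] != 0 -> proj_eq (phi v) (\row_j (G j).@[v 0])].

Definition isomorphic m l (X : set 'rV[F]_m) (Y : set 'rV[F]_l) :=
  exists (phi : 'rV[F]_m -> 'rV[F]_l) (psi : 'rV[F]_l -> 'rV[F]_m),
    [/\ regular_map X Y phi, regular_map Y X psi,
        forall v, X v -> proj_eq (psi (phi v)) v &
        forall w, Y w -> proj_eq (phi (psi w)) w].

Definition segre m l (u : 'rV[F]_m) (v : 'rV[F]_l) : 'rV[F]_(m * l) :=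
  mxvec (u^T *m v).

Definition prod_cone m l (X : set 'rV[F]_m) (Y : set 'rV[F]_l) :
    set 'rV[F]_(m * l) :=
  [set z | exists (u : 'rV[F]_m) (v : 'rV[F]_l), [/\ X u, Y v & z = segre u v]].

Lemma segreE m l (u : 'rV[F]_m) (v : 'rV[F]_l) i j :
  segre u v 0 (mxvec_index i j) = u 0 i * v 0 j.
Proof. by rewrite mxvecE mxE big_ord1 mxE. Qed.

Lemma segre_eqP m l (z : 'rV[F]_(m * l)) (u : 'rV[F]_m) (v : 'rV[F]_l) :
  (forall i j, z 0 (mxvec_index i j) = u 0 i * v 0 j) -> z = segre u v.
Proof.
move=> e; apply/rowP => k; case/mxvec_indexP: k => i j.
by rewrite e segreE.
Qed.

Lemma nz_coord m (v : 'rV[F]_m) : v != 0 -> exists i, v 0 i != 0.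
Proof. by move=> /rV0Pn. Qed.

Lemma coord_nz m (v : 'rV[F]_m) i : v 0 i != 0 -> v != 0.
Proof. by apply: contraNneq => ->; rewrite mxE. Qed.

Lemma homog_scale m d (f : {mpoly F[m]}) (c : F) (x : 'I_m -> F) :
  f \is d.-homog -> f.@[fun i => c * x i] = c ^+ d * f.@[x].
Proof.
move=> /dhomogP hf; rewrite !mevalE mulr_sumr !big_seq.
apply: eq_bigr => n /hf <-; rewrite mulrCA; congr (_ * _).
under eq_bigr do rewrite exprMn.
by rewrite big_split /= prodrXr mdegE.
Qed.

Lemma homog_scale0 m (f : {mpoly F[m]}) (c : F) (x : 'I_m -> F) : c != 0 ->
  f \is homog mdeg -> (f.@[fun i => c * x i] == 0) = (f.@[x] == 0).
Proof.
move=> c0 /homogP [d /homog_scale ->].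
by rewrite mulf_eq0 expf_eq0 (negPf c0) andbF.
Qed.

Lemma closed_coneZ m (E : set {mpoly F[m]}) c (v : 'rV[F]_m) :
  (forall f, E f -> f \is homog mdeg) -> c != 0 ->
  closed_cone E v -> closed_cone E (c *: v).
Proof.
move=> hE c0 [v0 Ev]; split=> [|f Ef]; first by rewrite scaler_eq0 negb_or c0.
apply/eqP; rewrite (@meval_eq _ _ _ (fun i => c * v 0 i)); last first.
  by move=> i; rewrite mxE.
by rewrite homog_scale0 ?Ev ?eqxx //; apply: hE.
Qed.

Lemma qproj_neq0 m (X : qproj m) v : qpts X v -> v != 0.
Proof. by have [A [B [[E _ ->] _ ->]]] := qprojP X; case=> [[]]. Qed.

Lemma qprojZ m (X : qproj m) c v : c != 0 -> qpts X v -> qpts X (c *: v).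
Proof.
have [A [B [[E hE ->] [E' hE' ->]] ->]] := qprojP X; move=> c0 [Av nBv].
split; first exact: closed_coneZ.
move=> Bv; apply: nBv; rewrite -[v]scale1r -(mulVf c0) -scalerA.
by apply: closed_coneZ; rewrite ?invr_eq0.
Qed.

Lemma comp_homog m l d (f : {mpoly F[m]}) (q : m.-tuple {mpoly F[l]}) :
  f \is d.-homog -> (forall i, tnth q i \is 1.-homog) -> f \mPo q \is d.-homog.
Proof.
move=> /dhomogP hf hq; rewrite comp_mpolyE big_seq; apply: rpred_sum => n /hf dn.
apply: rpredZ; have -> : d = (\sum_i n i)%N by rewrite -mdegE -dn.
elim/big_rec2: _ => [|i p e _ h]; first exact: dhomog1.
by apply: dhomogM => //; have := dhomogMn (n i) (hq i); rewrite mul1n.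
Qed.

(* Forms on F^(m * l), seen as m x l matrices, evaluated on the j-th column,
   resp. the i-th row. *)
Definition colpb m l (j : 'I_l) (f : {mpoly F[m]}) : {mpoly F[m * l]} :=
  f \mPo [tuple 'X_(mxvec_index i j) | i < m].
Definition rowpb m l (i : 'I_m) (f : {mpoly F[l]}) : {mpoly F[m * l]} :=
  f \mPo [tuple 'X_(mxvec_index i j) | j < l].

Lemma colpbE m l (j : 'I_l) (f : {mpoly F[m]}) x :
  (colpb j f).@[x] = f.@[fun i => x (mxvec_index i j)].
Proof.
rewrite comp_mpoly_meval; apply: meval_eq => i.
by rewrite tnth_mktuple mevalXU.
Qed.

Lemma rowpbE m l (i : 'I_m) (f : {mpoly F[l]}) x :
  (rowpb i f).@[x] = f.@[fun j => x (mxvec_index i j)].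
Proof.
rewrite comp_mpoly_meval; apply: meval_eq => j.
by rewrite tnth_mktuple mevalXU.
Qed.

Lemma homogX m (i : 'I_m) : ('X_i : {mpoly F[m]}) \is 1.-homog.
Proof. by rewrite dhomogX /= mdeg1. Qed.

Lemma colpb_homog m l (j : 'I_l) d (f : {mpoly F[m]}) :
  f \is d.-homog -> colpb j f \is d.-homog.
Proof. by move/comp_homog; apply=> i; rewrite tnth_mktuple homogX. Qed.

Lemma rowpb_homog m l (i : 'I_m) d (f : {mpoly F[l]}) :
  f \is d.-homog -> rowpb i f \is d.-homog.
Proof. by move/comp_homog; apply=> j; rewrite tnth_mktuple homogX. Qed.

Lemma colpb_segre m l (j : 'I_l) d (f : {mpoly F[m]}) (u : 'rV[F]_m) (v : 'rV[F]_l) :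
  f \is d.-homog -> (colpb j f).@[segre u v 0] = v 0 j ^+ d * f.@[u 0].
Proof.
move=> hf; rewrite colpbE -(homog_scale _ _ hf); apply: meval_eq => i.
by rewrite segreE mulrC.
Qed.

Lemma rowpb_segre m l (i : 'I_m) d (f : {mpoly F[l]}) (u : 'rV[F]_m) (v : 'rV[F]_l) :
  f \is d.-homog -> (rowpb i f).@[segre u v 0] = u 0 i ^+ d * f.@[v 0].
Proof.
move=> hf; rewrite rowpbE -(homog_scale _ _ hf); apply: meval_eq => j.
by rewrite segreE.
Qed.

Lemma segre_rank1 m l (z : 'rV[F]_(m * l)) :
  z != 0 ->
  (forall i i' j j', z 0 (mxvec_index i j) * z 0 (mxvec_index i' j') =
                     z 0 (mxvec_index i j') * z 0 (mxvec_index i' j)) ->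
  exists (u : 'rV[F]_m) (v : 'rV[F]_l), [/\ u != 0, v != 0 & z = segre u v].
Proof.
move=> /nz_coord [k]; case/mxvec_indexP: k => i0 j0 z0 hz.
exists (\row_i z 0 (mxvec_index i j0)).
exists (\row_j (z 0 (mxvec_index i0 j) / z 0 (mxvec_index i0 j0))).
split.
- by apply: (@coord_nz _ _ i0); rewrite mxE.
- by apply: (@coord_nz _ _ j0); rewrite mxE divff ?oner_eq0.
apply: segre_eqP => i j; rewrite !mxE; apply: (mulIf z0).
by rewrite mulrA divfK // hz.
Qed.

Lemma segre_neq0 m l (u : 'rV[F]_m) (v : 'rV[F]_l) :
  u != 0 -> v != 0 -> segre u v != 0.
Proof.
move=> /nz_coord [i ui] /nz_coord [j vj].
by apply: (@coord_nz _ _ (mxvec_index i j)); rewrite segreE mulf_neq0.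
Qed.

Lemma prod_qproj m l (X : qproj m) (Y : qproj l) :
  locally_closed (prod_cone X Y).
Proof.
have [_ [_ [[E hE ->] [E' hE' ->]] ->]] := qprojP X.
have [_ [_ [[D hD ->] [D' hD' ->]] ->]] := qprojP Y.
pose minor i i' j j' : {mpoly F[m * l]} :=
  'X_(mxvec_index i j) * 'X_(mxvec_index i' j') -
  'X_(mxvec_index i j') * 'X_(mxvec_index i' j).
pose P : set {mpoly F[m * l]} := [set p |
  [\/ exists i i' j j', p = minor i i' j j',
      exists j, exists2 f, E f & p = colpb j f |
      exists i, exists2 f, D f & p = rowpb i f]].
pose Q : set {mpoly F[m * l]} := [set p |
  exists i j, exists2 f, E' f & exists2 g, D' g & p = colpb j f * rowpb i g].
exists (closed_cone P), (closed_cone Q); split.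
- exists P => // p [[i [i' [j [j' ->]]]]|[j [f /hE /homogP [d h] ->]]|
                     [i [f /hD /homogP [d h] ->]]].
  + by apply/homogP; exists (1 + 1)%N; apply: rpredB; apply: dhomogM; apply: homogX.
  + by apply/homogP; exists d; apply: colpb_homog.
  + by apply/homogP; exists d; apply: rowpb_homog.
- exists Q => // p [i [j [f /hE' /homogP [d h]]]] [g /hD' /homogP [e h']] ->.
  apply/homogP; exists (d + e)%N; apply: dhomogM; first exact: colpb_homog.
  exact: rowpb_homog.
apply/seteqP; split=> z.
- move=> [u [v [[[u0 Eu] Eu'] [[v0 Dv] Dv'] ->]]].
  split; first split; first exact: segre_neq0.
    move=> p [[i [i' [j [j' ->]]]]|[j [f Ef ->]]|[i [f Df ->]]].
    + by rewrite mevalB !mevalM !mevalXU !segreE mulrACA [X in _ - X]mulrACA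
        [v 0 j * _]mulrC subrr.
    + by have /homogP [d h] := hE _ Ef; rewrite (colpb_segre _ _ _ h) Eu ?mulr0.
    + by have /homogP [d h] := hD _ Df; rewrite (rowpb_segre _ _ _ h) Dv ?mulr0.
  have [i ui] := nz_coord u0; have [j vj] := nz_coord v0.
  move=> [_ Qz]; apply: Eu'; split=> // f Ef; apply/eqP/negPn/negP => fu.
  apply: Dv'; split=> // g Dg.
  have /homogP [d h] := hE' _ Ef; have /homogP [e h'] := hD' _ Dg.
  have /Qz : Q (colpb j f * rowpb i g) by exists i, j, f => //; exists g.
  rewrite mevalM (colpb_segre _ _ _ h) (rowpb_segre _ _ _ h').
  move/eqP; rewrite !mulf_eq0 !expf_eq0 (negPf ui) (negPf vj) (negPf fu) !andbF /=.
  by move/eqP.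
- move=> [[z0 Pz] Qz].
  have [|u [v [u0 v0 zE]]] := segre_rank1 z0.
    move=> i i' j j'; apply/eqP; rewrite -subr_eq0; apply/eqP.
    have /Pz : P (minor i i' j j') by constructor 1; exists i, i', j, j'.
    by rewrite mevalB !mevalM !mevalXU.
  have [i ui] := nz_coord u0; have [j vj] := nz_coord v0.
  exists u, v; split=> //; split.
  + split=> // f Ef; have /homogP [d h] := hE _ Ef.
    have /Pz : P (colpb j f) by constructor 2; exists j, f.
    rewrite zE (colpb_segre _ _ _ h) => /eqP.
    by rewrite mulf_eq0 expf_eq0 (negPf vj) andbF => /eqP.
  + move=> [_ Eu]; apply: Qz; split=> // _ [i' [j' [f Ef [g Dg ->]]]].
    have /homogP [d h] := hE' _ Ef.
    by rewrite mevalM zE (colpb_segre _ _ _ h) Eu // mulr0 mul0r.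
  + split=> // f Df; have /homogP [d h] := hD _ Df.
    have /Pz : P (rowpb i f) by constructor 3; exists i, f.
    rewrite zE (rowpb_segre _ _ _ h) => /eqP.
    by rewrite mulf_eq0 expf_eq0 (negPf ui) andbF => /eqP.
  + move=> [_ Dv]; apply: Qz; split=> // _ [i' [j' [f Ef [g Dg ->]]]].
    have /homogP [d h] := hD' _ Dg.
    by rewrite mevalM zE (rowpb_segre _ _ _ h) Dv // !mulr0.
Qed.

Definition qproj_prod m l (X : qproj m) (Y : qproj l) : qproj (m * l) :=
  QProj (prod_qproj X Y).

Lemma proj_eq_refl m (u : 'rV[F]_m) : proj_eq u u.
Proof. by exists 1; rewrite ?oner_eq0 ?scale1r. Qed.

Lemma proj_eq_sym m (u v : 'rV[F]_m) : proj_eq u v -> proj_eq v u.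
Proof.
by case=> c c0 ->; exists c^-1; rewrite ?invr_eq0 // scalerA mulVf // scale1r.
Qed.

Lemma proj_eq_trans m (u v w : 'rV[F]_m) :
  proj_eq u v -> proj_eq v w -> proj_eq u w.
Proof.
by case=> c c0 -> [d d0 ->]; exists (c * d); rewrite ?mulf_neq0 // scalerA.
Qed.

Lemma segreZl m l c (u : 'rV[F]_m) (v : 'rV[F]_l) :
  segre (c *: u) v = c *: segre u v.
Proof. by apply/esym/segre_eqP => i j; rewrite mxE segreE mxE mulrA. Qed.

Lemma segreZr m l c (u : 'rV[F]_m) (v : 'rV[F]_l) :
  segre u (c *: v) = c *: segre u v.
Proof. by apply/esym/segre_eqP => i j; rewrite mxE segreE mxE mulrCA. Qed.

Lemma proj_eq_segre m l (u u' : 'rV[F]_m) (v v' : 'rV[F]_l) :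
  proj_eq u u' -> proj_eq v v' -> proj_eq (segre u v) (segre u' v').
Proof.
move=> [c c0 ->] [d d0 ->]; exists (c * d); first exact: mulf_neq0.
by rewrite segreZl segreZr scalerA.
Qed.

Lemma segre_inj m l (u u' : 'rV[F]_m) (v v' : 'rV[F]_l) :
  u != 0 -> v != 0 -> segre u v = segre u' v' -> proj_eq u' u /\ proj_eq v' v.
Proof.
move=> /nz_coord [i ui] /nz_coord [j vj] e.
have E a b : u 0 a * v 0 b = u' 0 a * v' 0 b by rewrite -!segreE e.
have : u' 0 i * v' 0 j != 0 by rewrite -E mulf_neq0.
rewrite mulf_eq0 negb_or => /andP [ui' vj'].
split.
- exists (v 0 j / v' 0 j); first by rewrite mulf_neq0 ?invr_eq0.
  apply/rowP => a; rewrite mxE; apply: (mulIf vj').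
  by rewrite -E mulrAC divfK // mulrC.
- exists (u 0 i / u' 0 i); first by rewrite mulf_neq0 ?invr_eq0.
  apply/rowP => b; rewrite mxE; apply: (mulfI ui').
  by rewrite -E mulrA [u' 0 i * _]mulrC divfK.
Qed.

Lemma regular_mapZ m l (X : qproj m) (Y : set 'rV[F]_l) phi c v :
  regular_map X Y phi -> qpts X v -> c != 0 -> proj_eq (phi (c *: v)) (phi v).
Proof.
move=> [_ reg] Xv c0; have [d [G [h [hG hh hv H]]]] := reg _ Xv.
have Ev (f : {mpoly F[m]}) : f.@[(c *: v) 0] = f.@[fun i => c * v 0 i].
  by apply: meval_eq => i; rewrite mxE.
apply: (proj_eq_trans (H _ (qprojZ c0 Xv) _)).
  by rewrite Ev homog_scale0.
apply: proj_eq_sym; apply: (proj_eq_trans (H _ Xv hv)).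
apply: proj_eq_sym; exists (c ^+ d); first by rewrite expf_neq0.
by apply/rowP => j; rewrite !mxE Ev (homog_scale _ _ (hG j)).
Qed.

Lemma iso_coord m l (X : set 'rV[F]_m) (Y : set 'rV[F]_l)
    (phi : 'rV[F]_m -> 'rV[F]_l) (psi : 'rV[F]_l -> 'rV[F]_m) :
  (forall j, exists i, forall v, phi v 0 j = v 0 i) ->
  (forall j, exists i, forall v, psi v 0 j = v 0 i) ->
  (forall v, X v -> Y (phi v)) -> (forall w, Y w -> X (psi w)) ->
  (forall v, X v -> proj_eq (psi (phi v)) v) ->
  (forall w, Y w -> proj_eq (phi (psi w)) w) ->
  isomorphic X Y.
Proof.
have reg m' l' (A : set 'rV[F]_m') (B : set 'rV[F]_l')
    (f : 'rV[F]_m' -> 'rV[F]_l') :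
    (forall j, exists i, forall v, f v 0 j = v 0 i) ->
    (forall v, A v -> B (f v)) -> regular_map A B f.
  move=> /choice [s hs] AB; split=> // p Ap.
  exists 1, (fun j => 'X_(s j)), 1; split.
  - by move=> j; apply: homogX.
  - by apply/homogP; exists 0; apply: dhomog1.
  - by rewrite meval1 oner_eq0.
  - move=> v _ _; suff -> : f v = \row_j ('X_(s j)).@[v 0] by apply: proj_eq_refl.
    by apply/rowP => j; rewrite mxE mevalXU hs.
by move=> h1 h2 h3 h4 h5 h6; exists phi, psi; split=> //; apply: reg.
Qed.

Lemma iso_refl m (X : set 'rV[F]_m) : isomorphic X X.
Proof.
apply: (@iso_coord _ _ _ _ id id) => //.
- by move=> j; exists j.
- by move=> j; exists j.
- by move=> v _; apply: proj_eq_refl.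
- by move=> v _; apply: proj_eq_refl.
Qed.

Lemma iso_prodC m l (X : set 'rV[F]_m) (Y : set 'rV[F]_l) :
  isomorphic (prod_cone X Y) (prod_cone Y X).
Proof.
pose sw a b (z : 'rV[F]_(a * b)) : 'rV[F]_(b * a) := mxvec (vec_mx z)^T.
have swc a b j : exists i, forall z, @sw a b z 0 j = z 0 i.
  case/mxvec_indexP: j => j i; exists (mxvec_index i j) => z.
  by rewrite mxvecE mxE mxE.
have sws a b (u : 'rV[F]_a) (v : 'rV[F]_b) : sw _ _ (segre u v) = segre v u.
  by rewrite /sw /segre mxvecK trmx_mul trmxK.
apply: (@iso_coord _ _ _ _ (sw m l) (sw l m)) => //.
- by move=> z [u [v [Xu Yv ->]]]; exists v, u.
- by move=> z [v [u [Yv Xu ->]]]; exists u, v.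
- by move=> z [u [v [Xu Yv ->]]]; rewrite !sws; apply: proj_eq_refl.
- by move=> z [u [v [Xu Yv ->]]]; rewrite !sws; apply: proj_eq_refl.
Qed.

Lemma iso_prodA m l p (X : set 'rV[F]_m) (Y : set 'rV[F]_l) (Z : set 'rV[F]_p) :
  isomorphic (prod_cone X (prod_cone Y Z)) (prod_cone (prod_cone X Y) Z).
Proof.
pose f (z : 'rV[F]_(m * (l * p))) : 'rV[F]_(m * l * p) :=
  mxvec (\matrix_(q, k) mxvec (\matrix_(i, j)
    z 0 (mxvec_index i (mxvec_index j k))) 0 q).
pose g (z : 'rV[F]_(m * l * p)) : 'rV[F]_(m * (l * p)) :=
  mxvec (\matrix_(i, q) mxvec (\matrix_(j, k)
    z 0 (mxvec_index (mxvec_index i j) k)) 0 q).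
have fs u v w : f (segre u (segre v w)) = segre (segre u v) w.
  apply: segre_eqP => q k; case/mxvec_indexP: q => i j.
  by rewrite mxvecE mxE mxvecE mxE !segreE mulrA.
have gs u v w : g (segre (segre u v) w) = segre u (segre v w).
  apply: segre_eqP => i q; case/mxvec_indexP: q => j k.
  by rewrite mxvecE mxE mxvecE mxE !segreE mulrA.
apply: (@iso_coord _ _ _ _ f g).
- move=> q; case/mxvec_indexP: q => q k; case/mxvec_indexP: q => i j.
  exists (mxvec_index i (mxvec_index j k)) => v.
  by rewrite mxvecE mxE mxvecE mxE.
- move=> q; case/mxvec_indexP: q => i q; case/mxvec_indexP: q => j k.
  exists (mxvec_index (mxvec_index i j) k) => v.
  by rewrite mxvecE mxE mxvecE mxE.
- move=> _ [u [_ [Xu [v [w [Yv Zw ->]]] ->]]]; rewrite fs.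
  by exists (segre u v), w; split=> //; exists u, v.
- move=> _ [_ [w [[u [v [Xu Yv ->]]] Zw ->]]]; rewrite gs.
  by exists u, (segre v w); split=> //; exists v, w.
- move=> _ [u [_ [Xu [v [w [Yv Zw ->]]] ->]]]; rewrite fs gs.
  exact: proj_eq_refl.
- move=> _ [_ [w [[u [v [Xu Yv ->]]] Zw ->]]]; rewrite gs fs.
  exact: proj_eq_refl.
Qed.

Lemma regular_prod m m' l (X : qproj m) (X' : qproj m') (Y : qproj l) phi :
  regular_map X X' phi -> exists Phi, regular_map (qproj_prod X Y) (qproj_prod X' Y) Phi /\
    forall u v, qpts X u -> qpts Y v ->
      proj_eq (Phi (segre u v)) (segre (phi u) v).
Proof.
move=> [XX' reg].
pose S (z : 'rV[F]_(m * l)) : set ('rV[F]_m * 'rV[F]_l) :=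
  [set uv | [/\ qpts X uv.1, qpts Y uv.2 & z = segre uv.1 uv.2]].
pose Phi z := let uv := xget 0 (S z) in segre (phi uv.1) uv.2.
have PhiE u v : qpts X u -> qpts Y v ->
    exists u' v', [/\ qpts X u', qpts Y v', segre u v = segre u' v' &
      Phi (segre u v) = segre (phi u') v'].
  move=> Xu Yv; rewrite /Phi; case: xgetP => [[u' v'] _ [/= Xu' Yv' e]|].
    by exists u', v'.
  by move=> /(_ (u, v)); case.
exists Phi; split; last first.
  move=> u v Xu Yv; have [u' [v' [Xu' Yv' e ->]]] := PhiE _ _ Xu Yv.
  have [[c c0 ->] ev] := segre_inj (qproj_neq0 Xu) (qproj_neq0 Yv) e.
  by apply: proj_eq_segre => //; apply: (regular_mapZ (conj XX' reg)).
split=> [_ [u [v [Xu Yv ->]]]|_ [u0 [v0 [Xu0 Yv0 ->]]]].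
  have [u' [v' [Xu' Yv' _ ->]]] := PhiE _ _ Xu Yv.
  by exists (phi u'), v'; split=> //; apply: XX'.
have [d [G [h [hG hh hu0 H]]]] := reg _ Xu0.
have [i ui] := nz_coord (qproj_neq0 Xu0).
have [j vj] := nz_coord (qproj_neq0 Yv0).
have /homogP [e he] := hh.
have row_ex (k : 'I_(m' * l)) : exists p : {mpoly F[m * l]}, p \is (d + 1).-homog /\
    forall (u : 'rV[F]_m) (v : 'rV[F]_l), p.@[segre u v 0] =
      v 0 j ^+ d * u 0 i * segre (\row_a (G a).@[u 0]) v 0 k.
  case/mxvec_indexP: k => a b; exists (colpb j (G a) * rowpb i 'X_b); split.
    by apply: dhomogM; [apply: colpb_homog | apply: rowpb_homog; apply: homogX].
  move=> u v; rewrite mevalM (colpb_segre _ _ _ (hG a)).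
  rewrite (rowpb_segre _ _ _ (homogX b)) mevalXU segreE mxE expr1 -!mulrA.
  by congr (_ * _); rewrite mulrCA.
have {row_ex} [G' hG'] := choice row_ex.
exists (d + 1)%N, G', (colpb j h * 'X_(mxvec_index i j)); split.
- by move=> k; have [] := hG' k.
- apply/homogP; exists (e + 1)%N; apply: dhomogM; last exact: homogX.
  exact: colpb_homog.
- by rewrite mevalM (colpb_segre _ _ _ he) mevalXU segreE !mulf_neq0 // expf_neq0.
move=> _ [u [v [Xu Yv ->]]].
have [u' [v' [Xu' Yv' -> ->]]] := PhiE _ _ Xu Yv.
rewrite mevalM (colpb_segre _ _ _ he) mevalXU segreE !mulf_eq0 !negb_or.
move=> /andP [/andP [vj' hu'] /andP [ui' vj'']].
apply: (proj_eq_trans (proj_eq_segre (H _ Xu' hu') (proj_eq_refl v'))).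
apply: proj_eq_sym; exists (v' 0 j ^+ d * u' 0 i); first by rewrite mulf_neq0 ?expf_neq0.
by apply/rowP => k; have [_ e'] := hG' k; rewrite !mxE e'.
Qed.

Lemma iso_prodl m m' l (X : qproj m) (X' : qproj m') (Y : qproj l) :
  isomorphic X X' -> isomorphic (qproj_prod X Y) (qproj_prod X' Y).
Proof.
move=> [phi [psi [rphi rpsi phiK psiK]]].
have [Phi [rPhi PhiE]] := regular_prod Y rphi.
have [Psi [rPsi PsiE]] := regular_prod Y rpsi.
have aux a b (A : qproj a) (B : qproj b) f g Fm Gm :
    regular_map A B f -> (forall v, qpts A v -> proj_eq (g (f v)) v) ->
    (forall u v, qpts A u -> qpts Y v -> proj_eq (Fm (segre u v)) (segre (f u) v)) ->
    (forall u v, qpts B u -> qpts Y v -> proj_eq (Gm (segre u v)) (segre (g u) v)) ->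
    regular_map (qproj_prod B Y) (qproj_prod A Y) Gm ->
    forall z, qpts (qproj_prod A Y) z -> proj_eq (Gm (Fm z)) z.
  move=> [AB _] gK FE GE rG _ [u [v [Au Yv ->]]].
  have [c c0 ->] := FE _ _ Au Yv.
  have BY : qpts (qproj_prod B Y) (segre (f u) v) by exists (f u), v; split=> //; apply: AB.
  apply: (proj_eq_trans (regular_mapZ rG BY c0)).
  apply: (proj_eq_trans (GE _ _ (AB _ Au) Yv)).
  by apply: proj_eq_segre; [apply: gK | apply: proj_eq_refl].
exists Phi, Psi; split=> // z.
- exact: (aux _ _ X X' phi psi Phi Psi).
- exact: (aux _ _ X' X psi phi Psi Phi).
Qed.

Lemma proj_closed_nz m : proj_closed [set v : 'rV[F]_m | v != 0].
Proof.
exists set0 => //; apply/seteqP; split=> v /=; last by case.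
by move=> v0; split.
Qed.

Lemma locally_closed_open m (f : {mpoly F[m]}) : f \is homog mdeg ->
  locally_closed [set v : 'rV[F]_m | v != 0 /\ f.@[v 0] != 0].
Proof.
move=> hf; exists [set v | v != 0], (closed_cone [set f]); split.
- exact: proj_closed_nz.
- by exists [set f] => // _ ->.
apply/seteqP; split=> v [v0].
  by move=> fv; split=> // -[_ /(_ f erefl) /eqP]; rewrite (negPf fv).
move=> nf; split=> //; apply/eqP => fv; apply: nf; split=> //.
by move=> _ ->.
Qed.

Lemma homog_one m : (1 : {mpoly F[m]}) \is homog mdeg.
Proof. by apply/homogP; exists 0%N; apply: dhomog1. Qed.

Lemma homog_var m (i : 'I_m) : ('X_i : {mpoly F[m]}) \is homog mdeg.
Proof. by apply/homogP; exists 1%N; apply: homogX. Qed.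

Definition pt_var : qproj 1 := QProj (locally_closed_open (homog_one 1)).
(* P^1 minus the point [0 : 1]. *)
Definition affine_line : qproj 2 :=
  QProj (locally_closed_open (homog_var (0 : 'I_2))).

Lemma iso_prod1 m (X : qproj m) : isomorphic (qproj_prod pt_var X) X.
Proof.
pose f (z : 'rV[F]_(1 * m)) : 'rV[F]_m := \row_j z 0 (mxvec_index 0 j).
pose g (v : 'rV[F]_m) : 'rV[F]_(1 * m) := segre (const_mx 1) v.
have fs u v : f (segre u v) = u 0 0 *: v.
  by apply/rowP => j; rewrite !mxE segreE.
have pt (u : 'rV[F]_1) : qpts pt_var u -> u 0 0 != 0.
  by move=> [u0 _]; case: (nz_coord u0) => i; rewrite ord1.
have pt1 : qpts pt_var (const_mx 1).
  by split; rewrite ?meval1 ?oner_eq0 //; apply: (@coord_nz _ _ 0); rewrite mxE oner_eq0.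
apply: (@iso_coord _ _ _ _ f g).
- by move=> j; exists (mxvec_index 0 j) => v; rewrite mxE.
- move=> j; case/mxvec_indexP: j => i j; exists j => v.
  by rewrite segreE mxE mul1r.
- by move=> _ [u [v [/pt u0 Xv ->]]]; rewrite fs; apply: qprojZ.
- by move=> v Xv; exists (const_mx 1), v.
- move=> _ [u [v [/pt u0 Xv ->]]]; rewrite fs /g.
  apply: proj_eq_segre; last by exists (u 0 0).
  exists (u 0 0)^-1; rewrite ?invr_eq0 //.
  by apply/rowP => i; rewrite !mxE ord1 mulVf.
- by move=> v Xv; rewrite fs mxE scale1r; apply: proj_eq_refl.
Qed.

Lemma prod_coneIl m l (Z : set 'rV[F]_m) (T : qproj l) :
  proj_closed Z -> exists2 Z', proj_closed Z' &
    forall (X : qproj m), prod_cone (X `&` Z) T = prod_cone X T `&` Z' /\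
      prod_cone (X `\` Z) T = prod_cone X T `\` Z'.
Proof.
move=> [E hE ->].
pose P : set {mpoly F[m * l]} :=
  [set p | exists j, exists2 f, E f & p = colpb j f].
exists (closed_cone P).
  exists P => // _ [j [f /hE /homogP [d h] ->]].
  by apply/homogP; exists d; apply: colpb_homog.
have EP (u : 'rV[F]_m) (v : 'rV[F]_l) : u != 0 -> v != 0 -> closed_cone P (segre u v) <-> closed_cone E u.
  move=> u0 v0; split=> -[_ H]; split=> //.
  - have [j vj] := nz_coord v0 => f Ef; have /homogP [d h] := hE _ Ef.
    have /H : P (colpb j f) by exists j, f.
    rewrite (colpb_segre _ _ _ h) => /eqP.
    by rewrite mulf_eq0 expf_eq0 (negPf vj) andbF => /eqP.
  - exact: segre_neq0.
  - move=> _ [j [f Ef ->]]; have /homogP [d h] := hE _ Ef.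
    by rewrite (colpb_segre _ _ _ h) H ?mulr0.
move=> X; split; apply/seteqP; split.
- move=> _ [u [v [[Xu Eu] Tv ->]]]; split; first by exists u, v.
  exact/(EP _ _ (qproj_neq0 Xu) (qproj_neq0 Tv)).
- move=> _ [[u [v [Xu Tv ->]]]].
  move/(EP _ _ (qproj_neq0 Xu) (qproj_neq0 Tv)) => Eu.
  by exists u, v.
- move=> _ [u [v [[Xu Eu] Tv ->]]]; split; first by exists u, v.
  by move/(EP _ _ (qproj_neq0 Xu) (qproj_neq0 Tv)).
- move=> _ [[u [v [Xu Tv ->]]] PE]; exists u, v; split=> //; split=> // Eu.
  exact/PE/(EP _ _ (qproj_neq0 Xu) (qproj_neq0 Tv)).
Qed.

End Projective.

Section Grothendieck.
Variable F : closedFieldType.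

Record qpvar := QPVar { qpdim : nat; qpset :> qproj F qpdim }.

HB.instance Definition _ := gen_eqMixin qpvar.
HB.instance Definition _ := gen_choiceMixin qpvar.

Definition free_gen (X : qpvar) : {freeg qpvar / int} := << X >>.

(* The subgroup of the free abelian group on varieties generated by the
   isomorphism and scissor relations. *)
Inductive K0rel : {freeg qpvar / int} -> Prop :=
| K0rel_iso (X Y : qpvar) : isomorphic X Y -> K0rel (free_gen X - free_gen Y)
| K0rel_scissor m (X Y U : qproj F m) (Z : set 'rV[F]_m) :
    proj_closed Z -> qpts Y = X `&` Z -> qpts U = X `\` Z ->
    K0rel (free_gen (QPVar X) - free_gen (QPVar Y) - free_gen (QPVar U))
| K0rel0 : K0rel 0
| K0relB D E : K0rel D -> K0rel E -> K0rel (D - E).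

Definition K0relb : {pred {freeg qpvar / int}} := fun D => `[< K0rel D >].

Lemma K0relb_closed : zmod_closed K0relb.
Proof.
split=> [|D E /asboolP hD /asboolP hE]; apply/asboolP; first exact: K0rel0.
exact: K0relB.
Qed.

HB.instance Definition _ :=
  GRing.isZmodClosed.Build {freeg qpvar / int} K0relb K0relb_closed.

Definition K0 : Type := Quotient.quot K0relb.

HB.instance Definition _ := GRing.Zmodule.on K0.

Definition qpvar_prod (X Y : qpvar) : qpvar := QPVar (qproj_prod X Y).

Definition fgmul (D E : {freeg qpvar / int}) : {freeg qpvar / int} :=
  fglift (fun X => fglift (fun Y => free_gen (qpvar_prod X Y)) E) D.

Lemma fgmulBl D D' E : fgmul (D - D') E = fgmul D E - fgmul D' E.
Proof. exact: lift_is_additive. Qed.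

Lemma fgmul_genl X E : fgmul (free_gen X) E = fglift (fun Y => free_gen (qpvar_prod X Y)) E.
Proof. by rewrite /fgmul liftU scale1r. Qed.

Lemma fgmul_gen X Y : fgmul (free_gen X) (free_gen Y) = free_gen (qpvar_prod X Y).
Proof. by rewrite fgmul_genl liftU scale1r. Qed.

Lemma fg_ind (P : {freeg qpvar / int} -> Prop) :
  (forall X, P (free_gen X)) -> (forall D E, P D -> P E -> P (D - E)) ->
  forall D, P D.
Proof.
move=> Pg PB D; have P0 : P 0.
  have X : qpvar := QPVar (pt_var F).
  by rewrite -(subrr (free_gen X)); apply: PB.
have PN E : P E -> P (- E) by rewrite -sub0r; apply: PB.
have PD E E' : P E -> P E' -> P (E + E').
  by move=> h /PN h'; rewrite -[E']opprK; apply: PB.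
rewrite -(freeg_sumE D); elim/big_ind: _ => // X _.
have -> (k : int) : << k *g X >> = free_gen X *~ k.
  by rewrite /free_gen freegU_mulz intz.
have PM n : P (free_gen X *+ n).
  by elim: n => [|n IH]; rewrite ?mulr0n // mulrS; apply: PD.
by case: (coeff X D) => n; [apply: PM | apply: PN; apply: PM].
Qed.

Lemma fgmulBr D E E' : fgmul D (E - E') = fgmul D E - fgmul D E'.
Proof.
elim/fg_ind: D => [X|D D' h h']; first by rewrite !fgmul_genl; apply: lift_is_additive.
by rewrite !fgmulBl h h' !opprD !opprK addrACA.
Qed.

Lemma K0relP D E : reflect (K0rel (D - E)) (\pi_K0 D == \pi_K0 E).
Proof. by rewrite eqmodE; apply: asboolP. Qed.

Lemma K0rel_mulr D E : K0rel D -> K0rel (fgmul D E).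
Proof.
move=> hD; elim/fg_ind: E => [T|E E']; last by rewrite fgmulBr; apply: K0relB.
elim: hD => [X Y XY|m X Y U Z hZ hY hU||D1 D2 _ h1 _ h2].
- by rewrite fgmulBl !fgmul_gen; apply/K0rel_iso/iso_prodl.
- have [Z' hZ' hXT] := prod_coneIl T hZ; have [hI hB] := hXT X.
  rewrite !fgmulBl !fgmul_gen /qpvar_prod /=; apply: (K0rel_scissor hZ') => /=.
    by rewrite hY hI.
  by rewrite hU hB.
- suff -> : fgmul 0 (free_gen T) = 0 by apply: K0rel0.
  by have := fgmulBl 0 0 (free_gen T); rewrite !subrr.
- by rewrite fgmulBl; apply: K0relB.
Qed.

Lemma K0relN D : K0rel D -> K0rel (- D).
Proof. by rewrite -sub0r; apply: K0relB K0rel0. Qed.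

Lemma K0relD D E : K0rel D -> K0rel E -> K0rel (D + E).
Proof. by move=> hD /K0relN hE; rewrite -[E]opprK; apply: K0relB. Qed.

Lemma K0rel_mulC D E : K0rel (fgmul D E - fgmul E D).
Proof.
elim/fg_ind: D => [X|D D' h h']; last first.
  rewrite fgmulBl fgmulBr; have := K0relB h h'.
  by rewrite !opprD !opprK addrACA.
elim/fg_ind: E => [Y|E E' h h']; last first.
  rewrite fgmulBl fgmulBr; have := K0relB h h'.
  by rewrite !opprD !opprK addrACA.
by rewrite !fgmul_gen; apply/K0rel_iso/iso_prodC.
Qed.

Lemma K0rel_mull D E : K0rel E -> K0rel (fgmul D E).
Proof.
move=> /(K0rel_mulr D) h; have := K0relD (K0rel_mulC D E) h.
by rewrite subrK.
Qed.

(* [K0] is only a possibly trivial ring ([comPzRingType]): 1 != 0 is true but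
   requires a nonzero motivic measure. The product is the one with
   [X] * [Y] = [X x Y], see [K0class_prod]. *)
Definition K0one : K0 := \pi_K0 (free_gen (QPVar (pt_var F))).
Definition K0mul (x y : K0) : K0 := \pi_K0 (fgmul (repr x) (repr y)).

Lemma pi_K0B D E : \pi_K0 (D - E) = \pi_K0 D - \pi_K0 E.
Proof. by rewrite raddfB. Qed.

Lemma pi_K0mul D E : K0mul (\pi_K0 D) (\pi_K0 E) = \pi_K0 (fgmul D E).
Proof.
have rP G : K0rel (repr (\pi_K0 G) - G) by apply/K0relP; rewrite reprK.
apply/eqP/K0relP; set D' := repr _; set E' := repr _.
have := K0relD (K0rel_mulr E' (rP D)) (K0rel_mull D (rP E)).
by rewrite fgmulBl fgmulBr addrA subrK.
Qed.

Lemma K0_ind (P : K0 -> Prop) : (forall X, P (\pi_K0 (free_gen X))) ->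
  (forall x y, P x -> P y -> P (x - y)) -> forall x, P x.
Proof.
move=> Pg PB x; rewrite -[x]reprK; elim/fg_ind: (repr x) => // D E.
by rewrite pi_K0B; apply: PB.
Qed.

Lemma K0mulC : commutative K0mul.
Proof.
move=> x y; rewrite -[x]reprK -[y]reprK !pi_K0mul.
exact/eqP/K0relP/K0rel_mulC.
Qed.

Lemma K0mulBl x y z : K0mul (x - y) z = K0mul x z - K0mul y z.
Proof.
rewrite -[x]reprK -[y]reprK -[z]reprK -pi_K0B !pi_K0mul -pi_K0B.
by rewrite fgmulBl.
Qed.

Lemma K0mulBr x y z : K0mul x (y - z) = K0mul x y - K0mul x z.
Proof. by rewrite ![K0mul x _]K0mulC K0mulBl. Qed.

Lemma K0mulDl : left_distributive K0mul +%R.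
Proof.
move=> x y z; have K0mulNl t : K0mul (- t) z = - K0mul t z.
  have z0 : K0mul 0 z = 0 by have := K0mulBl 0 0 z; rewrite !subrr.
  by rewrite -sub0r K0mulBl z0 sub0r.
by rewrite -[y in LHS]opprK K0mulBl K0mulNl opprK.
Qed.

Lemma K0mulA : associative K0mul.
Proof.
move=> x y z; elim/K0_ind: x => [X|x x' h h']; last by rewrite !K0mulBl h h'.
elim/K0_ind: y => [Y|y y' h h']; last by rewrite !(K0mulBl, K0mulBr) h h'.
elim/K0_ind: z => [Z|z z' h h']; last by rewrite !K0mulBr h h'.
rewrite !pi_K0mul !fgmul_gen; apply/eqP/K0relP/K0rel_iso.
exact: iso_prodA.
Qed.

Lemma K0mul1 : left_id K0one K0mul.
Proof.
move=> x; elim/K0_ind: x => [X|x x' h h']; last by rewrite !K0mulBr h h'.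
rewrite pi_K0mul fgmul_gen; apply/eqP/K0relP/K0rel_iso.
exact: iso_prod1.
Qed.

HB.instance Definition _ :=
  GRing.Zmodule_isComPzRing.Build K0 K0mulA K0mulC K0mul1 K0mulDl.

Definition K0class m (X : qproj F m) : K0 := \pi_K0 (free_gen (QPVar X)).

Lemma K0class_prod m l (X : qproj F m) (Y : qproj F l) :
  K0class X * K0class Y = K0class (qproj_prod X Y).
Proof. by rewrite [LHS]pi_K0mul fgmul_gen. Qed.

End Grothendieck.

Section GaussPoly.

Definition qfact (M : nat) : {poly int} := \prod_(1 <= i < M.+1) (1 - 'X^i).

(* The division is exact, see [gauss_polyE]. *)
Definition gauss_poly (M N : nat) : {poly int} :=
  qfact (M + N) %/ (qfact M * qfact N).

Lemma qfactS M : qfact M.+1 = qfact M * (1 - 'X^(M.+1)).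
Proof. by rewrite /qfact big_nat_recr. Qed.

Lemma lead_coef_qfact M : lead_coef (qfact M) = (-1) ^+ M.
Proof.
elim: M => [|M IH]; first by rewrite /qfact big_geq // lead_coef1.
rewrite qfactS lead_coefM IH [RHS]exprSr; congr (_ * _).
by rewrite -opprB lead_coefN lead_coefXnsubC.
Qed.

Lemma qfact_dvd M N :
  exists g, qfact (M + N) = g * (qfact M * qfact N).
Proof.
have q0 : qfact 0 = 1 by rewrite /qfact big_geq.
elim: M N => [|M IHM] N; first by exists 1; rewrite q0 !mul1r.
elim: N => [|N [g hg]]; first by exists 1; rewrite addn0 q0 mulr1 mul1r.
have [g' hg'] := IHM N.+1.
exists (g' + g * 'X^(M.+1)); rewrite addnS qfactS.
rewrite mulrDl {1}(qfactS M) qfactS.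
transitivity (qfact (M + N.+1) * (1 - 'X^(M.+1)) +
  qfact (M.+1 + N) * 'X^(M.+1) * (1 - 'X^(N.+1))); last first.
  by rewrite hg' hg (qfactS N); ring.
rewrite [(M + N.+1)%N]addnS -addSn -mulrA -mulrDr; congr (_ * _).
have -> : (M.+2 + N = M.+1 + N.+1)%N by rewrite addnS.
by rewrite exprD; ring.
Qed.

Lemma gauss_polyE M N : gauss_poly M N * (qfact M * qfact N) = qfact (M + N).
Proof.
have [g hg] := qfact_dvd M N; rewrite /gauss_poly hg.
rewrite Pdiv.IdomainUnit.mulpK // lead_coefM !lead_coef_qfact.
by rewrite unitrM !unitrX ?unitrN ?unitr1.
Qed.

End GaussPoly.

Definition poly_eval (A : comPzRingType) (p : {poly int}) (x : A) : A :=
  \sum_(i < size p) x ^+ i *~ p`_i.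

(* n-tuples of monomials of degree at most n. *)
Notation plucker_index n := {ffun 'I_n -> 'X_{1..2 < n.+1}}%type.

Section HilbertScheme.
Variable F : closedFieldType.

Record is_ideal (I : set {mpoly F[2]}) : Prop := IsIdeal {
  ideal0 : I 0;
  idealD : forall f g, I f -> I g -> I (f + g);
  idealM : forall f g, I g -> I (f * g) }.

(* [b] induces a basis of the vector space W / (I :&: W), for subspaces
   [W] and [I]. *)
Definition quot_basis (W I : set {mpoly F[2]}) n (b : 'I_n -> {mpoly F[2]}) :=
  (forall j, W (b j)) /\
  forall f, W f -> exists! c : 'rV[F]_n, I (f - \sum_j c 0 j *: b j).

Definition quot_dim (W I : set {mpoly F[2]}) (n : nat) :=
  exists b : 'I_n -> {mpoly F[2]}, quot_basis W I b.

Definition hilb (n : nat) : set (set {mpoly F[2]}) :=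
  [set I | is_ideal I /\ quot_dim setT I n].

(* The torus acts on the plane by (x, y) |-> (t1 x, t2 y), hence sends the
   subscheme with ideal I to the one with ideal {f | f(t1 x, t2 y) \in I}. *)
Definition torus_subst (t1 t2 : F) (f : {mpoly F[2]}) : {mpoly F[2]} :=
  f \mPo [tuple t1 *: 'X_0; t2 *: 'X_1].

Definition hilb_fix (k n : nat) : set (set {mpoly F[2]}) :=
  [set I | hilb n I /\
    forall t : F, t != 0 -> [set f | I (torus_subst t (t ^+ k) f)] = I].

Definition wdeg (k : nat) (m : 'X_{1..2}) : nat := (m 0%R + k * m 1%R)%N.

Lemma wdeg0 k : wdeg k 0%MM = 0%N.
Proof. by rewrite /wdeg !mnm0E muln0. Qed.

Lemma wdegD k : {morph wdeg k : m1 m2 / (m1 + m2)%MM >-> (m1 + m2)%N}.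
Proof. by move=> m1 m2; rewrite /wdeg !mnmDE mulnDr addnACA. Qed.

HB.instance Definition _ k := isMeasure.Build 2 (wdeg k) (wdeg0 k) (wdegD k).

Definition qhomog_part (k d : nat) : set {mpoly F[2]} :=
  [set f | f \is d.-homog for (wdeg k)].

(* I is spanned by its quasi-homogeneous elements. *)
Definition quasi_homogeneous (k : nat) (I : set {mpoly F[2]}) :=
  forall f, I f -> forall d, I (pihomog (wdeg k) d f).

Definition hilb_fixH (k n : nat) (H : nat -> nat) : set (set {mpoly F[2]}) :=
  [set I | [/\ hilb_fix k n I, quasi_homogeneous k I &
    forall d, quot_dim (qhomog_part k d) I (H d)]].

(* If I has colength n, the monomials of degree at most n span the quotient
   Q = F[x, y] / I, and I is determined by the resulting n-dimensional quotient
   of the space of polynomials of degree at most n. Its Plucker coordinates are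
   the values m_1 /\ ... /\ m_n in the line \Lambda^n Q, for all n-tuples of
   such monomials: A m is the coordinate row of m in the basis b, and c is an
   arbitrary scalar. This embeds the (smooth, hence reduced) Hilbert scheme of n
   points on the plane as a locally closed subvariety of projective space: by
   Gotzmann, Hilb^n(P^2) is closed in the Grassmannian of n-dimensional quotients
   of the forms of degree n. *)
Definition plucker n (I : set {mpoly F[2]}) (z : 'rV[F]_#|plucker_index n|) :=
  exists (b : 'I_n -> {mpoly F[2]}) (A : 'X_{1..2 < n.+1} -> 'rV[F]_n) (c : F),
    [/\ quot_basis setT I b,
        forall m : 'X_{1..2 < n.+1}, I ('X_[m] - \sum_j A m 0 j *: b j),
        c != 0 &
        z = \row_s (c * \det (\matrix_(i < n) A ((enum_val s : plucker_index n) i)))].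

Definition hilb_cone n (P : set (set {mpoly F[2]})) :
    set 'rV[F]_#|plucker_index n| :=
  [set z | exists2 I, P I & plucker I z].

End HilbertScheme.

(* The convention d_i = 0 for i < 0 is only used for i = -1. *)
Definition Hext (H : nat -> nat) (i : int) : nat :=
  if i is Posz j then H j else 0.

(* The value is -1 when no i qualifies, which covers H = 0. *)
Definition eta_index (k : nat) (H : nat -> nat) : int :=
  xget (-1) [set e : int | exists i : nat, [/\ e = i%:Z, H i = (i %/ k).+1 &
    forall j, H j = (j %/ k).+1 -> (j <= i)%N]].

Definition tau (k : nat) (i : int) : nat := (k %| i + 1)%Z.

(* Main.v *)
Require Import Defs.
From HB Require Import structures.
From mathcomp Require Import all_boot all_order all_algebra.
From mathcomp Require Import perm generic_quotient.
From mathcomp Require Import boolp classical_sets cardinality fsbigop reals.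
From mathcomp Require Import ssrcomplements freeg mpoly complex ring zify.

(* Call a function between affine spaces definable if it is built from the
   coordinates by +, * and inversion with 0^-1 = 0, so that zero tests are
   allowed. A definable subset of an affine space is constructible, its class in
   K_0 is invariant under definable bijections, and a quasi-projective variety
   has the class of its set of representatives with first nonzero coordinate 1.

   A quasi-homogeneous ideal consists of its graded parts V_i, where V_i is a
   space of polynomials in y of bounded degree (dehomogenize x), V_i is contained
   in V_(i+1) and y V_i in V_(i+k). Passing to Plucker coordinates is a definable
   bijection onto the space X(e) of such ideals with dim V_i = e_i, so it remains
   to compute the class of X(e). Count the pairs V_j <= W, with W of dimension
   e_j + m inside the socle { u | x u in V_(j+1), y u in V_(j+k) }, in two ways:
   over X(e), W is an m-dimensional subspace of the socle of the quotient; over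
   X(e + m delta_j), V_j is a subspace of W of codimension m containing the part
   V_(j-1) + y V_(j-k) generated in lower degree, whose dimension is fixed by the
   socle in degree j - 1 - k. This relates the q-binomial moments of the strata of
   fixed socle dimension in degree j of X(e) to those in degree j - 1 - k of
   X(e + m delta_j). The moments determine the strata, since the system is
   triangular, and induction on the colength gives both the class of X(e) and
   those of its strata. *)

Set Implicit Arguments.
Unset Strict Implicit.
Unset Printing Implicit Defensive.

Import Order.TTheory GRing.Theory Num.Theory.
Local Open Scope ring_scope.
Local Open Scope classical_set_scope.

(** * Classes of constructible sets *)

Section AffineCones.
Variable F : closedFieldType.
Implicit Types N M : nat.

Lemma K0class_iso m l (X : qproj F m) (Y : qproj F l) :
  isomorphic X Y -> K0class X = K0class Y.
Proof. by move=> h; apply/eqP/K0relP; apply: (@K0rel_iso _ (QPVar X) (QPVar Y)). Qed.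

Lemma K0class_ext m (X Y : qproj F m) : qpts X = qpts Y -> K0class X = K0class Y.
Proof. by move=> e; apply: K0class_iso; rewrite e; apply: iso_refl. Qed.

Lemma K0class_scissor m (X Y U : qproj F m) (Z : set 'rV[F]_m) :
  proj_closed Z -> qpts Y = X `&` Z -> qpts U = X `\` Z ->
  K0class X = K0class Y + K0class U.
Proof.
move=> hZ hY hU; apply/eqP; rewrite -subr_eq0 opprD addrA /K0class -!pi_K0B.
rewrite -(raddf0 (\pi_(K0 F)%qT)); apply/eqP/eqP/K0relP; rewrite subr0.
exact: K0rel_scissor hZ hY hU.
Qed.

Lemma K0class_set0 m (X : qproj F m) : qpts X = set0 -> K0class X = 0.
Proof.
move=> X0; have := @K0class_scissor _ X X X _ (proj_closed_nz F m).
by rewrite X0 set0I set0D => /(_ erefl erefl) /eqP; rewrite -subr_eq0 opprD addNKr oppr_eq0 => /eqP.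
Qed.

Lemma closed_coneI m (A B : set 'rV[F]_m) :
  proj_closed A -> proj_closed B -> proj_closed (A `&` B).
Proof.
move=> [E hE ->] [E' hE' ->]; exists (E `|` E').
  by move=> f [/hE|/hE'].
apply/seteqP; split=> v.
  by move=> [[v0 h] [_ h']]; split=> // f [/h|/h'].
by move=> [v0 h]; split; split=> // f Ef; apply: h; [left|right].
Qed.

Lemma homogM m (f g : {mpoly F[m]}) :
  f \is homog mdeg -> g \is homog mdeg -> f * g \is homog mdeg.
Proof.
by move=> /homogP [d hf] /homogP [e hg]; apply/homogP; exists (d + e)%N; apply: dhomogM.
Qed.

Lemma closed_coneU m (A B : set 'rV[F]_m) :
  proj_closed A -> proj_closed B -> proj_closed (A `|` B).
Proof.
move=> [E hE ->] [E' hE' ->]; exists [set h | exists f g, [/\ E f, E' g & h = f * g]].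
  by move=> _ [f [g [/hE hf /hE' hg ->]]]; apply: homogM.
apply/seteqP; split=> v.
  move=> [] [v0 h]; split=> // _ [f [g [Ef Eg ->]]]; rewrite mevalM.
    by rewrite (h _ Ef) mul0r.
  by rewrite (h _ Eg) mulr0.
move=> [v0 h]; case: (pselect (closed_cone E v)) => [|nE]; first by left.
right; split=> // g E'g; apply/eqP/negPn/negP => gv; apply: nE; split=> // f Ef.
have /eqP : (f * g).@[v 0] = 0 by apply: h; exists f, g.
by rewrite mevalM mulf_eq0 (negPf gv) orbF => /eqP.
Qed.

Lemma locally_closedI m (X : qproj F m) (Z : set 'rV[F]_m) :
  proj_closed Z -> locally_closed (X `&` Z).
Proof.
move=> hZ; have [A [B [hA hB ->]]] := qprojP X; exists (A `&` Z), B; split=> //.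
  exact: closed_coneI.
by apply/seteqP; split=> v [[? ?] ?].
Qed.

Lemma locally_closedD m (X : qproj F m) (Z : set 'rV[F]_m) :
  proj_closed Z -> locally_closed (X `\` Z).
Proof.
move=> hZ; have [A [B [hA hB ->]]] := qprojP X; exists A, (B `|` Z); split=> //.
  exact: closed_coneU.
by rewrite setDDl.
Qed.

Definition dehomv N (w : 'rV[F]_N.+1) : 'rV[F]_N :=
  \row_(i < N) (w 0 (fintype.lift ord0 i) / w 0 0).

Definition homv N (v : 'rV[F]_N) : 'rV[F]_N.+1 :=
  \row_i (if unlift ord0 i is Some j then v 0 j else 1).

Lemma hom0 N (v : 'rV[F]_N) : homv v 0 0 = 1.
Proof. by rewrite mxE fintype.unlift_none. Qed.

Lemma homS N (v : 'rV[F]_N) i : homv v 0 (fintype.lift ord0 i) = v 0 i.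
Proof. by rewrite mxE fintype.liftK. Qed.

Lemma homK N (v : 'rV[F]_N) : dehomv (homv v) = v.
Proof. by apply/rowP => i; rewrite mxE hom0 homS divr1. Qed.

Lemma dehomK N (w : 'rV[F]_N.+1) : w 0 0 != 0 -> homv (dehomv w) = (w 0 0)^-1 *: w.
Proof.
move=> w0; apply/rowP => i; rewrite [RHS]mxE; case: (fintype.unliftP ord0 i) => [j ->|->].
  by rewrite homS mxE mulrC.
by rewrite hom0 mulVf.
Qed.

Lemma dehomZ N c (w : 'rV[F]_N.+1) : c != 0 -> dehomv (c *: w) = dehomv w.
Proof.
by move=> c0; apply/rowP => i; rewrite !mxE -mulf_div divff ?mul1r.
Qed.

Definition hmg N D (p : {mpoly F[N]}) : {mpoly F[N.+1]} :=
  \sum_(m <- msupp p) p@_m *: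
    ('X_0 ^+ (D - mdeg m) * \prod_i 'X_(fintype.lift ord0 i) ^+ m i).

Lemma hmgE N D (p : {mpoly F[N]}) (w : 'rV[F]_N.+1) : (msize p <= D.+1)%N ->
  w 0 0 != 0 -> (hmg D p).@[w 0] = w 0 0 ^+ D * p.@[dehomv w 0].
Proof.
move=> hD w0; rewrite /hmg raddf_sum /= mevalE mulr_sumr !big_seq.
apply: eq_bigr => m /msize_mdeg_lt /leq_trans /(_ hD); rewrite ltnS => hm.
rewrite mevalZ mulrCA; congr (_ * _); rewrite mevalM rmorphXn /= mevalXU.
rewrite rmorph_prod /=; under [X in _ * X]eq_bigr do rewrite rmorphXn /= mevalXU.
rewrite -[in RHS](subnK hm) exprD -mulrA; congr (_ * _).
rewrite mdegE -prodrXr -big_split /=; apply: eq_bigr => i _.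
by rewrite -exprMn mxE mulrC divfK.
Qed.

Lemma hmg_homog N D (p : {mpoly F[N]}) : (msize p <= D.+1)%N ->
  hmg D p \is D.-homog.
Proof.
move=> hD; rewrite /hmg big_seq; apply: rpred_sum => m /msize_mdeg_lt.
move=> /leq_trans /(_ hD); rewrite ltnS => hm; apply: rpredZ.
have {2}-> : D = (D - mdeg m + mdeg m)%N by rewrite subnK.
apply: dhomogM; first by have := dhomogMn (D - mdeg m) (homogX F (0 : 'I_N.+1)); rewrite mul1n.
rewrite mdegE; elim/big_rec2: _ => [|i q e _ h]; first exact: dhomog1.
by apply: dhomogM => //; have := dhomogMn (m i) (homogX F (fintype.lift ord0 i)); rewrite mul1n.
Qed.

(* The affine space of dimension N is the chart w_0 != 0. *)
Definition acone N (S : 'rV[F]_N -> bool) : set 'rV[F]_N.+1 :=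
  [set w : 'rV[F]_N.+1 | w 0 0 != 0 /\ S (dehomv w)].

Definition bset N (E : seq {mpoly F[N]}) (q : {mpoly F[N]}) (v : 'rV[F]_N) : bool :=
  all (fun p => p.@[v 0] == 0) E && (q.@[v 0] != 0).

Definition pz N (p : {mpoly F[N]}) : set 'rV[F]_N.+1 :=
  closed_cone [set hmg (msize p) p].

Lemma pz_closed N (p : {mpoly F[N]}) : proj_closed (pz p).
Proof.
exists [set hmg (msize p) p] => // _ ->; apply/homogP; exists (msize p).
by apply: hmg_homog.
Qed.

Lemma pzE N (p : {mpoly F[N]}) (w : 'rV[F]_N.+1) : w 0 0 != 0 ->
  pz p w <-> p.@[dehomv w 0] = 0.
Proof.
move=> w0; split=> [[_ /(_ _ erefl)]|pw].
  rewrite hmgE // => /eqP; rewrite mulf_eq0 expf_eq0 (negPf w0) andbF /=.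
  by move=> /eqP.
by split=> [|_ ->]; [apply: (coord_nz w0) | rewrite hmgE // pw mulr0].
Qed.

Lemma chart_lc N : locally_closed (acone (fun _ : 'rV[F]_N => true)).
Proof.
have := locally_closed_open (homog_var F (0 : 'I_N.+1)).
congr locally_closed; apply/seteqP; split=> w; rewrite /acone /= mevalXU.
  by case.
by case=> w0 _; split=> //; apply: (coord_nz w0).
Qed.

Definition chart N : qproj F N.+1 := QProj (@chart_lc N).

Definition res0 N (Y : qproj F N.+1) (p : {mpoly F[N]}) : qproj F N.+1 :=
  QProj (locally_closedI Y (pz_closed p)).
Definition res1 N (Y : qproj F N.+1) (p : {mpoly F[N]}) : qproj F N.+1 :=
  QProj (locally_closedD Y (pz_closed p)).

Lemma res_scissor N (Y : qproj F N.+1) p :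
  K0class Y = K0class (res0 Y p) + K0class (res1 Y p).
Proof. exact: K0class_scissor (pz_closed p) _ _. Qed.

(* Decision trees over zero tests of polynomials. *)
Inductive tree N (A : Type) : Type :=
| Leaf of A
| Node of {mpoly F[N]} & tree N A & tree N A.
Arguments Leaf {N A}.
Arguments Node {N A}.

Fixpoint run N A (t : tree N A) (v : 'rV[F]_N) : A :=
  match t with
  | Leaf a => a
  | Node p t0 t1 => if p.@[v 0] == 0 then run t0 v else run t1 v
  end.

Fixpoint tbind N A B (t : tree N A) (f : A -> tree N B) : tree N B :=
  match t with
  | Leaf a => f a
  | Node p t0 t1 => Node p (tbind t0 f) (tbind t1 f)
  end.

Lemma run_bind N A B (t : tree N A) (f : A -> tree N B) v :
  run (tbind t f) v = run (f (run t v)) v.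
Proof. by elim: t => //= p t0 -> t1 ->; case: eqP. Qed.

Fixpoint tcls N (Y : qproj F N.+1) (t : tree N bool) : K0 F :=
  match t with
  | Leaf b => if b then K0class Y else 0
  | Node p t0 t1 => tcls (res0 Y p) t0 + tcls (res1 Y p) t1
  end.

Definition inchart N (Y : set 'rV[F]_N.+1) := forall w, Y w -> w 0 0 != 0.

Lemma tcls_sub N (Z Y : qproj F N.+1) (t : tree N bool) : inchart Z ->
  (forall w, qpts Y w -> qpts Z w) ->
  (forall w, qpts Z w -> (qpts Y w <-> run t (dehomv w))) ->
  tcls Z t = K0class Y.
Proof.
elim: t Z Y => [[]|p t0 IH0 t1 IH1] Z Y hZ hY h /=.
- apply: K0class_ext; apply/seteqP; split=> w; first by move=> Zw; apply/(h _ Zw).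
  exact: hY.
- apply/esym/K0class_set0; apply/seteqP; split=> w // Yw.
  by have [/(_ Yw)] := h _ (hY _ Yw).
rewrite (res_scissor Y p); congr (_ + _).
- apply: IH0 => [w [/hZ] //|w [Yw pw]|w [Zw pw] /=].
    by split=> //; apply: hY.
  have w0 := hZ _ Zw; have [h1 h2] := h _ Zw.
  move: h1 h2; rewrite /= (pzE p w0).1 // eqxx => h1 h2.
  by split=> [[/h1]|/h2 Yw].
- apply: IH1 => [w [/hZ] //|w [Yw pw]|w [Zw pw] /=].
    by split=> //; apply: hY.
  have w0 := hZ _ Zw; have [h1 h2] := h _ Zw.
  move: h1 h2 => /=; case: eqP => [/(pzE p w0) //|_] h1 h2.
  by split=> [[/h1]|/h2 Yw].
Qed.

Lemma tcls_split N (Z : qproj F N.+1) (t : tree N bool) p : inchart Z ->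
  tcls Z t = tcls (res0 Z p) t + tcls (res1 Z p) t.
Proof.
have ce (Y Y' : qproj F N.+1) s : qpts Y = qpts Y' -> tcls Y s = tcls Y' s.
  elim: s Y Y' => [[]|q s0 IH0 s1 IH1] Y Y' e //=; first exact: K0class_ext.
  by congr (_ + _); [apply: IH0 | apply: IH1]; rewrite /= e.
elim: t Z => [[]|q t0 IH0 t1 IH1] Z hZ /=; first exact: res_scissor.
  by rewrite addr0.
rewrite IH0 => [|w [/hZ] //]; rewrite [X in _ + X]IH1 => [|w [/hZ] //].
rewrite addrACA; congr (_ + _ + (_ + _)); apply: ce; rewrite /=.
- by rewrite setIAC.
- by apply/seteqP; split=> w [[? ?] ?].
- by apply/seteqP; split=> w [[? ?] ?].
- by rewrite !setDDl setUC.
Qed.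

Lemma tcls_eq N (Z : qproj F N.+1) (t t' : tree N bool) : inchart Z ->
  (forall w, qpts Z w -> run t (dehomv w) = run t' (dehomv w)) ->
  tcls Z t = tcls Z t'.
Proof.
elim: t Z => [[]|p t0 IH0 t1 IH1] Z hZ h.
- by rewrite [RHS](@tcls_sub _ Z Z) // => w Zw; rewrite -h.
- have lc0 : locally_closed (set0 : set 'rV[F]_N.+1).
    by have := locally_closedD Z (proj_closed_nz F N.+1);
      rewrite (_ : _ `\` _ = set0) //; apply/seteqP; split=> w // [/qproj_neq0 ? []].
  rewrite [RHS](@tcls_sub _ Z (QProj lc0)) //.
    by rewrite [RHS]K0class_set0.
  by move=> w Zw; rewrite -h.
rewrite (tcls_split t' p) //=; congr (_ + _).
  apply: IH0 => [w [/hZ] //|w [Zw /(pzE p (hZ _ Zw)) pw]].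
  by rewrite -h //= pw eqxx.
apply: IH1 => [w [/hZ] //|w [Zw pw]].
by rewrite -h //=; case: eqP => // /(pzE p (hZ _ Zw)).
Qed.

Definition cble N (S : 'rV[F]_N -> bool) := exists t : tree N bool, S =1 run t.

Definition amu N (S : 'rV[F]_N -> bool) : K0 F :=
  if pselect (cble S) is left h then tcls (chart N) (projT1 (cid h)) else 0.

Lemma amuE N (S : 'rV[F]_N -> bool) t : S =1 run t -> amu S = tcls (chart N) t.
Proof.
move=> h; rewrite /amu; case: pselect => [h'|[]]; last by exists t.
by case: cid => t' /= h''; apply: tcls_eq => [w []|w _] //; rewrite -h -h''.
Qed.

Lemma amu_lc N (S : 'rV[F]_N -> bool) (Y : qproj F N.+1) :
  cble S -> qpts Y = acone S -> amu S = K0class Y.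
Proof.
move=> [t h] eY; rewrite (amuE h); apply: tcls_sub => [w [] //||].
  by move=> w; rewrite eY => -[w0 _]; split.
by move=> w [w0 _]; rewrite eY /acone /= -h; split=> [[]|].
Qed.

Lemma amu_split N (S C : 'rV[F]_N -> bool) : cble S -> cble C ->
  amu S = amu (fun v => S v && C v) + amu (fun v => S v && ~~ C v).
Proof.
move=> [t h] [c hc].
pose f g := tbind t (fun b => tbind c (fun b' => Leaf (b && g b'))) : tree N bool.
have fE g v : run (f g) v = S v && g (C v) by rewrite /f !run_bind /= h hc.
rewrite (amuE h) (@amuE _ _ (f id)); last by move=> v; rewrite fE.
rewrite (@amuE _ _ (f negb)); last by move=> v; rewrite fE.
have {h} h0 v : run t v = S v by rewrite h.
have {hc} : forall w, qpts (chart N) w -> C (dehomv w) = run c (dehomv w) by [].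
have : inchart (qpts (chart N)) by move=> w [].
move: (chart N) => Z hZ; move: (f id) (fE id) (f negb) (fE negb) => {f fE} t1 h1 t2 h2.
elim: c Z hZ => [b|p c0 IH0 c1 IH1] Z hZ hC.
  have E0 t' : (forall w, qpts Z w -> run t' (dehomv w) = false) -> tcls Z t' = 0.
    by move=> e; rewrite (@tcls_eq _ _ _ (Leaf false)).
  case: b hC => hC.
    rewrite (E0 t2) ?addr0; last by move=> w Zw; rewrite h2 hC ?andbF.
    by apply: tcls_eq => // w Zw; rewrite h1 h0 hC ?andbT.
  rewrite (E0 t1) ?add0r; last by move=> w Zw; rewrite h1 hC ?andbF.
  by apply: tcls_eq => // w Zw; rewrite h2 h0 hC ?andbT.
rewrite !(tcls_split _ p hZ) addrACA IH0 ?IH1 //.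
- by move=> w [/hZ].
- by move=> w [Zw pw]; rewrite hC //=; case: eqP => // /(pzE p (hZ _ Zw)).
- by move=> w [/hZ].
- by move=> w [Zw /(pzE p (hZ _ Zw)) pw]; rewrite hC //= pw eqxx.
Qed.

End AffineCones.
Arguments Leaf {F N A}.
Arguments Node {F N A}.

(** * Definable sets and maps *)

Section Definable.
Variable F : closedFieldType.

(* Types identified with an affine space. *)
Structure dtype := DType {
  dsort :> Type;
  ddim : nat;
  dpk : dsort -> 'rV[F]_ddim;
  dup : 'rV[F]_ddim -> dsort;
  dpkK : cancel dpk dup;
  dupK : cancel dup dpk }.

Definition rv_dtype N := @DType 'rV[F]_N N id id (fun _ => erefl) (fun _ => erefl).

Canonical mx_dtype m n := @DType 'M[F]_(m, n) (m * n) mxvec vec_mx (@mxvecK F m n) (@vec_mxK F m n).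

Section Prod.
Variables T U : dtype.
Definition prod_pk (x : T * U) : 'rV[F]_(ddim T + ddim U) := row_mx (dpk x.1) (dpk x.2).
Definition prod_up (v : 'rV[F]_(ddim T + ddim U)) : T * U := (dup (lsubmx v), dup (rsubmx v)).
Lemma prod_pkK : cancel prod_pk prod_up.
Proof. by case=> t u; rewrite /prod_up row_mxKl row_mxKr !dpkK. Qed.
Lemma prod_upK : cancel prod_up prod_pk.
Proof. by move=> v; rewrite /prod_pk /= !dupK hsubmxK. Qed.
Canonical prod_dtype := DType prod_pkK prod_upK.
End Prod.

(* As 0^-1 = 0, the function x * x^-1 tests whether x is zero. *)
Inductive dfun (T : dtype) : (T -> F) -> Prop :=
| dfun_coord i : dfun (fun t => dpk t 0 i)
| dfun_const c : dfun (fun _ => c)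
| dfun_add f g : dfun f -> dfun g -> dfun (fun t => f t + g t)
| dfun_mul f g : dfun f -> dfun g -> dfun (fun t => f t * g t)
| dfun_inv f : dfun f -> dfun (fun t => (f t)^-1).

Lemma dfun_ext (T : dtype) (f g : T -> F) : f =1 g -> dfun f -> dfun g.
Proof. by move=> /funext ->. Qed.

Definition dmap (T U : dtype) (g : T -> U) := forall i, dfun (fun t => dpk (g t) 0 i).

Lemma dfun_comp (T U : dtype) (g : T -> U) (f : U -> F) :
  dmap g -> dfun f -> dfun (fun t => f (g t)).
Proof.
move=> hg; elim=> [i|c|f1 f2 _ h1 _ h2|f1 f2 _ h1 _ h2|f1 _ h1].
- exact: hg.
- exact: dfun_const.
- exact: dfun_add.
- exact: dfun_mul.
- exact: dfun_inv.
Qed.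

Definition dpred (T : dtype) (S : T -> bool) := dfun (fun t => (S t)%:R).

Lemma dfun_opp (T : dtype) (f : T -> F) : dfun f -> dfun (fun t => - f t).
Proof. by move=> h; apply: dfun_ext (dfun_mul (dfun_const T (-1)) h) => t; rewrite mulN1r. Qed.

Lemma dfun_sum (T : dtype) (I : Type) (r : seq I) (P : pred I) (f : I -> T -> F) :
  (forall i, dfun (f i)) -> dfun (fun t => \sum_(i <- r | P i) f i t).
Proof.
move=> h; elim: r => [|i r IH].
  by apply: dfun_ext (dfun_const T 0) => t; rewrite big_nil.
case Pi: (P i).
  by apply: dfun_ext (dfun_add (h i) IH) => t; rewrite big_cons Pi.
by apply: dfun_ext IH => t; rewrite big_cons Pi.
Qed.

Lemma dfun_prod (T : dtype) (I : Type) (r : seq I) (P : pred I) (f : I -> T -> F) :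
  (forall i, dfun (f i)) -> dfun (fun t => \prod_(i <- r | P i) f i t).
Proof.
move=> h; elim: r => [|i r IH].
  by apply: dfun_ext (dfun_const T 1) => t; rewrite big_nil.
case Pi: (P i).
  by apply: dfun_ext (dfun_mul (h i) IH) => t; rewrite big_cons Pi.
by apply: dfun_ext IH => t; rewrite big_cons Pi.
Qed.

Lemma dfun_exp (T : dtype) (f : T -> F) n : dfun f -> dfun (fun t => f t ^+ n).
Proof.
move=> h; elim: n => [|n IH]; first exact: dfun_const.
by apply: dfun_ext (dfun_mul h IH) => t; rewrite exprS.
Qed.

Lemma dfun_meval (T : dtype) N (p : {mpoly F[N]}) (f : T -> 'I_N -> F) :
  (forall i, dfun (fun t => f t i)) -> dfun (fun t => p.@[f t]).
Proof.
move=> h; apply: (@dfun_ext _ (fun t => \sum_(m <- msupp p) p@_m * \prod_i f t i ^+ m i)).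
  by move=> t; rewrite mevalE.
apply: dfun_sum => m; apply: dfun_mul; first exact: dfun_const.
by apply: dfun_prod => i; apply: dfun_exp.
Qed.

Lemma dpred_neq0 (T : dtype) (f : T -> F) : dfun f -> dpred (fun t => f t != 0).
Proof.
move=> h; apply: dfun_ext (dfun_mul h (dfun_inv h)) => t /=.
by have [->|f0] := eqVneq; rewrite ?mul0r // mulfV.
Qed.

Lemma dpredN (T : dtype) (S : T -> bool) : dpred S -> dpred (fun t => ~~ S t).
Proof.
move=> h; apply: dfun_ext (dfun_add (dfun_const T 1) (dfun_opp h)) => t.
by case: (S t); rewrite ?subrr ?subr0.
Qed.

Lemma dpred_eq0 (T : dtype) (f : T -> F) : dfun f -> dpred (fun t => f t == 0).
Proof. by move=> /dpred_neq0/dpredN; apply: dfun_ext => t; rewrite negbK. Qed.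

Lemma dpred_eq (T : dtype) (f g : T -> F) : dfun f -> dfun g -> dpred (fun t => f t == g t).
Proof.
move=> hf hg; apply: dfun_ext (dpred_eq0 (dfun_add hf (dfun_opp hg))) => t.
by rewrite subr_eq0.
Qed.

Lemma dpredI (T : dtype) (S S' : T -> bool) :
  dpred S -> dpred S' -> dpred (fun t => S t && S' t).
Proof. by move=> h h'; apply: dfun_ext (dfun_mul h h') => t; rewrite -natrM mulnb. Qed.

Lemma dpred_const (T : dtype) b : dpred (fun _ : T => b).
Proof. exact: dfun_const. Qed.

Lemma dpred_all (T : dtype) (I : Type) (r : seq I) (S : I -> T -> bool) :
  (forall i, dpred (S i)) -> dpred (fun t => all (S^~ t) r).
Proof. by move=> h; elim: r => [|i r IH] /=; [apply: dpred_const | apply: dpredI]. Qed.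

Lemma dpred_forall (T : dtype) (I : finType) (S : I -> T -> bool) :
  (forall i, dpred (S i)) -> dpred (fun t => [forall i, S i t]).
Proof.
move=> h; have -> : (fun t => [forall i, S i t]) = (fun t => all (S^~ t) (enum I)).
  by apply/funext => t; apply/forallP/allP => H i; rewrite ?H // mem_enum.
exact: dpred_all.
Qed.

Lemma dpred_comp (T U : dtype) (g : T -> U) (S : U -> bool) :
  dmap g -> dpred S -> dpred (fun t => S (g t)).
Proof. exact: (dfun_comp (f := fun u => (S u)%:R)). Qed.

Lemma dmap_comp (T U V : dtype) (g : T -> U) (h : U -> V) :
  dmap g -> dmap h -> dmap (fun t => h (g t)).
Proof. by move=> hg hh i; apply: (dfun_comp (f := fun u => dpk (h u) 0 i)). Qed.

Lemma dmap_id (T : dtype) : dmap (fun t : T => t).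
Proof. by move=> i; apply: dfun_coord. Qed.

Lemma dmap_fst (T U : dtype) : dmap (fun x : T * U => x.1).
Proof.
move=> i; apply: (@dfun_ext (prod_dtype T U) (fun x => dpk x 0 (lshift _ i))).
  by move=> x; rewrite /= row_mxEl.
exact: dfun_coord.
Qed.

Lemma dmap_snd (T U : dtype) : dmap (fun x : T * U => x.2).
Proof.
move=> i; apply: (@dfun_ext (prod_dtype T U) (fun x => dpk x 0 (rshift _ i))).
  by move=> x; rewrite /= row_mxEr.
exact: dfun_coord.
Qed.

Lemma dmap_pair (T U V : dtype) (f : T -> U) (g : T -> V) :
  dmap f -> dmap g -> dmap (fun t => (f t, g t)).
Proof.
move=> hf hg i; case: (split_ordP i) => j ->.
  by apply: dfun_ext (hf j) => t; rewrite /= /prod_pk row_mxEl.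
by apply: dfun_ext (hg j) => t; rewrite /= /prod_pk row_mxEr.
Qed.

Definition dmx (T : dtype) m n (A : T -> 'M[F]_(m, n)) :=
  forall i j, dfun (fun t => A t i j).

Lemma dmap_mx (T : dtype) m n (A : T -> 'M[F]_(m, n)) :
  dmx A -> dmap (U := mx_dtype m n) A.
Proof.
move=> hA k; case/mxvec_indexP: k => i j.
by apply: dfun_ext (hA i j) => t; rewrite /= mxvecE.
Qed.

Lemma dmx_dmap (T : dtype) m n (A : T -> 'M[F]_(m, n)) :
  dmap (U := mx_dtype m n) A -> dmx A.
Proof.
move=> hA i j; apply: dfun_ext (hA (mxvec_index i j)) => t.
by rewrite /= mxvecE.
Qed.

Lemma dmx_comp (T U : dtype) m n (g : T -> U) (A : U -> 'M[F]_(m, n)) :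
  dmap g -> dmx A -> dmx (fun t => A (g t)).
Proof. by move=> hg hA i j; apply: (dfun_comp (f := fun u => A u i j)). Qed.

Definition tleaf N (f : 'rV[F]_N -> F) (v : 'rV[F]_N) (PQ : {mpoly F[N]} * {mpoly F[N]}) :=
  PQ.2.@[v 0] != 0 /\ f v = PQ.1.@[v 0] / PQ.2.@[v 0].

Lemma dfun_tree (T : dtype) (f : T -> F) : dfun f ->
  exists t : tree F (ddim T) ({mpoly F[ddim T]} * {mpoly F[ddim T]}),
    forall v, tleaf (fun v => f (dup v)) v (run t v).
Proof.
rewrite /tleaf; elim=> [i|c|g h _ [s hs] _ [t ht]|g h _ [s hs] _ [t ht]|g _ [s hs]].
- exists (Leaf ('X_i, 1)) => v /=; rewrite meval1 oner_eq0 mevalXU divr1 dupK.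
  by split.
- by exists (Leaf (c%:MP, 1)) => v /=; rewrite meval1 oner_eq0 mevalC divr1.
- exists (tbind s (fun a => tbind t (fun b => Leaf (a.1 * b.2 + b.1 * a.2, a.2 * b.2)))).
  move=> v; rewrite !run_bind /= !(mevalM, mevalD); have [s0 ->] := hs v; have [t0 ->] := ht v.
  by rewrite mulf_neq0 // addf_div.
- exists (tbind s (fun a => tbind t (fun b => Leaf (a.1 * b.1, a.2 * b.2)))).
  move=> v; rewrite !run_bind /= !mevalM; have [s0 ->] := hs v; have [t0 ->] := ht v.
  by rewrite mulf_neq0 // mulf_div.
- exists (tbind s (fun a => Node a.1 (Leaf (0, 1)) (Leaf (a.2, a.1)))).
  move=> v; rewrite !run_bind /=; have [s0 ->] := hs v.
  have [e|e] := eqVneq (run s v).1.@[v 0] 0.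
    by rewrite /= meval1 meval0 e !mul0r invr0 oner_eq0.
  by rewrite /= e invf_div.
Qed.

Lemma dmap_tree (T U : dtype) (f : T -> U) : dmap f ->
  exists t : tree F (ddim T) (('I_(ddim U) -> {mpoly F[ddim T]}) * {mpoly F[ddim T]}),
    forall v : 'rV[F]_(ddim T), (run t v).2.@[v 0] != 0 /\
      forall i, dpk (f (dup v)) 0 i = ((run t v).1 i).@[v 0] / (run t v).2.@[v 0].
Proof.
move=> hf; suff [t ht] : exists t : tree F (ddim T) (('I_(ddim U) -> {mpoly F[ddim T]}) * {mpoly F[ddim T]}),
    forall v : 'rV[F]_(ddim T), (run t v).2.@[v 0] != 0 /\
      forall i, i \in enum 'I_(ddim U) -> dpk (f (dup v)) 0 i = ((run t v).1 i).@[v 0] / (run t v).2.@[v 0].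
  by exists t => v; have [h0 h] := ht v; split=> // i; apply: h; rewrite mem_enum.
elim: (enum _) => [|i r [t ht]].
  by exists (Leaf (fun _ => 0, 1)) => v; rewrite meval1 oner_eq0.
have [s hs] := dfun_tree (hf i).
exists (tbind s (fun a => tbind t (fun b =>
  Leaf (fun j => if j == i then a.1 * b.2 else b.1 j * a.2, a.2 * b.2)))) => v.
rewrite !run_bind /=; have [s0 es] := hs v; have [t0 et] := ht v.
rewrite mevalM mulf_neq0 //; split=> // j; rewrite inE.
have [-> _|_ /= /et ->] := eqVneq; rewrite mevalM.
  by rewrite es -mulf_div divff // mulr1.
by rewrite invfM mulrA mulfK.
Qed.

Lemma dpred_cble (T : dtype) (S : T -> bool) : dpred S -> cble (fun v => S (dup v)).
Proof.
move=> /dfun_tree [t ht].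
exists (tbind t (fun a => Node a.1 (Leaf false) (Leaf true))) => v.
rewrite run_bind /=; have [h0] := ht v; case: (S _) => [] e; last first.
  by move/esym/eqP: e; rewrite mulf_eq0 invr_eq0 (negPf h0) orbF => ->.
case: eqP => // e'; move: e; rewrite e' mul0r => /eqP; by rewrite oner_eq0.
Qed.

Definition mu (T : dtype) (S : T -> bool) : K0 F := amu (fun v => S (dup v)).

Lemma mu_ext (T : dtype) (S S' : T -> bool) : S =1 S' -> mu S = mu S'.
Proof. by move=> /funext ->. Qed.

Lemma mu_split (T : dtype) (S C : T -> bool) : dpred S -> dpred C ->
  mu S = mu (fun t => S t && C t) + mu (fun t => S t && ~~ C t).
Proof. by move=> /dpred_cble hS /dpred_cble hC; apply: amu_split. Qed.

Lemma mu_false (T : dtype) (S : T -> bool) : (forall t, ~~ S t) -> mu S = 0.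
Proof.
move=> h; rewrite (@mu_ext _ S (fun _ => false)) => [|t]; last exact/negbTE.
by rewrite /mu (@amuE _ _ _ (Leaf false)).
Qed.

Lemma bset_ind N (A : Type) (t : tree F N A) (Phi : ('rV[F]_N -> bool) -> Prop) :
  (forall S p, Phi (fun v => S v && (p.@[v 0] == 0)) ->
     Phi (fun v => S v && ~~ (p.@[v 0] == 0)) -> Phi S) ->
  (forall E q a, (forall v, bset E q v -> run t v = a) -> Phi (bset E q)) ->
  Phi (fun _ => true).
Proof.
move=> hsplit hleaf; have -> : (fun _ => true) = bset [::] (1 : {mpoly F[N]}).
  by apply/funext => v; rewrite /bset meval1 oner_eq0.
have {hleaf} : forall E q a, (forall v, bset E q v -> bset [::] (1 : {mpoly F[N]}) v) ->
    (forall v, bset E q v -> run t v = a) -> Phi (bset E q).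
  by move=> E q a _; apply: hleaf.
move: [::] (1 : {mpoly F[N]}); elim: t => [a|p t0 IH0 t1 IH1] E q hleaf.
  exact: (hleaf _ _ a).
apply: (hsplit _ p).
  suff -> : (fun v => bset E q v && (p.@[v 0] == 0)) = bset (p :: E) q.
    apply: IH0 => E' q' a h h'; apply: (hleaf _ _ a) => v /[dup] /h'.
      by move=> _ /h /andP [/andP [_ ? ?]]; apply/andP.
    by move=> e /h /andP [/andP [/= -> _ _]].
  by apply/funext => v; rewrite /bset /= andbC andbA.
suff -> : (fun v => bset E q v && ~~ (p.@[v 0] == 0)) = bset E (q * p).
  apply: IH1 => E' q' a h h'; apply: (hleaf _ _ a) => v /[dup] /h'.
    by move=> _ /h /andP [E'v]; rewrite mevalM mulf_eq0 negb_or /bset E'v => /andP [].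
  by move=> e /h /andP [_]; rewrite mevalM mulf_eq0 negb_or /= => /andP [_ /negbTE ->].
by apply/funext => v; rewrite /bset mevalM mulf_eq0 negb_or andbA.
Qed.

Lemma bset_lc N (E : seq {mpoly F[N]}) q :
  exists Y : qproj F N.+1, qpts Y = acone (bset E q).
Proof.
elim: E => [|p E [Y hY]].
  exists (res1 (chart F N) q); apply/seteqP; split=> w.
    by move=> [[w0 _] nq]; split=> //; apply/eqP => /(pzE q w0).
  by move=> [w0] /eqP nq; split=> // /(pzE q w0).
exists (res0 Y p); apply/seteqP; rewrite /= hY; split=> w.
  by move=> [[w0 h] /(pzE p w0) e]; split=> //; rewrite /bset /= e eqxx.
move=> [w0]; rewrite /bset /= -andbA => /andP [/eqP e h]; split=> //.
exact/(pzE p w0).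
Qed.

Lemma dfun_rv N i : dfun (T := rv_dtype N) (fun v : 'rV[F]_N => v 0 i).
Proof. exact (@dfun_coord (rv_dtype N) i). Qed.

Lemma cble_bset N (E : seq {mpoly F[N]}) q : cble (bset E q).
Proof.
have hp (p : {mpoly F[N]}) : dfun (T := rv_dtype N) (fun v : 'rV[F]_N => p.@[v 0]).
  by apply: (@dfun_meval (rv_dtype N)) => i; apply: dfun_rv.
apply: (@dpred_cble (rv_dtype N) (bset E q)); apply: (@dpredI (rv_dtype N)).
  apply: (@dpred_all (rv_dtype N) _ E (fun p (v : 'rV[F]_N) => p.@[v 0] == 0)) => p.
  exact: dpred_eq0 (hp p).
exact: dpred_neq0 (hp q).
Qed.

Lemma bset_regular N M E q E' q' (f : 'rV[F]_N -> 'rV[F]_M)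
    (P : 'I_M -> {mpoly F[N]}) (Q : {mpoly F[N]}) :
  (forall v, bset E q v -> [/\ bset E' q' (f v), Q.@[v 0] != 0 &
     forall i, f v 0 i = (P i).@[v 0] / Q.@[v 0]]) ->
  regular_map (acone (bset E q)) (acone (bset E' q')) (fun w => homv (f (dehomv w))).
Proof.
move=> h; split=> [w [w0 /h [h' _ _]]|p [p0 /h [_ Qp _]]].
  by split; rewrite ?hom0 ?oner_eq0 ?homK.
pose D := (msize Q + \sum_i msize (P i))%N.
have hP i : (msize (P i) <= D.+1)%N.
  by rewrite /D (bigD1 i) //= addnCA -addnS leq_addr.
have hQ : (msize Q <= D.+1)%N by rewrite /D -addnS leq_addr.
exists D, (fun i => if fintype.unlift ord0 i is Some j then hmg D (P j) else hmg D Q), (hmg D Q).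
split=> [i||| w [w0 /h [_ Qw e]] _].
- by case: fintype.unliftP => [j|] _; apply: hmg_homog.
- by apply/homogP; exists D; apply: hmg_homog.
- by rewrite hmgE // mulf_neq0 // expf_neq0.
- apply: proj_eq_sym; exists (w 0 0 ^+ D * Q.@[dehomv w 0]).
    by rewrite mulf_neq0 // expf_neq0.
  apply/rowP => i; rewrite !mxE; case: fintype.unliftP => [j|] _; rewrite hmgE //.
    by rewrite e -mulrA [Q.@[_] * _]mulrC divfK.
  by rewrite mulr1.
Qed.

Lemma bset_iso N M E q E' q' (f : 'rV[F]_N -> 'rV[F]_M) (g : 'rV[F]_M -> 'rV[F]_N)
    (P : 'I_M -> {mpoly F[N]}) (Q : {mpoly F[N]})
    (P' : 'I_N -> {mpoly F[M]}) (Q' : {mpoly F[M]}) :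
  (forall v, bset E q v -> [/\ bset E' q' (f v), g (f v) = v, Q.@[v 0] != 0 &
     forall i, f v 0 i = ((P i).@[v 0]) / (Q.@[v 0])]) ->
  (forall v, bset E' q' v -> [/\ bset E q (g v), f (g v) = v, Q'.@[v 0] != 0 &
     forall i, g v 0 i = (P' i).@[v 0] / Q'.@[v 0]]) ->
  amu (bset E q) = amu (bset E' q').
Proof.
move=> hf hg; have [Y hY] := bset_lc E q; have [Y' hY'] := bset_lc E' q'.
rewrite (amu_lc (cble_bset E q) hY) (amu_lc (cble_bset E' q') hY').
apply: K0class_iso; rewrite hY hY'.
exists (fun w => homv (f (dehomv w))), (fun w => homv (g (dehomv w))); split.
- by apply: (@bset_regular _ _ _ _ _ _ f P Q) => v /hf [? _ ? ?]; split.
- by apply: (@bset_regular _ _ _ _ _ _ g P' Q') => v /hg [? _ ? ?]; split.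
- move=> w [w0 /hf [_ e _ _]]; rewrite homK e dehomK //.
  by exists (w 0 0)^-1; rewrite ?invr_eq0.
- move=> w [w0 /hg [_ e _ _]]; rewrite homK e dehomK //.
  by exists (w 0 0)^-1; rewrite ?invr_eq0.
Qed.

(* The numerator of p(P_1/Q, ..., P_M/Q). *)
Definition pull N M (P : 'I_M -> {mpoly F[N]}) (Q : {mpoly F[N]}) (p : {mpoly F[M]}) :=
  hmg (msize p) p \mPo [tuple if fintype.unlift ord0 i is Some j then P j else Q | i < M.+1].

Lemma pull_eq0 N M (P : 'I_M -> {mpoly F[N]}) (Q : {mpoly F[N]}) p v (u : 'rV[F]_M) :
  Q.@[v] != 0 -> (forall i, u 0 i = (P i).@[v] / Q.@[v]) ->
  ((pull P Q p).@[v] == 0) = (p.@[u 0] == 0).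
Proof.
move=> Q0 e; rewrite comp_mpoly_meval.
pose w : 'rV[F]_M.+1 := Q.@[v] *: homv u.
have w0 : w 0 0 = Q.@[v] by rewrite mxE hom0 mulr1.
rewrite (@meval_eq _ _ _ (w 0)) => [|i]; last first.
  rewrite tnth_mktuple; case: (fintype.unliftP ord0 i) => [j ->|->]; last by rewrite w0.
  by rewrite mxE homS e mulrC divfK.
by rewrite hmgE ?w0 // mulf_eq0 expf_eq0 (negPf Q0) andbF /= dehomZ // homK.
Qed.

Lemma bset_preim N M E q E' q' (f : 'rV[F]_N -> 'rV[F]_M)
    (P : 'I_M -> {mpoly F[N]}) (Q : {mpoly F[N]}) :
  (forall v, bset E q v -> Q.@[v 0] != 0 /\
     (forall i, f v 0 i = (P i).@[v 0] / Q.@[v 0])) ->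
  exists E1 q1, forall v, bset E1 q1 v = bset E q v && bset E' q' (f v).
Proof.
move=> h; exists (E ++ map (pull P Q) E'), (q * pull P Q q') => v.
rewrite /bset all_cat mevalM mulf_eq0 negb_or; case Ev: (all _ E) => //=.
case qv: (q.@[v 0] != 0); rewrite /= ?andbF //.
have [|Qv e] := h v; first by rewrite /bset Ev qv.
rewrite (pull_eq0 _ Qv e) all_map; congr (_ && _); apply: eq_all => p /=.
exact: pull_eq0.
Qed.

Lemma mu_bij (T U : dtype) (S : T -> bool) (S' : U -> bool) (f : T -> U) (g : U -> T) :
  dpred S -> dpred S' -> dmap f -> dmap g ->
  (forall t, S t -> S' (f t) /\ g (f t) = t) ->
  (forall u, S' u -> S (g u) /\ f (g u) = u) ->
  mu S = mu S'.
Proof.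
move=> hS hS' hf hg SK S'K.
have [tf htf] := dmap_tree hf; have [tg htg] := dmap_tree hg.
pose dC N (C : 'rV[F]_N -> bool) := dpred (T := rv_dtype N) C.
have dC_comp (V : dtype) (C : 'rV[F]_(ddim V) -> bool) : dC _ C -> dpred (fun t : V => C (dpk t)).
  by apply: (@dpred_comp V (rv_dtype (ddim V))) => i; apply: dfun_coord.
have dC_poly N C (p : {mpoly F[N]}) : dC N C ->
    dC N (fun v => C v && (p.@[v 0] == 0)) /\ dC N (fun v => C v && ~~ (p.@[v 0] == 0)).
  have hp : dpred (T := rv_dtype N) (fun v => p.@[v 0] == 0).
    by apply: dpred_eq0; apply: (@dfun_meval (rv_dtype N)) => i; apply: dfun_rv.
  by move=> hC; split; apply: dpredI => //; apply: dpredN.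
have dC_bset N E q : dC N (bset E q).
  have hp (p : {mpoly F[N]}) : dfun (T := rv_dtype N) (fun v : 'rV[F]_N => p.@[v 0]).
    by apply: (@dfun_meval (rv_dtype N)) => i; apply: dfun_rv.
  apply: (@dpredI (rv_dtype N)); last exact: dpred_neq0 (hp q).
  apply: (@dpred_all (rv_dtype N) _ E (fun p (v : 'rV[F]_N) => p.@[v 0] == 0)) => p.
  exact: dpred_eq0 (hp p).
have [ts hts] := dpred_cble hS.
suff : dC (ddim T) (fun _ => true) ->
    mu (fun t => S t && true) = mu (fun u => S' u && true).
  rewrite (@mu_ext _ (fun t => S t && true) S); last by move=> ?; rewrite andbT.
  rewrite (@mu_ext _ (fun t => S' t && true) S'); last by move=> ?; rewrite andbT.
  by apply; apply: dpred_const.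
pose Phi C := dC _ C -> mu (fun t => S t && C (dpk t)) = mu (fun u => S' u && C (dpk (g u))).
suff H : Phi (fun _ => true) by exact: H.
apply: (@bset_ind _ _ (tbind ts (fun b => tbind tf (fun a => Leaf (b, a)))) Phi).
  move=> C p h0 h1 hC; have [d0 d1] := dC_poly _ _ p hC.
  have hp : dpred (fun t : T => p.@[dpk t 0] == 0).
    by apply: dpred_eq0; apply: dfun_meval => i; apply: dfun_coord.
  rewrite (mu_split (dpredI hS (dC_comp _ _ hC)) hp).
  rewrite [RHS](mu_split (C := fun u => p.@[dpk (g u) 0] == 0)); last first.
  - exact: (dpred_comp hg hp).
  - exact/dpredI/(dpred_comp hg (dC_comp _ _ hC)).
  have asc (V : dtype) (a1 b1 c1 : V -> bool) : mu (fun v : V => a1 v && b1 v && c1 v) = mu (fun v => a1 v && (b1 v && c1 v)).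
    by apply: mu_ext => v; rewrite andbA.
  by rewrite [X in X + _ = _]asc [X in _ + X = _]asc [X in _ = X + _]asc [X in _ = _ + X]asc h0 // h1.
move=> E q [b a] hA dA; rewrite /Phi.
have {hA} hA v : bset E q v -> S (dup v) = b /\ run tf v = a.
  by move=> /hA; rewrite !run_bind /= -hts => -[-> ->].
case: b hA => hA; last first.
  rewrite !mu_false // => t; apply/negP => /andP [].
    by move=> /S'K [St gK] /hA; rewrite dpkK St => -[].
  by move=> St /hA; rewrite dpkK St => -[].
pose S2 u := S' u && bset E q (dpk (g u)).
have hS2 : dpred S2 by apply: dpredI => //; apply: (dpred_comp hg (dC_comp _ _ dA)).
have [t2 ht2] := dpred_cble hS2.
suff : dC (ddim U) (fun _ => true) -> mu (fun t => S t && bset E q (dpk t) && true) = mu (fun u => S2 u && true).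
  rewrite (@mu_ext _ (fun t => S t && bset E q (dpk t) && true) (fun t => S t && bset E q (dpk t))); last by move=> ?; rewrite andbT.
  rewrite (@mu_ext _ (fun t => S2 t && true) S2); last by move=> ?; rewrite andbT.
  by apply; apply: dpred_const.
have hSA := dpredI hS (dC_comp _ _ dA).
pose Psi C := dC _ C -> mu (fun t => S t && bset E q (dpk t) && C (dpk (f t))) = mu (fun u => S2 u && C (dpk u)).
suff H : Psi (fun _ => true) by exact: H.
apply: (@bset_ind _ _ (tbind t2 (fun b => tbind tg (fun a => Leaf (b, a)))) Psi).
  move=> C p h0 h1 hC; have [d0 d1] := dC_poly _ _ p hC.
  have hp : dpred (fun t : U => p.@[dpk t 0] == 0).
    by apply: dpred_eq0; apply: dfun_meval => i; apply: dfun_coord.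
  rewrite (mu_split (C := fun u => p.@[dpk (f u) 0] == 0)); first last.
  - exact: (dpred_comp hf hp).
  - exact/dpredI/(dpred_comp hf (dC_comp _ _ hC)).
  rewrite [RHS](mu_split (dpredI hS2 (dC_comp _ _ hC)) hp).
  have asc (V : dtype) (a1 b1 c1 : V -> bool) : mu (fun v : V => a1 v && b1 v && c1 v) = mu (fun v => a1 v && (b1 v && c1 v)).
    by apply: mu_ext => v; rewrite andbA.
  by rewrite [X in X + _ = _]asc [X in _ + X = _]asc [X in _ = X + _]asc [X in _ = _ + X]asc h0 // h1.
move=> E' q' [b' a'] hB dB; rewrite /Psi.
have {hB} hB v : bset E' q' v -> S2 (dup v) = b' /\ run tg v = a'.
  by move=> /hB; rewrite !run_bind /= -ht2 => -[-> ->].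
case: b' hB => hB; last first.
  rewrite !mu_false // => t; apply/negP => /andP [].
    by move=> S2t /hB; rewrite dpkK S2t => -[].
  move=> /andP [St At] /hB; rewrite dpkK /S2; have [-> ->] := SK _ St.
  by rewrite At => -[].
pose fh v := dpk (f (dup v)); pose gh v := dpk (g (dup v)).
have fhE v : bset E q v -> a.2.@[v 0] != 0 /\ forall i, fh v 0 i = (a.1 i).@[v 0] / a.2.@[v 0].
  by move=> /hA [_ <-]; apply: htf.
have [E1 [q1 h1]] := bset_preim E' q' fhE.
transitivity (amu (bset E1 q1)); last transitivity (amu (bset E' q')).
- congr amu; apply/funext => v; rewrite h1 dupK.
  by case Av: (bset E q v); rewrite ?andbF //= (hA _ Av).1.
- apply: (@bset_iso _ _ _ _ _ _ fh gh a.1 a.2 a'.1 a'.2) => v.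
    rewrite h1 => /andP [Av Bv]; have [a0 e] := fhE _ Av; split=> //.
    by rewrite /gh /fh dpkK; have [_ ->] := SK _ (hA _ Av).1; rewrite dupK.
  move=> Bv; have [] := hB _ Bv; rewrite /S2 => /andP [/S'K [Sg gK] Av] ta.
  have := htg v; rewrite ta => -[? ?].
  have fg : fh (gh v) = v by rewrite /fh /gh dpkK gK dupK.
  by split=> //; rewrite h1 Av fg.
- congr amu; apply/funext => v; rewrite dupK.
  by case Bv: (bset E' q' v); rewrite ?andbF //= (hB _ Bv).1.
Qed.

Lemma mu_point (T : dtype) (t0 : T) (S : T -> bool) : dpred S ->
  (forall t, S t <-> t = t0) -> mu S = 1.
Proof.
move=> hS h; rewrite (@mu_bij T (rv_dtype 0) S (fun _ => true) (fun _ => 0) (fun _ => t0)) //.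
- rewrite /mu (@amuE _ _ _ (Leaf true)) //=; apply: K0class_iso.
  rewrite (_ : qpts _ = pt_var F); first exact: iso_refl.
  apply/seteqP; split=> w [w0] /=; rewrite ?meval1 ?oner_eq0.
    by move=> _; split=> //; apply: coord_nz w0.
  by move=> _; split=> //; case: (nz_coord w0) => i; rewrite ord1.
- exact: dpred_const.
- by move=> i; apply: dfun_const.
- by move=> i; apply: dfun_const.
- by move=> t /h ->.
- by move=> u _; split; [apply/h | apply/rowP => -[]].
Qed.

Lemma regular_forms m l (X : set 'rV[F]_m) (Y : set 'rV[F]_l) d
    (G : 'I_l -> {mpoly F[m]}) (phi : 'rV[F]_m -> 'rV[F]_l) :
  (forall j, G j \is d.-homog) -> (forall v, phi v = \row_j (G j).@[v 0]) ->
  (forall v, X v -> Y (phi v)) -> regular_map X Y phi.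
Proof.
move=> hG hphi XY; split=> // p Xp; exists d, G, 1; split=> //.
- exact: homog_one.
- by rewrite meval1 oner_eq0.
- by move=> v _ _; rewrite hphi; apply: proj_eq_refl.
Qed.

Section ProdLine.
Variable N : nat.

Let al (i : 'I_N.+1) : 'I_(N + 1).+1 :=
  if fintype.unlift ord0 i is Some j then fintype.lift ord0 (lshift 1 j) else ord0.
Let be (j : 'I_2) : 'I_(N + 1).+1 :=
  if j == 0 then ord0 else fintype.lift ord0 (rshift N (0 : 'I_1)).
Let phi (w : 'rV[F]_(N + 1).+1) : 'rV[F]_(N.+1 * 2) :=
  segre (\row_i w 0 (al i)) (\row_j w 0 (be j)).
Let ga (k : 'I_(N + 1).+1) : 'I_(N.+1 * 2) :=
  if fintype.unlift ord0 k is Some l then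
    match fintype.split l with
    | inl j => mxvec_index (fintype.lift ord0 j) (0 : 'I_2)
    | inr _ => mxvec_index ord0 (1 : 'I_2)
    end
  else mxvec_index ord0 0.
Let psi (z : 'rV[F]_(N.+1 * 2)) : 'rV[F]_(N + 1).+1 := \row_k z 0 (ga k).

Lemma iso_prod_line (S : 'rV[F]_N -> bool) :
  isomorphic (acone (fun v : 'rV[F]_(N + 1) => S (lsubmx v)))
    (prod_cone (acone S) (affine_line F)).
Proof.
have al0 : al ord0 = ord0 by rewrite /al fintype.unlift_none.
have alS j : al (fintype.lift ord0 j) = fintype.lift ord0 (lshift 1 j) by rewrite /al fintype.liftK.
have ga0 : ga ord0 = mxvec_index ord0 0 by rewrite /ga fintype.unlift_none.
have gaL j : ga (fintype.lift ord0 (lshift 1 j)) = mxvec_index (fintype.lift ord0 j) 0.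
  by rewrite /ga fintype.liftK (unsplitK (inl _ j)).
have gaR : ga (fintype.lift ord0 (rshift N (0 : 'I_1))) = mxvec_index ord0 1.
  by rewrite /ga fintype.liftK (unsplitK (inr _ _)).
have dl (w : 'rV[F]_(N + 1).+1) : dehomv (\row_i w 0 (al i)) = lsubmx (dehomv w).
  by apply/rowP => j; rewrite !mxE al0 alS.
have dp (u : 'rV[F]_N.+1) (v : 'rV[F]_2) : u 0 0 != 0 -> v 0 0 != 0 ->
    lsubmx (dehomv (psi (segre u v))) = dehomv u.
  move=> u0 v0; apply/rowP => j; rewrite !mxE ga0 gaL !segreE.
  by rewrite -mulf_div divff // mulr1.
have hphi w : acone (fun v : 'rV[F]_(N + 1) => S (lsubmx v)) w ->
    prod_cone (acone S) (affine_line F) (phi w).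
  move=> [w0 Sw]; exists (\row_i w 0 (al i)), (\row_j w 0 (be j)); split=> //.
    by split; rewrite ?dl // mxE al0.
  by split; [apply: (@coord_nz _ _ _ 0) | rewrite mevalXU]; rewrite mxE.
have hpsi z : prod_cone (acone S) (affine_line F) z ->
    acone (fun v : 'rV[F]_(N + 1) => S (lsubmx v)) (psi z).
  move=> [u [v [[u0 Su] [_]]]]; rewrite mevalXU => v0 ->.
  by split; rewrite ?dp // mxE ga0 segreE mulf_neq0.
exists phi, psi; split.
- have row_ex k : exists p : {mpoly F[(N + 1).+1]}, p \is 2.-homog /\
      forall w : 'rV[F]_(N + 1).+1, p.@[w 0] = phi w 0 k.
    case/mxvec_indexP: k => i j; exists ('X_(al i) * 'X_(be j)); split.
      by apply: (@dhomogM _ _ _ 1 _ 1); apply: homogX.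
    by move=> w; rewrite mevalM !mevalXU segreE !mxE.
  have {row_ex} [G hG] := choice row_ex.
  apply: (@regular_forms _ _ _ _ 2 G) => //.
    by move=> j; have [] := hG j.
  move=> w; apply/rowP => j; have [_ e] := hG j; by rewrite mxE e.
- apply: (@regular_forms _ _ _ _ 1 (fun k => 'X_(ga k))) => //.
    by move=> j; apply: homogX.
  by move=> w; apply/rowP => j; rewrite !mxE mevalXU.
- move=> w [w0 _]; exists (w 0 0) => //; apply/rowP => k; rewrite !mxE.
  case: (fintype.unliftP ord0 k) => [l|] ->; last by rewrite ga0 segreE !mxE al0.
  case: (fintype.split_ordP l) => j ->; first by rewrite gaL segreE !mxE alS mulrC.
  by rewrite ord1 gaR segreE !mxE al0.
- move=> z [u [v [[u0 Su] [_]]]]; rewrite mevalXU => v0 ->.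
  exists (u 0 0 * v 0 0); rewrite ?mulf_neq0 //; apply/rowP => k.
  rewrite [RHS]mxE; case/mxvec_indexP: k => i j; rewrite !segreE !mxE.
  have -> : segre u v 0 (ga (al i)) = u 0 i * v 0 0.
    case: (fintype.unliftP ord0 i) => [l|] ->; last by rewrite al0 ga0 segreE.
    by rewrite alS gaL segreE.
  have -> : segre u v 0 (ga (be j)) = u 0 0 * v 0 j.
    rewrite /be; have [->|j0] := eqVneq j 0; first by rewrite ga0 segreE.
    rewrite gaR segreE; congr (_ * v _ _); apply: val_inj.
    by move: j j0 => [[|[|]]].
  by ring.
Qed.

End ProdLine.

Lemma mu_line (T : dtype) (S : T -> bool) : dpred S ->
  mu (fun x : T * 'M[F]_1 => S x.1) = mu S * K0class (affine_line F).
Proof.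
move=> hS; set L := K0class _; have [ts hts] := dpred_cble hS.
pose dC (C : 'rV[F]_(ddim T) -> bool) := dpred (T := rv_dtype (ddim T)) C.
have dC_comp C : dC C -> dpred (fun t : T => C (dpk t)).
  by apply: (@dpred_comp T (rv_dtype (ddim T))) => i; apply: dfun_coord.
pose Phi C := dC C ->
  mu (fun x : T * 'M[F]_1 => S x.1 && C (dpk x.1)) = mu (fun t => S t && C (dpk t)) * L.
suff H : Phi (fun _ => true).
  rewrite (@mu_ext _ (fun x => S x.1) (fun x => S x.1 && true)); last by move=> ?; rewrite andbT.
  rewrite (@mu_ext _ S (fun x => S x && true)); last by move=> ?; rewrite andbT.
  by apply: H; apply: dpred_const.
have asc (V : dtype) (a1 b1 c1 : V -> bool) : mu (fun v : V => a1 v && b1 v && c1 v) = mu (fun v => a1 v && (b1 v && c1 v)).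
  by apply: mu_ext => v; rewrite andbA.
apply: (@bset_ind _ _ ts Phi) => [C p h0 h1 hC|E q b hA dA].
  have hp : dpred (T := rv_dtype _) (fun v : 'rV_(ddim T) => p.@[v 0] == 0).
    by apply: dpred_eq0; apply: (@dfun_meval (rv_dtype _)) => i; apply: dfun_rv.
  have hpT := dC_comp _ hp.
  rewrite (mu_split (dpredI hS (dC_comp _ hC)) hpT) mulrDl.
  rewrite (mu_split (C := fun x => p.@[dpk x.1 0] == 0)); first last.
  - exact: (dpred_comp (@dmap_fst T _) hpT).
  - exact: (dpred_comp (@dmap_fst T _) (dpredI hS (dC_comp _ hC))).
  rewrite [X in X + _ = _]asc [X in _ + X = _]asc [X in _ = X * L + _]asc [X in _ = _ + X * L]asc.
  by rewrite -h0 ?h1 //; [apply: (@dpredI (rv_dtype _)) => //; apply: (@dpredN (rv_dtype _)) | apply: (@dpredI (rv_dtype _))].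
rewrite /Phi; case: b hA => hA; last first.
  rewrite !mu_false ?mul0r // => [t|t]; apply/negP => /andP [St] /hA; rewrite -hts dpkK St //.
have [Y hY] := bset_lc E q.
have eS : mu (fun t => S t && bset E q (dpk t)) = K0class Y.
  rewrite -(amu_lc (cble_bset E q) hY); congr amu; apply/funext => v; rewrite dupK.
  by case Av: (bset E q v); rewrite ?andbF // hts hA.
rewrite eS K0class_prod.
have lcX : locally_closed (acone (fun v : 'rV[F]_(ddim T + 1) => bset E q (lsubmx v))).
  have [|E1 [q1 h1]] := @bset_preim (ddim T + 1) (ddim T) [::] 1 E q (fun v => lsubmx v)
    (fun i => 'X_(lshift 1 i)) 1.
    move=> v _; rewrite meval1 oner_eq0; split=> // i.
    by rewrite mevalXU mxE divr1.
  have [X hX] := bset_lc E1 q1; have := qprojP X; rewrite hX; congr (locally_closed (acone _)).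
  by apply/funext => v; rewrite h1 /bset /= meval1 oner_eq0.
have iso := @iso_prod_line (ddim T) (bset E q).
transitivity (K0class (QProj lcX)).
  rewrite -(@amu_lc _ _ (fun v : 'rV[F]_(ddim T + 1) => bset E q (lsubmx v))) //; last first.
    have := dpred_cble (dpred_comp (@dmap_fst T (mx_dtype 1 1)) (dC_comp _ dA)).
    by congr cble; apply/funext => v /=; rewrite dupK.
  congr amu; apply/funext => v; rewrite /= dupK.
  by case Av: (bset E q _); rewrite ?andbF // hts hA.
by apply: K0class_iso; move: iso; rewrite -hY.
Qed.

End Definable.

Section Projective.
Variable F : closedFieldType.

Lemma mu_lines (T : dtype F) (S : T -> bool) h : dpred S ->
  mu (fun x : T * 'rV[F]_h => S x.1) = mu S * K0class (affine_line F) ^+ h.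
Proof.
move=> hS; elim: h => [|h IH].
  rewrite mulr1; apply: (@mu_bij _ (prod_dtype T (mx_dtype F 1 0)) T _ _ (fun x => x.1) (fun t => (t, 0))) => //.
  - exact: (dpred_comp (@dmap_fst _ T _)).
  - exact: dmap_fst.
  - apply: dmap_pair; first exact: dmap_id.
    by apply: dmap_mx => i j; apply: (dfun_ext _ (dfun_const T 0)) => t; rewrite mxE.
  - by move=> [t v] /= St; split=> //; congr (_, _); apply/rowP => -[].
rewrite exprSr mulrA -IH -mu_line; last exact: (dpred_comp (@dmap_fst _ T _)).
apply: (@mu_bij _ (prod_dtype T (mx_dtype F 1 h.+1)) (prod_dtype (prod_dtype T (mx_dtype F 1 h)) (mx_dtype F 1 1)) _ _ (fun x : T * 'rV[F]_(h.+1) => ((x.1, \row_i x.2 0 (fintype.lift ord0 i)), x.2 0 0 *: 1%:M))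
   (fun y => (y.1.1, homv y.1.2 + \row_j ((j == ord0)%:R * (y.2 0 0 - 1))))) => //.
- exact: (dpred_comp (@dmap_fst _ T _)).
- exact: (dpred_comp (dmap_comp (@dmap_fst _ _ _) (@dmap_fst _ T _))).
- apply: dmap_pair; [apply: dmap_pair|]; first exact: dmap_fst.
    apply: dmap_mx => i j; have := dmx_dmap (@dmap_snd _ T (mx_dtype F 1 h.+1)) 0 (fintype.lift ord0 j).
    by apply: dfun_ext => t; rewrite mxE.
  apply: dmap_mx => i j; have := dmx_dmap (@dmap_snd _ T (mx_dtype F 1 h.+1)) 0 0.
  by apply: dfun_ext => t; rewrite !mxE !ord1 mulr1.
- apply: dmap_pair; first exact: (dmap_comp (@dmap_fst _ _ _) (@dmap_fst _ T _)).
  set V := prod_dtype _ _.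
  have h1 i : dfun (T := V) (fun y => y.1.2 0 i).
    have := dmx_dmap (dmap_comp (@dmap_fst _ (prod_dtype T (mx_dtype F 1 h)) (mx_dtype F 1 1)) (@dmap_snd _ T (mx_dtype F 1 h))) 0 i.
    by apply: dfun_ext.
  have h2 : dfun (T := V) (fun y => y.2 0 0).
    exact: (dmx_dmap (@dmap_snd _ _ _) 0 0).
  apply: dmap_mx => i j; rewrite ord1.
  case: (fintype.unliftP ord0 j) => [l|] ->.
    by apply: dfun_ext (h1 l) => y; rewrite mxE homS mxE mul0r addr0.
  by apply: dfun_ext h2 => y; rewrite mxE hom0 mxE eqxx mul1r addrCA subrr addr0.
- move=> [t v] /= St; split=> //; congr (_, _); apply/rowP => j.
  rewrite [LHS]mxE; case: (fintype.unliftP ord0 j) => [l|] ->.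
    by rewrite homS !mxE mul0r addr0.
  by rewrite hom0 !mxE eqxx mul1r mulr1 addrCA subrr addr0.
- move=> [[t u] v] /= St; split=> //; congr (_, _, _); apply/rowP => j.
    by rewrite mxE mxE homS mxE mul0r addr0.
  by rewrite !mxE !ord1 eqxx fintype.unlift_none mul1r mulr1 addrCA subrr addr0.
Qed.

Definition normalized m (v : 'rV[F]_m) :=
  [exists i, (v 0 i == 1) && [forall j : 'I_m, (j < i)%N ==> (v 0 j == 0)]].

Lemma lower_lc m (X : qproj F m) (i0 : 'I_m) :
  locally_closed (acone (fun v : 'rV[F]_m => (v 0 i0 == 1) && `[< qpts X v >])).
Proof.
have [_ [_ [[E hE ->] [E' hE' ->]] eX]] := qprojP X.
pose sh (f : {mpoly F[m]}) : {mpoly F[m.+1]} := f \mPo [tuple 'X_(fintype.lift ord0 i) | i < m].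
have she f d (w : 'rV[F]_m.+1) : f \is d.-homog -> w 0 0 != 0 ->
    ((sh f).@[w 0] == 0) = (f.@[dehomv w 0] == 0).
  move=> hf w0; rewrite comp_mpoly_meval.
  rewrite [X in (X == 0) = _](@meval_eq _ _ _ (fun i => w 0 0 * dehomv w 0 i)) => [|i]; last first.
    by rewrite tnth_mktuple mevalXU mxE mulrC divfK.
  by rewrite (homog_scale _ _ hf) mulf_eq0 expf_eq0 (negPf w0) andbF.
have shh f : f \is homog mdeg -> sh f \is homog mdeg.
  move=> /homogP [d hd]; apply/homogP; exists d; apply: comp_homog => // i.
  by rewrite tnth_mktuple homogX.
have cl (E1 : set {mpoly F[m]}) : (forall f, E1 f -> f \is homog mdeg) ->
    proj_closed (closed_cone (sh @` E1)).
  by move=> h; exists (sh @` E1) => // _ [f /h hf <-]; apply: shh.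
have clE (E1 : set {mpoly F[m]}) (w : 'rV[F]_m.+1) : (forall f, E1 f -> f \is homog mdeg) -> w 0 0 != 0 ->
    dehomv w 0 i0 = 1 ->
    closed_cone (sh @` E1) w <-> closed_cone E1 (dehomv w).
  move=> h w0 w1; split=> -[_ H]; split.
  - by apply: (@coord_nz _ _ _ i0); rewrite w1 oner_eq0.
  - move=> f Ef; apply/eqP; have /homogP [d hd] := h _ Ef.
    by rewrite -(she _ _ _ hd w0) H //; exists f.
  - exact: coord_nz w0.
  - move=> _ [f Ef <-]; apply/eqP; have /homogP [d hd] := h _ Ef.
    by rewrite (she _ _ _ hd w0) H.
have hX : proj_closed (pz ('X_i0 - 1 : {mpoly F[m]})) by apply: pz_closed.
pose Y0 := QProj (locally_closedI (chart F m) hX).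
pose Y1 := QProj (locally_closedI Y0 (cl _ hE)).
have := locally_closedD Y1 (cl _ hE').
congr locally_closed; apply/seteqP; split=> w.
- move=> [[[[w0 _] /(pzE _ w0)]]]; rewrite mevalB mevalXU meval1 => /eqP.
  rewrite subr_eq0 => /eqP w1 /(clE _ _ hE w0 w1) Ew nE'w; split=> //.
  rewrite w1 eqxx /=; apply/asboolP; rewrite eX; split=> //.
  by move=> /(clE _ _ hE' w0 w1).
- move=> [w0 /andP [/eqP w1 /asboolP]]; rewrite eX => -[Ew nE'w]; split.
    split; last exact/(clE _ _ hE w0 w1).
    by split=> //; apply/(pzE _ w0); rewrite mevalB mevalXU meval1 w1 subrr.
  by move=> /(clE _ _ hE' w0 w1).
Qed.

Lemma K0class_normal m (X : qproj F m) (S : 'rV[F]_m -> bool) :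
  dpred (T := rv_dtype F m) S ->
  (forall v, S v <-> qpts X v /\ normalized v) ->
  K0class X = mu (T := rv_dtype F m) S.
Proof.
move=> hS h.
have hz (i : 'I_m) : dpred (T := rv_dtype F m) (fun v : 'rV[F]_m => v 0 i == 0).
  exact (@dpred_eq0 F (rv_dtype F m) (fun v : 'rV[F]_m => v 0 i) (@dfun_rv F m i)).
suff H k (Y : qproj F m) (C : 'rV[F]_m -> bool) : (k <= m)%N ->
    dpred (T := rv_dtype F m) C ->
    (forall v, qpts Y v -> forall i : 'I_m, (i < m - k)%N -> v 0 i = 0) ->
    (forall v, C v <-> qpts Y v /\ normalized v) -> K0class Y = mu (T := rv_dtype F m) C.
  by apply: (H m) => // v _ i; rewrite subnn.
elim: k Y C => [|k IH] Y C km hC Y0 CY.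
  rewrite mu_false; last first.
    move=> v; apply/negP => /CY [Yv _]; case: (nz_coord (qproj_neq0 Yv)) => i.
    by rewrite Y0 ?eqxx // subn0.
  apply: K0class_set0; apply/seteqP; split=> v // Yv; case: (nz_coord (qproj_neq0 Yv)) => i.
  by rewrite Y0 ?eqxx // subn0.
have ltm : (m - k.+1 < m)%N by rewrite -subn_gt0 subKn.
pose i0 := Ordinal ltm.
have hcl : proj_closed (closed_cone [set ('X_i0 : {mpoly F[m]})]).
  by exists [set 'X_i0] => // _ ->; apply: homog_var.
have clE (v : 'rV[F]_m) : qpts Y v -> closed_cone [set ('X_i0 : {mpoly F[m]})] v <-> v 0 i0 = 0.
  move=> /qproj_neq0 v0; split=> [[_ /(_ _ erefl)]|e]; first by rewrite mevalXU.
  by split=> // _ ->; rewrite mevalXU.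
rewrite (K0class_scissor (Y := QProj (locally_closedI Y hcl)) (U := QProj (locally_closedD Y hcl)) hcl) //.
rewrite (mu_split hC (hz i0)); congr (_ + _).
  apply: IH => [|||v]; first exact: ltnW.
  - exact: (dpredI hC (hz i0)).
  - move=> v [Yv /(clE _ Yv) vi] i; rewrite -(subnSK km) ltnS leq_eqVlt => /orP [/eqP e|lt].
      by rewrite -vi; congr (v _ _); apply: val_inj.
    by apply: Y0.
  - split=> [/andP [/CY [Yv nv] /eqP e]|[[Yv /(clE _ Yv) e] nv]].
      by split=> //; split=> //; apply/(clE _ Yv).
    by rewrite e eqxx andbT; apply/CY.
pose U := QProj (locally_closedD Y hcl).
have nvE (v : 'rV[F]_m) : qpts Y v -> v 0 i0 != 0 -> normalized v -> v 0 i0 = 1.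
  move=> Yv vi /existsP [i /andP [/eqP e /forallP z]].
  case: (ltngtP i i0) => [lt|lt|/val_inj <- //].
    by move: e; rewrite (Y0 _ Yv) // => /esym/eqP; rewrite oner_eq0.
  by have := z i0; rewrite lt (negPf vi).
have CE : (fun v : rv_dtype F m => C v && ~~ (v 0 i0 == 0)) = (fun v : 'rV[F]_m => (v 0 i0 == 1) && `[< qpts U v >]).
  apply/funext => v; apply/andP/andP => [[/CY [Yv nv] vi]|[/eqP vi /asboolP [Yv nc]]].
    rewrite (nvE _ Yv vi nv) eqxx; split=> //; apply/asboolP; split=> //.
    by move=> /(clE _ Yv) /eqP; rewrite (negPf vi).
  rewrite vi oner_eq0; split=> //; apply/CY; split=> //; apply/existsP; exists i0.
  by rewrite vi eqxx /=; apply/forallP => j; apply/implyP => /(Y0 _ Yv) ->.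
have lc := lower_lc U i0.
have -> : mu (T := rv_dtype F m) (fun v => C v && ~~ (v 0 i0 == 0)) = K0class (QProj lc).
  rewrite CE; apply: amu_lc => //; rewrite -CE.
  exact (dpred_cble (dpredI hC (dpredN (hz i0)))).
apply: K0class_iso.
pose p (v : 'rV[F]_m) : 'rV[F]_m.+1 := \row_k (if fintype.unlift ord0 k is Some j then v 0 j else v 0 i0).
have dp (v : 'rV[F]_m) : v 0 i0 != 0 -> dehomv (p v) = (v 0 i0)^-1 *: v.
  by move=> vi; apply/rowP => j; rewrite !mxE fintype.liftK fintype.unlift_none mulrC.
have UE (v : 'rV[F]_m) : qpts U v -> v 0 i0 != 0.
  by move=> [Yv nc]; apply/eqP => e; apply: nc; apply/(clE _ Yv).
apply: (@iso_coord _ _ _ _ _ p (fun w : 'rV[F]_m.+1 => \row_j w 0 (fintype.lift ord0 j))).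
- move=> k'; case: (fintype.unliftP ord0 k') => [j|] ->.
    by exists j => v; rewrite mxE fintype.liftK.
  by exists i0 => v; rewrite mxE fintype.unlift_none.
- by move=> j; exists (fintype.lift ord0 j) => v; rewrite mxE.
- move=> v Uv; have vi := UE _ Uv; split; first by rewrite mxE fintype.unlift_none.
  rewrite dp // mxE mulVf // eqxx; apply/asboolP.
  by apply: (@qprojZ _ _ U) => //; rewrite invr_eq0.
- move=> w [w0 /andP [/eqP w1 /asboolP Uw]].
  have -> : \row_j w 0 (fintype.lift ord0 j) = w 0 0 *: dehomv w.
    by apply/rowP => j; rewrite !mxE mulrC divfK.
  exact: (@qprojZ _ _ U).
- move=> v Uv; have -> : \row_j p v 0 (fintype.lift ord0 j) = v.
    by apply/rowP => j; rewrite !mxE fintype.liftK.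
  exact: proj_eq_refl.
- move=> w [w0 /andP [/eqP w1 _]]; move: w1; rewrite mxE => w1.
  have -> : p (\row_j w 0 (fintype.lift ord0 j)) = w.
    apply/rowP => k'; rewrite mxE; case: (fintype.unliftP ord0 k') => [j|] ->; rewrite mxE //.
    by rewrite -[LHS](divfK w0) w1 mul1r.
  exact: proj_eq_refl.
Qed.

End Projective.

(** * Definable linear algebra *)

Section DefLinAlg.
Variable F : closedFieldType.
Variable T : dtype F.

Definition dfin (K : eqType) (c : T -> K) := forall x, dpred (fun t => c t == x).

Lemma dfun_case (K : finType) (c : T -> K) (f : K -> T -> F) :
  dfin c -> (forall x, dfun (f x)) -> dfun (fun t => f (c t) t).
Proof.
move=> hc hf.
apply: (dfun_ext (f := fun t => \sum_(x : K) (c t == x)%:R * f x t)) => [t|].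
  rewrite (bigD1 (c t)) //= eqxx mul1r big1 ?addr0 // => x xc.
  by rewrite eq_sym (negPf xc) mul0r.
by apply: dfun_sum => x; apply: dfun_mul (hc x) (hf x).
Qed.

Lemma dpred_case (K : finType) (c : T -> K) (S : K -> T -> bool) :
  dfin c -> (forall x, dpred (S x)) -> dpred (fun t => S (c t) t).
Proof. by move=> hc hS; apply: (@dfun_case K c (fun x t => (S x t)%:R)). Qed.

Lemma dfin_comp (K K' : finType) (c : T -> K) (h : K -> K') :
  dfin c -> dfin (fun t => h (c t)).
Proof.
by move=> hc x; apply: (@dpred_case K c (fun y _ => h y == x) hc) => y; apply: dpred_const.
Qed.

Lemma dfin_fun (K : finType) (P : K -> T -> bool) :
  (forall x, dpred (P x)) -> dfin (fun t => [ffun x => P x t]).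
Proof.
move=> hP phi; have := dpred_forall (S := fun x t => P x t == phi x) (T := T).
have -> : (fun t => [forall i, P i t == phi i]) = (fun t => [ffun x => P x t] == phi).
  apply/funext => t; apply/forallP/eqP => [e|<- x]; last by rewrite ffunE.
  by apply/ffunP => x; rewrite ffunE; apply/eqP.
apply=> x; case: (phi x).
  by have := hP x; congr dpred; apply/funext => t; rewrite eqb_id.
by have := dpredN (hP x); congr dpred; apply/funext => t; rewrite eqbF_neg.
Qed.

Lemma dfin_pick (K : finType) (P : K -> T -> bool) :
  (forall x, dpred (P x)) -> dfin (fun t => [pick x | P x t]).
Proof.
move=> hP; have := dfin_comp (fun phi : {ffun K -> bool} => [pick x | phi x]) (dfin_fun hP).
congr (dfin (K := _)); apply/funext => t; apply: eq_pick => x /=.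
by rewrite /= ffunE.
Qed.

Lemma dmx_case (K : finType) m n (c : T -> K) (f : K -> T -> 'M[F]_(m, n)) :
  dfin c -> (forall x, dmx (f x)) -> dmx (fun t => f (c t) t).
Proof. by move=> hc hf i j; apply: (dfun_case (f := fun x t => f x t i j)) => // x; apply: hf. Qed.

Lemma dmx_ext m n (A B : T -> 'M[F]_(m, n)) : A =1 B -> dmx A -> dmx B.
Proof. by move=> /funext ->. Qed.

Lemma dmx_const m n (A : 'M[F]_(m, n)) : dmx (fun _ : T => A).
Proof. by move=> i j; apply: dfun_const. Qed.

Lemma dmx_mul m n p (A : T -> 'M[F]_(m, n)) (B : T -> 'M[F]_(n, p)) :
  dmx A -> dmx B -> dmx (fun t => A t *m B t).
Proof.
move=> hA hB i j; apply: (dfun_ext (f := fun t => \sum_k A t i k * B t k j)).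
  by move=> t; rewrite mxE.
by apply: dfun_sum => k; apply: dfun_mul.
Qed.

Lemma dmx_add m n (A B : T -> 'M[F]_(m, n)) : dmx A -> dmx B -> dmx (fun t => A t + B t).
Proof. by move=> hA hB i j; apply: dfun_ext (dfun_add (hA i j) (hB i j)) => t; rewrite mxE. Qed.

Lemma dmx_scale m n (a : T -> F) (A : T -> 'M[F]_(m, n)) :
  dfun a -> dmx A -> dmx (fun t => a t *: A t).
Proof. by move=> ha hA i j; apply: dfun_ext (dfun_mul ha (hA i j)) => t; rewrite mxE. Qed.

Lemma dmx_opp m n (A : T -> 'M[F]_(m, n)) : dmx A -> dmx (fun t => - A t).
Proof. by move=> hA i j; apply: dfun_ext (dfun_opp (hA i j)) => t; rewrite mxE. Qed.

Lemma dmx_sub m n (A B : T -> 'M[F]_(m, n)) : dmx A -> dmx B -> dmx (fun t => A t - B t).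
Proof. by move=> hA hB; apply: dmx_add => //; apply: dmx_opp. Qed.

Lemma dmx_mxsub m n m' n' (f : 'I_m' -> 'I_m) (g : 'I_n' -> 'I_n) (A : T -> 'M[F]_(m, n)) :
  dmx A -> dmx (fun t => mxsub f g (A t)).
Proof. by move=> hA i j; apply: dfun_ext (hA (f i) (g j)) => t; rewrite mxE. Qed.

Lemma dmx_scalar n (a : T -> F) : dfun a -> dmx (fun t => (a t)%:M : 'M[F]_n).
Proof.
move=> ha i j; apply: (dfun_ext (f := fun t => a t * (i == j)%:R)).
  by move=> t; rewrite mxE mulr_natr.
by apply: dfun_mul => //; apply: dfun_const.
Qed.

Lemma dmx_row_mx m n p (A : T -> 'M[F]_(m, n)) (B : T -> 'M[F]_(m, p)) :
  dmx A -> dmx B -> dmx (fun t => row_mx (A t) (B t)).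
Proof.
move=> hA hB i j; case: (fintype.split_ordP j) => l ->.
  by apply: dfun_ext (hA i l) => t; rewrite row_mxEl.
by apply: dfun_ext (hB i l) => t; rewrite row_mxEr.
Qed.

Lemma dmx_col_mx m n p (A : T -> 'M[F]_(m, n)) (B : T -> 'M[F]_(p, n)) :
  dmx A -> dmx B -> dmx (fun t => col_mx (A t) (B t)).
Proof.
move=> hA hB i j; case: (fintype.split_ordP i) => l ->.
  by apply: dfun_ext (hA l j) => t; rewrite col_mxEu.
by apply: dfun_ext (hB l j) => t; rewrite col_mxEd.
Qed.

Lemma dmx_lsub m n p (A : T -> 'M[F]_(m, n + p)) : dmx A -> dmx (fun t => lsubmx (A t)).
Proof. by move=> hA i j; apply: dfun_ext (hA i (lshift p j)) => t; rewrite mxE. Qed.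

Lemma dmx_rsub m n p (A : T -> 'M[F]_(m, n + p)) : dmx A -> dmx (fun t => rsubmx (A t)).
Proof. by move=> hA i j; apply: dfun_ext (hA i (rshift n j)) => t; rewrite mxE. Qed.

Lemma dfun_det n (A : T -> 'M[F]_n) : dmx A -> dfun (fun t => \det (A t)).
Proof.
move=> hA; apply: dfun_sum => s; apply: dfun_mul; first exact: dfun_const.
by apply: dfun_prod.
Qed.

Lemma dmx_inv n (A : T -> 'M[F]_n) : dmx A -> dmx (fun t => invmx (A t)).
Proof.
move=> hA; have hdet := dfun_det hA.
apply: (dmx_ext (A := fun t => if \det (A t) != 0 then (\det (A t))^-1 *: \adj (A t) else A t)).
  by move=> t; rewrite /invmx unitmxE unitfE.
apply: (dmx_case (c := fun t => \det (A t) != 0)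
  (f := fun b t => if b then (\det (A t))^-1 *: \adj (A t) else A t)).
  by apply: (dfin_comp id) => b; case: b;
    [have := dpred_neq0 hdet | have := dpred_eq0 hdet]; congr dpred;
    apply/funext => t; rewrite ?eqb_id // eqbF_neg negbK.
case=> //; apply: dmx_scale; first exact: dfun_inv.
move=> i j; apply: (dfun_ext (f := fun t => cofactor (A t) j i)) => [t|]; first by rewrite mxE.
apply: dfun_mul; first exact: dfun_const.
by apply: dfun_det => i' j'; apply: dfun_ext (hA (fintype.lift j i') (fintype.lift i j')) => t; rewrite !mxE.
Qed.

Definition dnat (f : T -> nat) := forall i : nat, dpred (fun t => (i < f t)%N).

Lemma dnat_eq (f : T -> nat) i : dnat f -> dpred (fun t => f t == i).
Proof.
move=> hf; case: i => [|i].
  by have := dpredN (hf 0); congr dpred; apply/funext => t; rewrite -leqNgt leqn0.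
have := dpredI (hf i) (dpredN (hf i.+1)); congr dpred; apply/funext => t.
by rewrite -leqNgt eqn_leq andbC.
Qed.

Lemma GaussE_def m n (A : T -> 'M[F]_(m, n)) : dmx A ->
  [/\ dmx (fun t => (Gaussian_elimination_ (A t)).1.1),
      dmx (fun t => (Gaussian_elimination_ (A t)).1.2) &
      dnat (fun t => (Gaussian_elimination_ (A t)).2)].
Proof.
elim: m n A => [|m IH] [|n] A hA; try by
  split; [apply: dmx_const | apply: dmx_const | move=> i; apply: dpred_const].
pose c t := [pick ij : 'I_m.+1 * 'I_n.+1 | A t ij.1 ij.2 != 0].
have hc : dfin c.
  by apply: (dfin_pick (P := fun ij t => A t ij.1 ij.2 != 0)) => ij; apply: dpred_neq0; apply: hA.
pose A1 i j t : 'M[F]_(1 + m, 1 + n) := xrow i 0 (xcol j 0 (A t)).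
have hA1 i j : dmx (A1 i j).
  move=> i' j'; apply: dfun_ext (hA (tperm i 0 i') (tperm j 0 j')) => t.
  by rewrite !mxE.
pose v i j t := (A t i j)^-1 *: dlsubmx (A1 i j t).
have hv i j : dmx (v i j).
  apply: dmx_scale; first exact/dfun_inv/hA.
  by apply: dmx_lsub => i' j'; apply: dfun_ext (hA1 i j (rshift 1 i') j') => t; rewrite [RHS]mxE.
have hu i j : dmx (fun t => ursubmx (A1 i j t)).
  by apply: dmx_rsub => i' j'; apply: dfun_ext (hA1 i j (lshift m i') j') => t; rewrite [RHS]mxE.
pose B i j t := drsubmx (A1 i j t) - v i j t *m ursubmx (A1 i j t).
have hB i j : dmx (B i j).
  apply: dmx_sub; last exact: dmx_mul.
  by apply: dmx_rsub => i' j'; apply: dfun_ext (hA1 i j (rshift 1 i') j') => t; rewrite [RHS]mxE.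
have xr p q (i : 'I_p.+1) (M : T -> 'M[F]_(p.+1, q)) : dmx M -> dmx (fun t => xrow i 0 (M t)).
  by move=> hM i' j'; apply: dfun_ext (hM (tperm i 0 i') j') => t; rewrite mxE.
have xc p q (j : 'I_q.+1) (M : T -> 'M[F]_(p, q.+1)) : dmx M -> dmx (fun t => xcol j 0 (M t)).
  by move=> hM i' j'; apply: dfun_ext (hM i' (tperm j 0 j')) => t; rewrite mxE.
pose G ij t : 'M[F]_m.+1 * 'M[F]_n.+1 * nat :=
  if ij is Some (i, j) then
    let: (L, U, r) := Gaussian_elimination_ (B i j t) in
    (xrow i 0 (block_mx 1 0 (v i j t) L : 'M_(1 + m)),
     xcol j 0 (block_mx (A t i j)%:M (ursubmx (A1 i j t)) 0 U : 'M_(1 + n)), r.+1)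
  else (1%:M, 1%:M, 0%N).
have GE t : Gaussian_elimination_ (A t) = G (c t) t.
  rewrite /= /G /c; case: [pick ij | _] => [[i j]|] //.
have bl p q r s (M1 : T -> 'M[F]_(p, q)) M2 M3 (M4 : T -> 'M[F]_(r, s)) :
  dmx M1 -> dmx M2 -> dmx M3 -> dmx M4 -> dmx (fun t => block_mx (M1 t) (M2 t) (M3 t) (M4 t)).
  by move=> ? ? ? ?; apply: dmx_col_mx; apply: dmx_row_mx.
have hG ij : [/\ dmx (fun t => (G ij t).1.1), dmx (fun t => (G ij t).1.2) & dnat (fun t => (G ij t).2)].
  case: ij => [[i j]|]; last first.
    by split; [apply: dmx_const | apply: dmx_const | move=> i; apply: dpred_const].
  have [h1 h2 h3] := IH _ _ (hB i j); split.
  - apply: (dmx_ext (A := fun t => xrow i 0 (block_mx 1 0 (v i j t) (Gaussian_elimination_ (B i j t)).1.1 : 'M_(1 + m)))).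
      by move=> t; rewrite /G; case: (Gaussian_elimination_ _) => [[]].
    apply: (xr _ _ i); apply: (bl _ _ _ _ (fun _ => 1) (fun _ => 0) (v i j) _ _ _ (hv i j) h1);
    exact: dmx_const.
  - apply: (dmx_ext (A := fun t => xcol j 0 (block_mx (A t i j)%:M (ursubmx (A1 i j t)) 0 (Gaussian_elimination_ (B i j t)).1.2 : 'M_(1 + n)))).
      by move=> t; rewrite /G; case: (Gaussian_elimination_ _) => [[]].
    apply: (xc _ _ j); apply: (bl _ _ _ _ (fun t => (A t i j)%:M) _ (fun _ => 0) _ _ (hu i j) _ h2).
      by apply: dmx_scalar.
    exact: dmx_const.
  - move=> k; have -> : (fun t => (k < (G (Some (i, j)) t).2)%N) = (fun t => (k < (Gaussian_elimination_ (B i j t)).2.+1)%N).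
      by apply/funext => t; rewrite /G; case: (Gaussian_elimination_ _) => [[]].
    by case: k => [|k]; [apply: dpred_const | apply: h3].
split.
- apply: (dmx_ext (A := fun t => (G (c t) t).1.1)) => [t|]; first by rewrite GE.
  by apply: (dmx_case (f := fun x t => (G x t).1.1)) => // x; have [] := hG x.
- apply: (dmx_ext (A := fun t => (G (c t) t).1.2)) => [t|]; first by rewrite GE.
  by apply: (dmx_case (f := fun x t => (G x t).1.2)) => // x; have [] := hG x.
- move=> k; have -> : (fun t => (k < (Gaussian_elimination_ (A t)).2)%N) = (fun t => (k < (G (c t) t).2)%N).
    by apply/funext => t; rewrite GE.
  by apply: (dpred_case (S := fun x t => (k < (G x t).2)%N)) => // x; have [_ _] := hG x; apply.
Qed.

Lemma dnat_rank m n (A : T -> 'M[F]_(m, n)) : dmx A -> dnat (fun t => \rank (A t)).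
Proof.
by move=> hA; have [_ _ h] := GaussE_def hA; move=> i; have := h i; congr dpred;
  apply/funext => t; rewrite mxrankE.
Qed.

Lemma dmx_pid m n (f : T -> nat) : dnat f -> dmx (fun t => pid_mx (f t) : 'M[F]_(m, n)).
Proof.
move=> hf i j; have := dpredI (dpred_const T (i == j :> nat)) (hf i).
by apply: dfun_ext => t; rewrite mxE.
Qed.

Lemma dmx_ebase m n (A : T -> 'M[F]_(m, n)) : dmx A ->
  dmx (fun t => col_ebase (A t)) /\ dmx (fun t => row_ebase (A t)).
Proof.
by move=> hA; have [h1 h2 _] := GaussE_def hA; split;
  [apply: dmx_ext h1 | apply: dmx_ext h2] => t; rewrite /col_ebase /row_ebase unlock.
Qed.

Lemma dmx_pinv m n (A : T -> 'M[F]_(m, n)) : dmx A -> dmx (fun t => pinvmx (A t)).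
Proof.
move=> hA; have [h1 h2] := dmx_ebase hA; have h3 := dnat_rank hA.
by apply: dmx_mul; [apply: dmx_mul; [apply: dmx_inv | apply: dmx_pid] | apply: dmx_inv].
Qed.

Lemma dmx_ker m n (A : T -> 'M[F]_(m, n)) : dmx A -> dmx (fun t => kermx (A t)).
Proof.
move=> hA; have [h1 _] := dmx_ebase hA; have h3 := dnat_rank hA.
apply: dmx_mul; last exact: dmx_inv.
by apply: dmx_sub; [apply: dmx_const | apply: dmx_pid].
Qed.

Lemma dmx_coker m n (A : T -> 'M[F]_(m, n)) : dmx A -> dmx (fun t => cokermx (A t)).
Proof.
move=> hA; have [_ h2] := dmx_ebase hA; have h3 := dnat_rank hA.
apply: dmx_mul; first exact: dmx_inv.
by apply: dmx_sub; [apply: dmx_const | apply: dmx_pid].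
Qed.

Lemma dpred_mxeq m n (A B : T -> 'M[F]_(m, n)) : dmx A -> dmx B -> dpred (fun t => A t == B t).
Proof.
move=> hA hB; have := dpred_forall (S := fun (ij : 'I_m * 'I_n) t => A t ij.1 ij.2 == B t ij.1 ij.2) (T := T).
have -> : (fun t => [forall ij : 'I_m * 'I_n, A t ij.1 ij.2 == B t ij.1 ij.2]) = (fun t => A t == B t).
  apply/funext => t; apply/forallP/eqP => [e|-> //].
  by apply/matrixP => i j; apply/eqP/(e (i, j)).
by apply=> ij; apply: dpred_eq.
Qed.

Lemma dpred_sub m m' n (A : T -> 'M[F]_(m, n)) (B : T -> 'M[F]_(m', n)) :
  dmx A -> dmx B -> dpred (fun t => (A t <= B t)%MS).
Proof.
move=> hA hB; have -> : (fun t => (A t <= B t)%MS) = (fun t => A t *m pinvmx (B t) *m B t == A t).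
  apply/funext => t; apply/idP/eqP => [/mulmxKpV //|<-]; exact: submxMl.
by apply: dpred_mxeq => //; apply: dmx_mul => //; apply: dmx_mul => //; apply: dmx_pinv.
Qed.

Lemma dmx_cap m m' n (A : T -> 'M[F]_(m, n)) (B : T -> 'M[F]_(m', n)) :
  dmx A -> dmx B -> dmx (fun t => capmx_gen (A t) (B t)).
Proof.
move=> hA hB; apply: dmx_mul => //; apply: dmx_lsub; apply: dmx_ker.
exact: dmx_col_mx.
Qed.

End DefLinAlg.

Section Canonical.
Variables (F : fieldType) (D : nat).

Definition selmx (S : {set 'I_D}) : 'M[F]_D := diag_mx (\row_j (j \in S)%:R).

Definition pivots m (A : 'M[F]_(m, D)) (S : {set 'I_D}) :=
  (\rank (A *m selmx S) == \rank A) && (\rank A == #|S|).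

(* The reduced echelon basis of the row space of A, for the first possible set
   of pivots, the basis vector of a pivot j being the row j. *)
Definition cform m (A : 'M[F]_(m, D)) : 'M[F]_D :=
  if [pick S | pivots A S] is Some P
  then selmx P *m pinvmx (A *m selmx P) *m A else 0.

Lemma selmxE (S : {set 'I_D}) i j : selmx S i j = ((i == j) && (i \in S))%:R.
Proof. by rewrite !mxE; case: eqVneq => [->|_]; rewrite ?mulr1n ?mulr0n. Qed.

Lemma selmx_idem S : selmx S *m selmx S = selmx S.
Proof.
rewrite /selmx mulmx_diag; congr diag_mx; apply/rowP => j; rewrite !mxE.
by case: (j \in S); rewrite ?mulr1 ?mulr0.
Qed.

Lemma rank_selmx S : (\rank (selmx S) <= #|S|)%N.
Proof.
have -> : selmx S = \matrix_(i, k) (i == enum_val k)%:R *m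
    (\matrix_(k, j) (j == enum_val k)%:R : 'M_(#|S|, D)).
  apply/matrixP => i j; rewrite selmxE mxE.
  under eq_bigr do rewrite !mxE -natrM mulnb.
  case iS: (i \in S); last first.
    rewrite andbF big1 // => k _; case: eqP => // e.
    by move: iS; rewrite e enum_valP.
  rewrite (bigD1 (enum_rank_in iS i)) //= enum_rankK_in // eqxx big1 => [|k kn].
    by rewrite addr0 andbT eq_sym.
  case: eqP => // e; case/eqP: kn; apply: enum_val_inj.
  by rewrite enum_rankK_in.
exact: mulmx_max_rank.
Qed.

Lemma pivots_ex m (A : 'M[F]_(m, D)) : exists S, pivots A S.
Proof.
pose f := maxrankfun A^T; pose S := [set f i | i : 'I_(\rank A^T)].
have cS : #|S| = \rank A.
  by rewrite card_imset ?card_ord ?mxrank_tr //; apply: maxrankfun_inj.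
exists S; rewrite /pivots cS eqxx andbT eqn_leq mxrankM_maxl /=.
have e : (rowsub f A^T)^T = A *m selmx S *m (\matrix_(j, k) (j == f k)%:R).
  apply/matrixP => i k; rewrite -mulmxA !mxE.
  rewrite (bigD1 (f k)) //= big1 ?addr0 => [|j jk].
    rewrite mxE (bigD1 (f k)) //= big1 ?addr0 => [|l lk].
      by rewrite selmxE mxE !eqxx imset_f // !mulr1.
    by rewrite mxE (negPf lk) mulr0.
  rewrite mxE big1 ?mulr0 // => l _; rewrite selmxE mxE.
  case: (l =P f k) => [->|_]; last by rewrite mulr0.
  by rewrite (negPf jk) mul0r.
have := mxrankM_maxl (A *m selmx S) (\matrix_(j, k) (j == f k)%:R).
by rewrite -e mxrank_tr (eqP (maxrowsub_free _)) mxrank_tr.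
Qed.

Lemma pivots_eqmx m m' (A : 'M[F]_(m, D)) (B : 'M[F]_(m', D)) S :
  (A :=: B)%MS -> pivots A S = pivots B S.
Proof. by move=> e; rewrite /pivots !(eqmxMr _ e) e. Qed.

Lemma pivots_form m (A : 'M[F]_(m, D)) S : pivots A S ->
  let K := selmx S *m pinvmx (A *m selmx S) *m A in
  [/\ K *m selmx S = selmx S, selmx S *m K = K & (K :=: A)%MS].
Proof.
move=> /andP [/eqP rA /eqP rS] K.
have sub : (selmx S <= A *m selmx S)%MS.
  have [_ <-] := mxrank_leqif_sup (submxMl A (selmx S)).
  by rewrite eqn_leq (mxrankM_maxr A) rA rS rank_selmx.
have K1 : K *m selmx S = selmx S by rewrite /K -mulmxA mulmxKpV.
have K2 : selmx S *m K = K by rewrite /K !mulmxA selmx_idem.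
have KA : (K <= A)%MS by apply: submxMl.
split=> //; apply/eqmxP; rewrite KA /=.
have [_ <-] := mxrank_leqif_sup KA; rewrite eqn_leq mxrankS //= -rA.
apply: leq_trans (mxrankM_maxl K (selmx S)); rewrite K1.
exact: mxrankM_maxr.
Qed.

Lemma pivots_uniq m (A : 'M[F]_(m, D)) S (K K' : 'M[F]_D) : pivots A S ->
  K *m selmx S = K' *m selmx S -> (K <= A)%MS -> (K' <= A)%MS -> K = K'.
Proof.
move=> /andP [/eqP rA _] e hK hK'; apply/eqP; rewrite -subr_eq0 -submx0.
have := mxrank_mul_ker A (selmx S); rewrite rA -[RHS]addn0 => /addnI/eqP.
rewrite mxrank_eq0 => /eqP <-; rewrite sub_capmx addmx_sub ?eqmx_opp //=.
by apply/sub_kermxP; rewrite mulmxBl e subrr.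
Qed.

Lemma cform_eqmx m (A : 'M[F]_(m, D)) : (cform A :=: A)%MS.
Proof.
rewrite /cform; case: pickP => [S /pivots_form [] //|h].
by have [S] := pivots_ex A; rewrite h.
Qed.

Lemma cform_eq m m' (A : 'M[F]_(m, D)) (B : 'M[F]_(m', D)) :
  (A == B)%MS -> cform A = cform B.
Proof.
move=> /eqmxP e; rewrite /cform (eq_pick (fun S => pivots_eqmx S e)).
case: pickP => // S pB; have pA : pivots A S by rewrite (pivots_eqmx S e).
have [a1 _ a2] := pivots_form pA; have [b1 _ b2] := pivots_form pB.
by apply: (pivots_uniq pB); rewrite ?a1 ?b1 ?a2 ?b2 ?e.
Qed.

Lemma cform_id m (A : 'M[F]_(m, D)) : cform (cform A) = cform A.
Proof. by apply: cform_eq; apply/eqmxP; apply: cform_eqmx. Qed.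

Lemma cform_proj m m' (A : 'M[F]_(m, D)) (u : 'M[F]_(m', D)) :
  (u *m cform A == u) = (u <= A)%MS.
Proof.
apply/eqP/idP => [<-|]; first by rewrite -(cform_eqmx A) submxMl.
rewrite -(cform_eqmx A) => /submxP [x ->]; rewrite -mulmxA; congr (_ *m _).
rewrite /cform; case: pickP => [S /pivots_form [k1 k2 _]|_]; last by rewrite mulmx0.
by rewrite -[in X in _ *m X]k2 mulmxA k1.
Qed.

End Canonical.

Section DefCanonical.
Variables (F : closedFieldType) (T : dtype F).

Lemma dmx_cform D m (A : T -> 'M[F]_(m, D)) : dmx A -> dmx (fun t => cform (A t)).
Proof.
move=> hA; have hp S : dpred (fun t => pivots (A t) S).
  apply: dpredI; last exact: dnat_eq (dnat_rank hA).
  have h1 : dmx (fun t => A t *m selmx F S) by apply: dmx_mul => //; apply: dmx_const.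
  pose r t := \rank (A t *m selmx F S).
  have hr i : dpred (fun t => (r t == i) && (\rank (A t) == i)).
    by apply: dpredI; apply: dnat_eq; apply: dnat_rank.
  have := dpredN (dpred_forall (S := fun (i : 'I_m.+1) t => ~~ ((r t == i) && (\rank (A t) == i))) (fun i => dpredN (hr i))).
  congr dpred; apply/funext => t; rewrite negb_forall; apply/existsP/eqP => [[i ri]|e].
    by move: ri; rewrite negbK /r => /andP [/eqP -> /eqP ->].
  exists (inord (r t)); rewrite negbK /r e inordK ?eqxx // ltnS; exact: rank_leq_row.
apply: (dmx_case (c := fun t => [pick S | pivots (A t) S]) (f := fun S t =>
    if S is Some P then selmx F P *m pinvmx (A t *m selmx F P) *m A t else 0)).
  exact: (dfin_pick (P := fun S t => pivots (A t) S)).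
case=> [S|]; last exact: dmx_const.
apply: dmx_mul => //; apply: dmx_mul; first exact: dmx_const.
by apply: dmx_pinv; apply: dmx_mul => //; apply: dmx_const.
Qed.

End DefCanonical.

Section Extensions.
Variables (F : fieldType) (D : nat).

Lemma rank_coker m p (X : 'M[F]_(m, D)) (C : 'M[F]_(p, D)) :
  \rank (col_mx X C) = (\rank X + \rank (C *m cokermx X))%N.
Proof.
rewrite -(mxrank_mul_ker (col_mx X C) (cokermx X)) addnC; congr (_ + _)%N.
  have -> : (col_mx X C :&: kermx (cokermx X) :=: X)%MS.
    apply/eqmxP/andP; split.
      by rewrite submxE; apply/eqP/sub_kermxP; apply: capmxSr.
    rewrite sub_capmx -addsmxE addsmxSl /=; apply/sub_kermxP.
    exact: mulmx_coker.
  by [].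
rewrite mul_col_mx mulmx_coker -addsmxE.
by rewrite adds0mx.
Qed.

Lemma compl_rows m p (X : 'M[F]_(m, D)) (C : 'M[F]_(p, D)) h :
  \rank (col_mx X C) = (\rank X + h)%N ->
  exists f : {ffun 'I_h -> 'I_p}, \rank (col_mx X (rowsub f C)) = (\rank X + h)%N.
Proof.
rewrite rank_coker => /addnI rh; rewrite -rh.
exists [ffun i => maxrankfun (C *m cokermx X) i].
rewrite rank_coker; congr (_ + _)%N.
have -> : rowsub [ffun i => maxrankfun (C *m cokermx X) i] C *m cokermx X
  = rowsub (maxrankfun (C *m cokermx X)) (C *m cokermx X).
  by apply/row_matrixP => i; rewrite row_mul !row_rowsub ffunE row_mul.
exact/eqP/maxrowsub_free.
Qed.

Lemma rank_add1 m (X : 'M[F]_(m, D)) (v : 'rV[F]_D) :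
  ~~ (v <= X)%MS -> \rank (X + v)%MS = (\rank X).+1.
Proof.
move=> nv; apply/eqP; rewrite eqn_leq; apply/andP; split.
  apply: leq_trans (mxrank_adds_leqif X v) _.
  by have := rank_leq_row v; lia.
rewrite ltn_neqAle mxrankS ?addsmxSl // andbT.
have [_ ->] := mxrank_leqif_sup (addsmxSl X v).
by rewrite addsmx_sub submx_refl.
Qed.

Lemma colSl m p (A : 'M[F]_(m, D)) (B : 'M[F]_(p, D)) : (A <= col_mx A B)%MS.
Proof. by rewrite -addsmxE addsmxSl. Qed.

Lemma colSr m p (A : 'M[F]_(m, D)) (B : 'M[F]_(p, D)) : (B <= col_mx A B)%MS.
Proof. by rewrite -addsmxE addsmxSr. Qed.

End Extensions.

(** * Grassmannian bundles *)

Section Bundle.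
Variables (F : closedFieldType) (T : dtype F) (D : nat).
Local Notation LL := (K0class (affine_line F)).

Fixpoint qb (A : pzSemiRingType) (q : A) (n m : nat) : A :=
  match n, m with
  | _, 0 => 1
  | 0, _.+1 => 0
  | n'.+1, m'.+1 => qb q n' m'.+1 + q ^+ (n' - m') * qb q n' m'
  end.

Lemma qbn0 (A : pzSemiRingType) (q : A) n : qb q n 0 = 1.
Proof. by case: n. Qed.

Definition between p c (S : T -> bool) (A : T -> 'M[F]_(p, D)) (C : T -> 'M[F]_(c, D)) w
    (x : T * 'M[F]_D) :=
  [&& S x.1, cform x.2 == x.2, (A x.1 <= x.2)%MS, (x.2 <= col_mx (A x.1) (C x.1))%MS &
      \rank x.2 == w].

Lemma dpred_between p c (S : T -> bool) (A : T -> 'M[F]_(p, D)) (C : T -> 'M[F]_(c, D)) w :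
  dpred S -> dmx A -> dmx C -> dpred (between S A C w).
Proof.
move=> hS hA hC.
have h1 : dmap (fun x : T * 'M[F]_D => x.1) by apply: dmap_fst.
have h2 : dmx (fun x : T * 'M[F]_D => x.2) by apply: dmx_dmap; apply: dmap_snd.
have hA1 := dmx_comp h1 hA; have hC1 := dmx_comp h1 hC.
apply: dpredI; first exact: (dpred_comp h1 hS).
apply: dpredI; first exact: (dpred_mxeq (dmx_cform h2) h2).
apply: dpredI; first exact: dpred_sub.
apply: dpredI; first by apply: dpred_sub => //; apply: dmx_col_mx.
exact: dnat_eq (dnat_rank h2).
Qed.

Lemma mu_between p c (S : T -> bool) (A : T -> 'M[F]_(p, D)) (C : T -> 'M[F]_(c, D)) a m :
  dpred S -> dmx A -> dmx C ->
  (forall t, S t -> \rank (A t) = a /\ \rank (col_mx (A t) (C t)) = (a + c)%N) ->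
  mu (between S A C (a + m)%N) = mu S * qb LL c m.
Proof.
elim: c m C => [|c IH] m C hS hA hC hr.
  have AC t : (col_mx (A t) (C t) :=: A t)%MS.
    rewrite (flatmx0 (C t)).
    exact: eqmx_trans (eqmx_sym (addsmxE _ _)) (addsmx0 _ _).
  case: m => [|m]; last first.
    rewrite mulr0 mu_false // => -[t W]; apply/negP => /and5P [/= St _ _].
    rewrite AC => /mxrankS; rewrite (hr _ St).1 => h /eqP e.
    by move: h; rewrite e; lia.
  rewrite mulr1; apply: (@mu_bij _ _ _ _ _ (fun x => x.1) (fun t => (t, cform (A t)))) => //.
  - exact: dpred_between.
  - exact: dmap_fst.
  - by apply: dmap_pair; [apply: dmap_id | apply: dmap_mx; apply: dmx_cform].
  - move=> [t W] /and5P [/= St /eqP cW AW WA /eqP rW]; split=> //; congr (_, _).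
    by rewrite -cW; apply: cform_eq; rewrite AW -AC.
  - move=> t St; split=> //; rewrite /between /= St cform_id eqxx.
    by rewrite !cform_eqmx submx_refl AC submx_refl (hr _ St).1 addn0 eqxx.
pose e t : 'rV[F]_D := usubmx (C t : 'M_(1 + c, D)).
pose C' t := dsubmx (C t : 'M_(1 + c, D)).
pose P t := col_mx (A t) (C' t).
have he : dmx e by move=> i j; apply: dfun_ext (hC (lshift c i) j) => t; rewrite [RHS]mxE.
have hC' : dmx C' by move=> i j; apply: dfun_ext (hC (rshift 1 i) j) => t; rewrite [RHS]mxE.
have hP : dmx P by apply: dmx_col_mx.
have ACE t : (col_mx (A t) (C t) :=: P t + e t)%MS.
  have cE m' (X : 'M[F]_(m', D)) : (C t <= X)%MS = (e t <= X)%MS && (C' t <= X)%MS.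
    rewrite -(@col_mx_sub _ 1 c) /e /C' vsubmxK //.
  have /andP [eC C'C] : (e t <= C t)%MS && (C' t <= C t)%MS by rewrite -cE.
  apply/eqmxP; rewrite addsmx_sub !col_mx_sub cE addsmxSr.
  rewrite !(submx_trans _ (addsmxSl (P t) (e t))) ?colSl ?colSr //=.
  by rewrite !(submx_trans _ (colSr (A t) (C t))) ?colSl ?colSr.
have rP t : S t -> \rank (P t) = (a + c)%N.
  move=> St; have [rA rAC] := hr _ St; apply/eqP; rewrite eqn_leq.
  rewrite /P -addsmxE (leq_trans (mxrank_adds_leqif _ _)) ?rA ?leq_add2l ?rank_leq_row //=.
  have := mxrank_adds_leqif (P t) (e t); rewrite -ACE rAC => -[h _].
  have := rank_leq_row (e t); move: h; rewrite /P -addsmxE; lia.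
have eP t : S t -> ~~ (e t <= P t)%MS.
  move=> St; have [_ rAC] := hr _ St; apply/negP => /addsmx_idPl h.
  by move: rAC; rewrite ACE h rP //; lia.
have hr' t : S t -> \rank (A t) = a /\ \rank (col_mx (A t) (C' t)) = (a + c)%N.
  by move=> St; split; [have [] := hr _ St | apply: rP].
have dAC := dpred_between (a + m)%N hS hA hC.
have hx1 : dmap (fun x : T * 'M[F]_D => x.1) by apply: dmap_fst.
have hx2 : dmx (fun x : T * 'M[F]_D => x.2) by apply: dmx_dmap; apply: dmap_snd.
have hPx := dmx_comp hx1 hP; have hex := dmx_comp hx1 he; have hC'x := dmx_comp hx1 hC'.
have dWP : dpred (fun x : T * 'M[F]_D => (x.2 <= P x.1)%MS) by apply: dpred_sub.
rewrite (mu_split dAC dWP).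
have -> : mu (fun x : T * 'M[F]_D => between S A C (a + m)%N x && (x.2 <= P x.1)%MS) = mu S * qb LL c m.
  rewrite -(IH _ _ hS hA hC' hr'); apply: mu_ext => -[t W] /=.
  rewrite /between /=; case: (S t) => //=; case: (_ == W) => //=; case: (A t <= W)%MS => //=.
  rewrite -/(P t); case h: (W <= P t)%MS; rewrite ?andbF //= andbT.
  by rewrite ACE (submx_trans h (addsmxSl _ _)).
case: m dAC => [|m] dAC.
  rewrite [X in _ + X = _]mu_false ?addr0; last first.
    move=> [t W]; apply/negP => /andP [/and5P [/= St _ AW WA /eqP rW]] /negP []/=.
    have [_ h] := mxrank_leqif_sup AW; move: h; rewrite rW (hr _ St).1 addn0 eqxx => /esym h.
    by apply: submx_trans h _; rewrite /P -addsmxE addsmxSl.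
  by rewrite !qbn0.
rewrite [RHS]/= mulrDr; congr (_ + _).
set h := (c - m)%N.
pose B' := between S A C' (a + m)%N.
have hB' : dpred B' by apply: dpred_between.
rewrite mulrCA mulrC -(IH _ _ hS hA hC' hr') -/B' -mu_lines //.
pose sel (x : T * 'M[F]_D) := [pick f : {ffun 'I_h -> 'I_c} | \rank (col_mx x.2 (rowsub f (C' x.1))) == (a + c)%N].
pose Ga (x : T * 'M[F]_D) : 'M[F]_(h, D) := if sel x is Some f then rowsub f (C' x.1) else 0.
have hGa : dmx Ga.
  apply: (dmx_case (c := sel) (f := fun f x => if f is Some f then rowsub f (C' x.1) else 0)).
    apply: (@dfin_pick _ (prod_dtype T (mx_dtype F D D)) _ (fun (f : {ffun 'I_h -> 'I_c}) x => \rank (col_mx x.2 (rowsub f (C' x.1))) == (a + c)%N)) => f.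
    by apply: dnat_eq; apply: dnat_rank; apply: dmx_col_mx => //; apply: dmx_mxsub.
  by case=> [f|]; [apply: dmx_mxsub | apply: dmx_const].
have GaP x : B' x -> [/\ (Ga x <= P x.1)%MS, \rank (x.2 + Ga x)%MS = (a + c)%N & (a + m + h = a + c)%N].
  case: x => t W /and5P [/= St _ AW WP /eqP rW].
  have rPt := rP _ St.
  have hh : (a + m + h = a + c)%N.
    by have := mxrankS WP; rewrite rW -/(P t) rPt /h; lia.
  have [|f hf] := @compl_rows _ _ _ _ W (C' t) h.
    rewrite rW hh -rPt; apply/eqmx_rank.
    by rewrite /P !col_mx_sub WP !colSr (submx_trans AW (colSl _ _)).
  split=> //; last first.
    rewrite /Ga /sel; case: pickP => [f' /eqP /= e'|/(_ f)]; first by rewrite addsmxE e'.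
    by rewrite /= hf rW hh eqxx.
  rewrite /Ga; case: (sel _) => [f'|]; last exact: sub0mx.
  exact: submx_trans (rowsub_sub _ _) (colSr _ _).
pose ff (y : T * 'M[F]_D * 'rV[F]_h) := (y.1.1, cform (col_mx y.1.2 (e y.1.1 + y.2 *m Ga y.1))).
pose W' (x : T * 'M[F]_D) := cform (capmx_gen x.2 (P x.1)).
pose gg (x : T * 'M[F]_D) := ((x.1, W' x), - rsubmx (e x.1 *m pinvmx (col_mx x.2 (Ga (x.1, W' x))))).
have hW' : dmx W' by apply: dmx_cform; apply: dmx_cap.
have hxW : dmap (fun x : T * 'M[F]_D => (x.1, W' x)) by apply: dmap_pair => //; apply: dmap_mx.
have vP t u G : S t -> (G <= P t)%MS -> ~~ ((e t + (u : 'rV_h) *m G)%R <= P t)%MS.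
  move=> St GP; apply: contra (eP _ St) => hh; rewrite -[e t](addrK (u *m G)).
  apply: addmx_sub => //; rewrite -scaleN1r; apply: scalemx_sub; exact: submx_trans (submxMl _ _) GP.
apply/esym; apply: (@mu_bij _ _ _ _ _ ff gg) => //.
- exact: (dpred_comp (@dmap_fst _ (prod_dtype T (mx_dtype F D D)) (mx_dtype F 1 h)) hB').
- by apply: dpredI => //; apply: dpredN.
- have k1 := @dmap_fst _ (prod_dtype T (mx_dtype F D D)) (mx_dtype F 1 h).
  have k2 := dmx_dmap (@dmap_snd _ (prod_dtype T (mx_dtype F D D)) (mx_dtype F 1 h)).
  apply: dmap_pair; first exact: (dmap_comp k1 hx1).
  apply: dmap_mx; apply: dmx_cform; apply: dmx_col_mx; first exact: (dmx_comp k1 hx2).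
  apply: dmx_add; first exact: (dmx_comp k1 hex).
  by apply: dmx_mul => //; apply: (dmx_comp k1 hGa).
- apply: dmap_pair => //; apply: dmap_mx; apply: dmx_opp; apply: dmx_rsub.
  apply: dmx_mul => //; apply: dmx_pinv; apply: dmx_col_mx => //.
  exact: (dmx_comp hxW hGa).
- move=> [[t W] u] /= B'x; have [GP rG hh] := GaP _ B'x.
  have /and5P [/= St /eqP cW AW WP /eqP rW] := B'x.
  set v := e t + u *m Ga (t, W).
  have nv : ~~ (v <= P t)%MS by apply: vP.
  set X := cform (col_mx W v); have XE : (X :=: W + v)%MS by apply: (eqmx_trans (cform_eqmx _) (eqmx_sym (addsmxE _ _))).
  have rX : \rank X = (a + m).+1.
    by rewrite XE rank_add1 ?rW //; apply: contra nv => /submx_trans; apply.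
  have XP : ~~ (X <= P t)%MS by rewrite XE addsmx_sub negb_and nv orbT.
  have WX : (W <= X)%MS by rewrite XE addsmxSl.
  have W'E : W' (t, X) = W.
    rewrite /W' -[RHS]cW; apply: cform_eq => /=.
    apply/eqmxP; apply: eqmx_trans (eqmx_sym (capmxE _ _)) _; apply/eqmxP.
    have s1 : (W <= X :&: P t)%MS by rewrite sub_capmx WX WP.
    rewrite s1 andbT; have [_ <-] := mxrank_leqif_sup s1.
    rewrite eqn_leq mxrankS //= rW -ltnS -rX ltn_neqAle mxrankS ?capmxSl // andbT.
    have [_ ->] := mxrank_leqif_sup (capmxSl X (P t)).
    by rewrite sub_capmx submx_refl.
  split.
    apply/andP; split; last by [].
    have rX' : (\rank X == a + m.+1)%N by rewrite rX addnS.
    rewrite /between /= -/v -/X St cform_id eqxx rX' andbT (submx_trans AW WX) /=.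
    rewrite XE ACE addsmx_sub (submx_trans WP (addsmxSl _ _)) /=.
    rewrite addmx_sub ?addsmxSr //; apply: submx_trans (submxMl _ _) _.
    exact: submx_trans GP (addsmxSl _ _).
  rewrite /gg /= -/v -/X W'E; congr (_, _).
  set G := Ga (t, W); set y := e t *m _.
  have ev : (e t <= col_mx X G)%MS.
    rewrite -addsmxE -[e t](addrK (u *m G)) -/v; apply: addmx_sub.
      by rewrite (submx_trans _ (addsmxSl _ _)) // XE addsmxSr.
    by rewrite -scaleN1r scalemx_sub // (submx_trans (submxMl _ _)) // addsmxSr.
  have yE : lsubmx y *m X + rsubmx y *m G = e t.
    by rewrite -mul_row_col hsubmxK /y mulmxKpV.
  have [z zE] : exists z, v = z *m X by apply/submxP; rewrite XE addsmxSr.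
  have cap0 : (X :&: G)%MS = 0.
    apply/eqP; rewrite -mxrank_eq0 -leqn0.
    have s : (X :&: G <= W :&: G)%MS.
      rewrite sub_capmx capmxSr andbT -[W in (_ <= W)%MS]W'E /W' cform_eqmx -capmxE.
      by rewrite capmxS.
    apply: leq_trans (mxrankS s) _.
    have := mxrank_sum_cap W G; rewrite rG rW.
    by have := rank_leq_row G; move: hh; lia.
  have rGh : row_free G.
    rewrite -row_leq_rank.
    have := mxrank_sum_cap W G; rewrite rG rW.
    by move: hh; lia.
  have : ((rsubmx y + u)%R *m G <= X :&: G)%MS.
    rewrite sub_capmx submxMl andbT mulmxDl.
    have -> : rsubmx y *m G + u *m G = (z - lsubmx y) *m X.
      by rewrite mulmxBl -zE /v -yE -/G; rewrite [_ *m X + _]addrC addrAC addrK.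
    exact: submxMl.
  rewrite cap0 submx0 => /eqP yu0.
  have : rsubmx y + u = 0 by apply: (row_free_inj rGh); rewrite mul0mx.
  by rewrite addrC => /eqP; rewrite addr_eq0 => /eqP ->.
- move=> [t W] /andP [/= B WP]; have /and5P [/= St /eqP cW AW WA /eqP rW] := B.
  have W'E : (W' (t, W) :=: W :&: P t)%MS.
    exact: eqmx_trans (cform_eqmx _) (eqmx_sym (capmxE _ _)).
  have sumE : \rank (W + P t)%MS = (a + c).+1.
    apply/eqP; rewrite eqn_leq; apply/andP; split.
      rewrite -addnS -(hr _ St).2; apply: mxrankS.
      by rewrite addsmx_sub WA ACE addsmxSl.
    rewrite -(rP _ St) ltn_neqAle mxrankS ?addsmxSr // andbT.
    have [_ ->] := mxrank_leqif_sup (addsmxSr W (P t)).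
    by rewrite addsmx_sub (negPf WP).
  have B'x : B' (t, W' (t, W)).
    rewrite /B' /between /= St cform_id eqxx !W'E sub_capmx AW colSl /=.
    rewrite (submx_trans (capmxSr _ _)) //=; apply/eqP.
    by have := mxrank_sum_cap W (P t); rewrite sumE rW rP //; lia.
  split=> //; have [/= GP rG hh] := GaP _ B'x.
  rewrite /ff /gg /=; set G := Ga (t, W' (t, W)); set y := e t *m _.
  congr (_, _); rewrite -[RHS]cW; apply: cform_eq.
  have W'G : (P t <= W' (t, W) + G)%MS.
    have s : (W' (t, W) + G <= P t)%MS by rewrite addsmx_sub GP W'E capmxSr.
    have [_ <-] := mxrank_leqif_sup s; by rewrite rG rP.
  have WGE : (W + P t <= col_mx W G)%MS.
    rewrite addsmx_sub colSl; apply: submx_trans W'G _.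
    by rewrite addsmx_sub colSr W'E (submx_trans (capmxSl _ _) (colSl _ _)).
  have ev : (e t <= col_mx W G)%MS.
    apply: submx_trans WGE.
    have s : (W + P t <= col_mx (A t) (C t))%MS by rewrite addsmx_sub WA ACE addsmxSl.
    have : (col_mx (A t) (C t) <= W + P t)%MS.
      have [_ <-] := mxrank_leqif_sup s; by rewrite sumE (hr _ St).2 addnS.
    by apply: submx_trans; rewrite ACE addsmxSr.
  have yE : lsubmx y *m W + rsubmx y *m G = e t.
    by rewrite -mul_row_col hsubmxK /y mulmxKpV.
  have ve : e t + - rsubmx y *m G = lsubmx y *m W.
    by rewrite -yE mulNmx addrK.
  have nv := vP t (- rsubmx y) G St GP.
  have s : (col_mx (W' (t, W)) (e t + - rsubmx y *m G)%R <= W)%MS.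
    by rewrite col_mx_sub W'E capmxSl ve submxMl.
  rewrite s /=; have [_ <-] := mxrank_leqif_sup s.
  rewrite -addsmxE rank_add1; last first.
    by apply: contra nv => /submx_trans; apply; rewrite W'E capmxSr.
  by have /and5P [_ _ _ _ /eqP /= ->] := B'x; rewrite rW addnS.
Qed.

End Bundle.

(** * Gaussian binomials *)

Section QBinomial.

Section Eval.
Variables (A : comPzRingType) (x : A).
Local Notation ev p := (poly_eval p x).

Lemma poly_eval_wide (p : {poly int}) N : (size p <= N)%N -> ev p = \sum_(i < N) x ^+ i *~ p`_i.
Proof.
move=> h; rewrite /poly_eval (big_ord_widen _ (fun i => x ^+ i *~ p`_i) h) big_mkcond.
apply: eq_bigr => i _; case: ltnP => // hi.
by rewrite nth_default ?mulr0z.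
Qed.

Lemma poly_evalD (p r : {poly int}) : ev (p + r) = ev p + ev r.
Proof.
pose N := maxn (size p) (size r).
rewrite (@poly_eval_wide _ N) ?size_polyD // (@poly_eval_wide p N) ?leq_maxl //.
rewrite (@poly_eval_wide r N) ?leq_maxr // -big_split; apply: eq_bigr => i _.
by rewrite coefD mulrzDr.
Qed.

Lemma poly_evalC c : ev c%:P = 1 *~ c.
Proof. by rewrite (@poly_eval_wide _ 1) ?size_polyC_leq1 // big_ord1 coefC. Qed.

Lemma poly_evalMX (p : {poly int}) : ev (p * 'X) = ev p * x.
Proof.
rewrite (@poly_eval_wide _ (size p).+1); last first.
  by have [->|p0] := eqVneq p 0; rewrite ?mul0r ?size_poly0 // size_mulX.
rewrite big_ord_recl coefMX eqxx mulr0z add0r mulr_suml; apply: eq_bigr => i _.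
by rewrite coefMX /= exprSr mulrzAl.
Qed.

Lemma poly_eval0 : ev 0 = 0.
Proof. by rewrite /poly_eval size_poly0 big_ord0. Qed.

Lemma poly_evalM (p r : {poly int}) : ev (p * r) = ev p * ev r.
Proof.
elim/poly_ind: p r => [|p c IH] r; first by rewrite mul0r poly_eval0 mul0r.
rewrite mulrDl !poly_evalD poly_evalMX poly_evalC mulrDl; congr (_ + _).
  by rewrite -mulrA -commr_polyX mulrA poly_evalMX IH mulrAC.
elim/poly_ind: r => [|r d IHr]; first by rewrite mulr0 poly_eval0 mulr0.
rewrite mulrDr !poly_evalD mulrDr mulrA !poly_evalMX IHr mulrA -polyCM !poly_evalC.
by rewrite intrM.
Qed.

Lemma poly_evalX : ev 'X = x.
Proof. by rewrite -['X]mul1r poly_evalMX poly_evalC mul1r. Qed.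

Lemma poly_eval1 : ev 1 = 1.
Proof. by rewrite poly_evalC. Qed.

Lemma poly_evalXn n : ev ('X ^+ n) = x ^+ n.
Proof. by elim: n => [|n IH]; rewrite ?poly_eval1 // !exprS poly_evalM poly_evalX IH. Qed.

Lemma poly_eval_qb n m : ev (qb 'X n m) = qb x n m.
Proof.
elim: n m => [|n IH] [|m] /=; rewrite ?poly_eval1 ?poly_eval0 //.
by rewrite poly_evalD poly_evalM poly_evalXn !IH.
Qed.

End Eval.

Local Notation P := (@qb {poly int} 'X).

Lemma qb_gt (A : pzSemiRingType) (q : A) n m : (n < m)%N -> qb q n m = 0.
Proof.
elim: n m => [|n IH] [|m] //= h; rewrite !IH ?mulr0 ?addr0 //; lia.
Qed.

Lemma qbnn (A : pzSemiRingType) (q : A) n : qb q n n = 1.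
Proof. by elim: n => //= n IH; rewrite qb_gt // IH subnn mulr1 add0r. Qed.

Lemma qfact_neq0 n : qfact n != 0.
Proof. by rewrite -lead_coef_eq0 lead_coef_qfact signr_eq0. Qed.

Lemma qb_qfact a b : P (a + b) a * (qfact a * qfact b) = qfact (a + b).
Proof.
have q0 : qfact 0 = 1 by rewrite /qfact big_geq.
have [s hs] := ubnP (a + b)%N; elim: s a b hs => // s IH [|a] b hs.
  by rewrite qbn0 q0 !mul1r.
rewrite addSn [P _ _]/= mulrDl.
case: b hs => [|b] hs.
  rewrite addn0 qb_gt // mul0r add0r subnn mul1r qbnn mul1r q0 mulr1 //.
have -> : (a + b.+1 - a = b.+1)%N by lia.
have h1 : P (a + b.+1) a.+1 * (qfact a.+1 * qfact b.+1) = qfact (a + b.+1) * (1 - 'X^(b.+1)).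
  by rewrite -addSnnS (qfactS b) -IH; [ring | lia].
have h2 : P (a + b.+1) a * (qfact a.+1 * qfact b.+1) = qfact (a + b.+1) * (1 - 'X^(a.+1)).
  by rewrite (qfactS a) -IH; [ring | lia].
rewrite h1 -[_ * P _ _ * _]mulrA h2 qfactS.
have -> : 'X^((a + b.+1).+1) = 'X^(a.+1) * 'X^(b.+1) :> {poly int} by rewrite -exprD.
ring.
Qed.

Lemma gauss_polyP a b : gauss_poly a b = P (a + b) a.
Proof.
have h : qfact a * qfact b != 0 by rewrite mulf_neq0 ?qfact_neq0.
by apply: (mulIf h); rewrite gauss_polyE qb_qfact.
Qed.

Variables (A : comPzRingType) (q : A).
Local Notation Q := (qb q).

Lemma poly_eval_gauss a b : poly_eval (gauss_poly a b) q = Q (a + b) a.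
Proof. by rewrite gauss_polyP poly_eval_qb. Qed.

Lemma qb_sym a b : Q (a + b) a = Q (a + b) b.
Proof.
rewrite -!(poly_eval_qb q); congr poly_eval.
have h : qfact a * qfact b != 0 by rewrite mulf_neq0 ?qfact_neq0.
apply: (mulIf h); rewrite qb_qfact [qfact a * _]mulrC addnC; exact/esym/qb_qfact.
Qed.

Lemma qb_rec n m : Q n.+1 m.+1 = q ^+ m.+1 * Q n m.+1 + Q n m.
Proof.
case: (ltngtP n m) => [lt|gt|->].
- by rewrite /= !qb_gt ?mulr0 ?addr0 //; lia.
- have -> : n.+1 = (m.+1 + (n - m))%N by lia.
  rewrite qb_sym; have -> : (m.+1 + (n - m) = n.+1)%N by lia.
  have [r hr] : exists r, (n - m = r.+1)%N by exists (n - m).-1; lia.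
  rewrite hr /= ; have -> : (n - r = m.+1)%N by lia.
  have en : n = (m.+1 + r)%N by lia.
  have en' : n = (m + r.+1)%N by lia.
  by rewrite addrC {1}en -qb_sym -en {2}en' -qb_sym -en'.
- by rewrite /= subnn mul1r qb_gt // mulr0 qbnn.
Qed.

Lemma qb_multinomial a b c :
  Q (a + b + c) (a + b) * Q (a + b) a = Q (a + b + c) a * Q (b + c) b.
Proof.
rewrite -!(poly_eval_qb q) -!poly_evalM; congr poly_eval.
have h : qfact a * (qfact b * qfact c) != 0 by rewrite !mulf_neq0 ?qfact_neq0.
apply: (mulIf h).
transitivity (qfact (a + b + c)).
  by rewrite -qb_qfact -[qfact (a + b)]qb_qfact; ring.
by rewrite -addnA -qb_qfact -[qfact (b + c)]qb_qfact; ring.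
Qed.

Lemma qb_trinomial n t m : (m <= t)%N ->
  Q n t * Q t m = Q n m * Q (n - m) (t - m).
Proof.
move=> mt; case: (ltnP n t) => [lt|le].
  rewrite qb_gt // mul0r; case: (leqP m n) => h; last by rewrite qb_gt ?mul0r.
  by rewrite [Q (n - m) _]qb_gt ?mulr0 //; lia.
have := qb_multinomial m (t - m) (n - t).
have -> : (m + (t - m) + (n - t) = n)%N by lia.
have -> : (m + (t - m) = t)%N by lia.
by have -> : (t - m + (n - t) = n - m)%N by lia.
Qed.

Local Arguments qb : simpl never.

Lemma qb_vandermonde x y r :
  Q (x + y) r = \sum_(t < r.+1) q ^+ ((x - t) * (r - t)) * Q x t * Q y (r - t).
Proof.
elim: x r => [|x IH] r.
  rewrite big_ord_recl big1 => [|i _]; last by rewrite [Q 0 _]qb_gt // mulr0 mul0r.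
  by rewrite addr0 sub0n mul0n qbn0 subn0 !mul1r.
case: r => [|r].
  by rewrite big_ord1 !muln0 !qbn0 !mul1r.
rewrite addSn qb_rec (IH r.+1) (IH r).
rewrite big_ord_recl [RHS]big_ord_recl mulrDr -addrA; congr (_ + _).
  rewrite !qbn0 !subn0 !mulr1 mulrA -exprD; congr (q ^+ _ * _); lia.
rewrite mulr_sumr -big_split; apply: eq_bigr => i _ /=.
rewrite /bump /= add1n subSS qb_rec mulrDr mulrDl; congr (_ + _).
case: (leqP i.+1 x) => h; last by rewrite [Q x i.+1]qb_gt ?(mulr0, mul0r).
rewrite !mulrA -exprD; congr (_ * _ * _); rewrite -exprD; congr (q ^+ _).
have := ltn_ord i; rewrite ltnS; move: (nat_of_ord i) h => {}i h hi.
have [x' ->] : exists x', x = (x' + i.+1)%N by exists (x - i.+1)%N; lia.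
have [r' ->] : exists r', r = (r' + i)%N by exists (r - i)%N; lia.
have -> : (x' + i.+1 - i.+1 = x')%N by lia.
have -> : (r' + i - i = r')%N by lia.
by nia.
Qed.

Lemma qb_moment n M K m :
  \sum_(t < M.+1) q ^+ ((n - t) * (M - t)) * Q n t * Q K (M - t) * Q t m =
  if (m <= M)%N then Q n m * Q (n - m + K) (M - m) else 0.
Proof.
case: leqP => mM; last first.
  by rewrite big1 // => t _; rewrite [Q t m]qb_gt ?mulr0 //; have := ltn_ord t; lia.
rewrite qb_vandermonde mulr_sumr -(big_mkord xpredT (fun t => q ^+ ((n - t) * (M - t)) * Q n t * Q K (M - t) * Q t m)).
rewrite (big_cat_nat (n := m)) //=; last lia.
rewrite big_nat_cond big1 ?add0r => [|t /andP [/andP [_ h] _]]; last first.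
  by rewrite [Q t m]qb_gt ?mulr0.
rewrite -{1}[m]add0n big_addn (_ : (M.+1 - m = (M - m).+1)%N); last lia.
rewrite big_mkord; apply: eq_bigr => i _.
rewrite mulrAC -[_ * Q n (i + m) * _]mulrA qb_trinomial ?leq_addl // addnK.
have -> : (n - (i + m) = n - m - i)%N by lia.
have -> : (M - (i + m) = M - m - i)%N by lia.
by ring.
Qed.

(* The system is triangular in t. *)
Lemma qb_moment_inj N (u : nat -> A) :
  (forall m, \sum_(t < N) u t * Q t m = 0) -> forall t, (t < N)%N -> u t = 0.
Proof.
elim: N => // N IH h.
have uN : u N = 0.
  have := h N; rewrite big_ord_recr /= qbnn mulr1 big1 ?add0r // => t _.
  by rewrite qb_gt ?mulr0.
move=> t; rewrite ltnS leq_eqVlt => /orP [/eqP -> //|]; apply: IH => m.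
by have := h m; rewrite big_ord_recr /= uN mul0r addr0.
Qed.

End QBinomial.

Section BundleCor.
Variables (F : closedFieldType) (T : dtype F) (D : nat).
Local Notation LL := (K0class (affine_line F)).

Lemma dpred_imply (b : bool) (S : T -> bool) : dpred S -> dpred (fun t => b ==> S t).
Proof. by case: b => //= _; apply: dpred_const. Qed.

Lemma mu_partition (S : T -> bool) (c : T -> nat) N : dpred S -> dnat c ->
  (forall t, S t -> (c t < N)%N) -> mu S = \sum_(i < N) mu (fun t => S t && (c t == i)).
Proof.
move=> hS hc; elim: N S hS => [|N IH] S hS h.
  by rewrite big_ord0 mu_false // => t; apply/negP => /h.
rewrite big_ord_recr /= (mu_split hS (dnat_eq N hc)) addrC; congr (_ + _).
rewrite (IH (fun t => S t && ~~ (c t == N))); last first.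
- by move=> t /andP [/h]; rewrite ltnS leq_eqVlt => /orP [->|].
- by apply: dpredI => //; apply: dpredN; apply: dnat_eq.
apply: eq_bigr => i _; apply: mu_ext => t; rewrite -andbA; congr (_ && _).
by case: (c t =P i) => [->|]; rewrite ?andbF // neq_ltn ltn_ord.
Qed.

Definition sandwich p r (S : T -> bool) (A : T -> 'M[F]_(p, D)) (B : T -> 'M[F]_(r, D)) w
    (x : T * 'M[F]_D) :=
  [&& S x.1, cform x.2 == x.2, (A x.1 <= x.2)%MS, (x.2 <= B x.1)%MS & \rank x.2 == w].

Lemma dpred_sandwich p r (S : T -> bool) (A : T -> 'M[F]_(p, D)) (B : T -> 'M[F]_(r, D)) w :
  dpred S -> dmx A -> dmx B -> dpred (sandwich S A B w).
Proof.
move=> hS hA hB.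
have h1 : dmap (fun x : T * 'M[F]_D => x.1) by apply: dmap_fst.
have h2 : dmx (fun x : T * 'M[F]_D => x.2) by apply: dmx_dmap; apply: dmap_snd.
have hA1 := dmx_comp h1 hA; have hB1 := dmx_comp h1 hB.
apply: dpredI; first exact: (dpred_comp h1 hS).
apply: dpredI; first exact: (dpred_mxeq (dmx_cform h2) h2).
apply: dpredI; first exact: dpred_sub.
apply: dpredI; first exact: dpred_sub.
exact: dnat_eq (dnat_rank h2).
Qed.

Lemma mu_sandwich p r (S : T -> bool) (A : T -> 'M[F]_(p, D)) (B : T -> 'M[F]_(r, D)) a c m :
  dpred S -> dmx A -> dmx B ->
  (forall t, S t -> [/\ (A t <= B t)%MS, \rank (A t) = a & \rank (B t) = a + c]%N) ->
  mu (sandwich S A B (a + m)%N) = mu S * qb LL c m.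
Proof.
move=> hS hA hB hr.
pose sel t := [pick f : {ffun 'I_c -> 'I_r} | \rank (col_mx (A t) (rowsub f (B t))) == (a + c)%N].
pose C t : 'M[F]_(c, D) := if sel t is Some f then rowsub f (B t) else 0.
have hC : dmx C.
  apply: (dmx_case (c := sel) (f := fun f t => if f is Some f then rowsub f (B t) else 0)).
    apply: (@dfin_pick _ T _ (fun (f : {ffun 'I_c -> 'I_r}) t => \rank (col_mx (A t) (rowsub f (B t))) == (a + c)%N)) => f.
    by apply: dnat_eq; apply: dnat_rank; apply: dmx_col_mx => //; apply: dmx_mxsub.
  by case=> [f|]; [apply: dmx_mxsub | apply: dmx_const].
have CP t : S t -> \rank (col_mx (A t) (C t)) = (a + c)%N /\ (col_mx (A t) (C t) :=: B t)%MS.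
  move=> /hr [AB rA rB].
  have rC : \rank (col_mx (A t) (C t)) = (a + c)%N.
    have [|f hf] := @compl_rows _ _ _ _ (A t) (B t) c.
      rewrite rA -rB; apply/eqmx_rank; rewrite col_mx_sub AB submx_refl /=.
      exact: colSr.
    rewrite /C /sel; case: pickP => [f' /eqP //|/(_ f)].
    by rewrite hf rA eqxx.
  split=> //; apply/eqmxP.
  have s : (col_mx (A t) (C t) <= B t)%MS.
    rewrite col_mx_sub AB /C; case: (sel t) => [f|]; [exact: rowsub_sub | exact: sub0mx].
  by rewrite s /=; have [_ <-] := mxrank_leqif_sup s; rewrite rC rB.
rewrite -(@mu_between _ _ _ _ _ _ _ _ a m hS hA hC); last by move=> t St; split; [have [] := hr _ St | have [] := CP _ St].
apply: mu_ext => -[t W]; rewrite /sandwich /between /=; case St: (S t) => //=.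
by have [_ ->] := CP _ St.
Qed.

End BundleCor.

(** * Graded ideals with given Hilbert function *)

Section Model.
Variables (F : closedFieldType) (k B D : nat).
Hypothesis k_gt0 : (0 < k)%N.
Local Notation LL := (K0class (affine_line F)).

(* Degrees are shifted by k + 1, so that the part of degree i of the graded
   ring has dimension rho i and the pieces of degree at most k vanish. *)
Definition rho (i : nat) := (i.-1 %/ k)%N.

Lemma rhoDk i : (0 < i)%N -> rho (i + k) = (rho i).+1.
Proof.
case: i => // i _; rewrite /rho addSn /= -{1}[k]mul1n addnC divnMDl //.
Qed.

Lemma rho_leDk i : (rho (i + k) <= (rho i).+1)%N.
Proof.
case: i => [|i]; last by rewrite rhoDk.
by rewrite /rho add0n; case: (k) k_gt0 => // k' _ /=; rewrite divn_small.
Qed.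

Lemma rho_mono i j : (i <= j)%N -> (rho i <= rho j)%N.
Proof. by move=> h; apply: leq_div2r; lia. Qed.

Lemma rho_small j : (j <= k)%N -> rho j = 0%N.
Proof. by move=> h; apply: divn_small; lia. Qed.

Definition admissible (e : nat -> nat) :=
  [/\ forall i, (e i <= rho i)%N, forall i, (e i <= e i.+1)%N,
      forall i, (0 < e i)%N -> (e i < e (i + k))%N &
      forall i, (B < i + k + 1)%N -> e i = rho i].

Definition point := 'M[F]_(B.+1, D * D).
Definition pt_dtype : dtype F := mx_dtype F B.+1 (D * D).

Definition piece (v : point) (i : nat) : 'M[F]_D := vec_mx (row (inord i) v).
Definition upd (v : point) (j : nat) (W : 'M[F]_D) : point :=
  \matrix_i (if i == inord j then mxvec W else row i v).

Definition shY : 'M[F]_D := \matrix_(i, j) (j == i.+1 :> nat)%:R.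
Definition low r : 'M[F]_D := pid_mx r.

Lemma piece_upd v j W i : (i <= B)%N -> (j <= B)%N ->
  piece (upd v j W) i = if i == j then W else piece v i.
Proof.
move=> iB jB; rewrite /piece rowK.
have -> : (inord i == inord j :> 'I_B.+1) = (i == j).
  by apply/eqP/eqP => [/(congr1 val)|-> //]; rewrite /= !inordK ?ltnS.
by case: eqP => // _; rewrite mxvecK.
Qed.

Lemma piece_upd_eq v j W : (j <= B)%N -> piece (upd v j W) j = W.
Proof. by move=> jB; rewrite piece_upd // eqxx. Qed.

Lemma piece_upd_ne v j W i : (i <= B)%N -> (j <= B)%N -> i != j ->
  piece (upd v j W) i = piece v i.
Proof. by move=> iB jB /negbTE ij; rewrite piece_upd // ij. Qed.

Lemma piece_inj v v' : (forall i, (i <= B)%N -> piece v i = piece v' i) -> v = v'.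
Proof.
move=> h; apply/row_matrixP => i; apply: (can_inj (@vec_mxK F D D)).
by have := h i; rewrite /piece inord_val; apply; rewrite -ltnS.
Qed.

Lemma dmx_piece i : dmx (T := pt_dtype) (fun v => piece v i).
Proof.
move=> a b; have := dmx_dmap (@dmap_id F pt_dtype) (inord i) (mxvec_index a b).
by apply: dfun_ext => v; rewrite mxE mxE.
Qed.

(* The row u of [piece v i] stands for the polynomial
   sum_b u_b x^(i - k - 1 - k b) y^b; multiplication by y is [shY]. *)
Definition inX (e : nat -> nat) (v : point) :=
  [&& [forall i : 'I_B.+1, [&& cform (piece v i) == piece v i, \rank (piece v i) == e i &
        (piece v i <= low (rho i))%MS]],
      [forall i : 'I_B.+1, (i < B)%N ==> (piece v i <= piece v i.+1)%MS] &
      [forall i : 'I_B.+1, (i + k <= B)%N ==> (piece v i *m shY <= piece v (i + k))%MS]].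

Lemma inXP e v : reflect
  [/\ forall i, (i <= B)%N -> [/\ cform (piece v i) = piece v i, \rank (piece v i) = e i &
        (piece v i <= low (rho i))%MS],
      forall i, (i < B)%N -> (piece v i <= piece v i.+1)%MS &
      forall i, (i + k <= B)%N -> (piece v i *m shY <= piece v (i + k))%MS]
  (inX e v).
Proof.
apply: (iffP and3P) => [[/forallP h1 /forallP h2 /forallP h3]|[h1 h2 h3]]; split.
- move=> i iB; have := h1 (inord i); rewrite inordK ?ltnS //.
  by case/and3P => /eqP ? /eqP ? ?.
- by move=> i iB; have := h2 (inord i); rewrite inordK ?iB // ltnS ltnW.
- move=> i iB; have := h3 (inord i); rewrite inordK ?iB // ltnS; lia.
- apply/forallP => i; have [|? ? ?] := h1 i; first by rewrite -ltnS.
  by apply/and3P; split=> //; apply/eqP.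
- by apply/forallP => i; apply/implyP => /h2.
- by apply/forallP => i; apply/implyP => /h3.
Qed.

Lemma dpred_inX e : dpred (T := pt_dtype) (inX e).
Proof.
have hp i := dmx_piece i.
apply: dpredI; first apply: dpred_forall => i; last apply: dpredI; try apply: dpred_forall => i.
- apply: dpredI; first by apply: dpred_mxeq => //; apply: dmx_cform.
  apply: dpredI; first by apply: dnat_eq; apply: dnat_rank.
  by apply: dpred_sub => //; apply: dmx_const.
- have h : dpred (T := pt_dtype) (fun v => (piece v i <= piece v i.+1)%MS) by apply: dpred_sub.
  exact: dpred_imply h.
- have h : dpred (T := pt_dtype) (fun v => (piece v i *m shY <= piece v (i + k))%MS).
    by apply: dpred_sub => //; apply: dmx_mul => //; apply: dmx_const.
  exact: dpred_imply h.
Qed.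

(* The elements of degree j mapped into the ideal by both x and y. *)
Definition soc (j : nat) (v : point) : 'M[F]_(D + D, D) :=
  capmx_gen (piece v j.+1) (kermx (shY *m cokermx (piece v (j + k)))).

Definition strat (e : nat -> nat) j t (v : point) := inX e v && (\rank (soc j v) == e j + t)%N.

Lemma dmx_soc j : dmx (T := pt_dtype) (soc j).
Proof.
apply: dmx_cap; first exact: dmx_piece.
apply: dmx_ker; apply: dmx_mul; first exact: dmx_const.
by apply: dmx_coker; apply: dmx_piece.
Qed.

Lemma lowP r (u : 'rV[F]_D) :
  reflect (forall j : 'I_D, (r <= j)%N -> u 0 j = 0) (u <= low r)%MS.
Proof.
apply: (iffP idP) => [/submxP [x ->] j rj|h].
  rewrite mxE big1 // => l _; rewrite mxE.
  case: eqP => [e|]; rewrite ?mulr0 //= (_ : (l < r)%N = false) ?mulr0 //.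
  by rewrite ltnNge (_ : l = j) ?rj //; apply: val_inj.
suff -> : u = u *m low r by apply: submxMl.
apply/rowP => j; rewrite mxE (bigD1 j) //= big1 ?addr0 => [|l lj].
  rewrite mxE eqxx /=; case: ltnP => [_|/h ->]; last by rewrite mul0r.
  by rewrite mulr1.
by rewrite mxE (_ : (l == j :> nat) = false) ?mulr0 //; apply/negbTE.
Qed.

Lemma mulYE (u : 'rV[F]_D) (i j : 'I_D) : j = i.+1 :> nat -> (u *m shY) 0 j = u 0 i.
Proof.
move=> ji; rewrite mxE (bigD1 i) //= big1 ?addr0 => [|l li].
  by rewrite mxE ji eqxx mulr1.
rewrite mxE ji eqSS eq_sym (_ : (l == i :> nat) = false) ?mulr0 //; exact/negbTE.
Qed.

Lemma low_mono r s : (r <= s)%N -> (low r <= low s)%MS.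
Proof.
move=> rs; apply/row_subP => i; apply/lowP => j sj; rewrite !mxE.
case: eqP => //= ->; rewrite ltnNge (leq_trans rs) //.
Qed.

Lemma rank_low r : (r <= D)%N -> \rank (low r) = r.
Proof. by move=> h; rewrite rank_pid_mx. Qed.

Lemma lowY m r s (A : 'M[F]_(m, D)) : (r < D)%N -> (A <= low r)%MS ->
  (A *m shY <= low s)%MS -> (A <= low s.-1)%MS.
Proof.
move=> rD /row_subP Ar /row_subP As; apply/row_subP => l; apply/lowP => j sj.
case: (leqP r j) => rj; first by move/lowP: (Ar l); apply.
have jD : (j.+1 < D)%N by lia.
rewrite -(@mulYE _ j (Ordinal jD)) // -row_mul.
move/lowP: (As l); apply => /=; lia.
Qed.

Lemma mulY_inj m r (A : 'M[F]_(m, D)) : (r < D)%N -> (A <= low r)%MS ->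
  A *m shY = 0 -> A = 0.
Proof.
move=> rD Ar AY; apply/eqP; rewrite -submx0.
have A0 : (A <= low 0)%MS by apply: (lowY rD Ar (s := 0)); rewrite AY sub0mx.
apply: submx_trans A0 _.
by apply/row_subP => i; rewrite (_ : row i _ = 0) ?sub0mx //; apply/rowP => j; rewrite !mxE /= ltn0 andbF.
Qed.

Lemma rank_mulY m r (A : 'M[F]_(m, D)) : (r < D)%N -> (A <= low r)%MS ->
  \rank (A *m shY) = \rank A.
Proof.
move=> rD Ar; rewrite -(mxrank_mul_ker A shY).
suff -> : (A :&: kermx shY)%MS = 0 by rewrite mxrank0 addn0.
apply: (mulY_inj rD); first exact: submx_trans (capmxSl _ _) Ar.
exact/sub_kermxP/capmxSr.
Qed.

Lemma Y_stable0 r m (W : 'M[F]_(m, D)) : (r < D)%N -> (W <= low r)%MS ->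
  (W *m shY <= W)%MS -> W = 0.
Proof.
elim: r => [|r IH] rD Wr WY.
  apply/eqP; rewrite -submx0; apply: submx_trans Wr _.
  by apply/row_subP => i; rewrite (_ : row i _ = 0) ?sub0mx //; apply/rowP => j; rewrite !mxE /= ltn0 andbF.
by apply: IH => //; [lia | apply: (lowY rD Wr (submx_trans WY Wr))].
Qed.

Lemma sub_soc m j v (X : 'M[F]_(m, D)) :
  (X <= soc j v)%MS = (X <= piece v j.+1)%MS && (X *m shY <= piece v (j + k))%MS.
Proof.
rewrite sub_capmx_gen; congr (_ && _); rewrite [RHS]submxE -mulmxA.
by apply/sub_kermxP/eqP.
Qed.

Hypothesis ltD : (rho B < D)%N.

Lemma rho_ltD i : (i <= B)%N -> (rho i < D)%N.
Proof. by move=> /rho_mono h; apply: leq_ltn_trans h ltD. Qed.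

Lemma soc_low e j v : (j + k + 1 <= B)%N -> inX e v -> (soc j v <= low (rho j))%MS.
Proof.
move=> jB /inXP [h1 _ _].
have : (soc j v <= soc j v)%MS by [].
rewrite sub_soc => /andP [s1 s2].
have [|_ _ l1] := h1 j.+1; first lia.
have [|_ _ l2] := h1 (j + k)%N; first lia.
apply: submx_trans (low_mono (r := (rho (j + k)).-1) _).
  by apply: (lowY (r := rho j.+1)) (submx_trans s1 l1) (submx_trans s2 l2); apply: rho_ltD; lia.
have := rho_leDk j; lia.
Qed.

Lemma sub_piece_soc e j v : (j + k + 1 <= B)%N -> inX e v -> (piece v j <= soc j v)%MS.
Proof. by move=> jB /inXP [_ h2 h3]; rewrite sub_soc h2 ?h3 //; lia. Qed.

Definition raise (e : nat -> nat) j m i := if i == j then (e j + m)%N else e i.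

Lemma soc_upd j v W : (j + k + 1 <= B)%N -> soc j (upd v j W) = soc j v.
Proof.
move=> jB; have e1 : piece (upd v j W) j.+1 = piece v j.+1 by apply: piece_upd_ne; lia.
have e2 : piece (upd v j W) (j + k) = piece v (j + k) by apply: piece_upd_ne; lia.
by rewrite /soc e1 e2.
Qed.

Lemma upd_upd v j W : (j <= B)%N -> upd (upd v j W) j (piece v j) = v.
Proof.
move=> jB; apply: piece_inj => i iB; rewrite !piece_upd //.
by case: eqP => [->|].
Qed.

Lemma inX_up e j m v W : (j + k + 1 <= B)%N -> inX e v -> cform W = W ->
  (piece v j <= W)%MS -> (W <= soc j v)%MS -> \rank W = (e j + m)%N ->
  inX (raise e j m) (upd v j W).
Proof.
move=> jB vX cW VW; rewrite sub_soc => /andP [W1 W2] rW.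
have Wl : (W <= low (rho j))%MS.
  by apply: submx_trans (soc_low jB vX); rewrite sub_soc W1.
have jB' : (j <= B)%N by lia.
have /inXP [h1 h2 h3] := vX; apply/inXP; split=> i iB.
- rewrite /raise; have [->|ij] := eqVneq i j; first by rewrite piece_upd_eq.
  by rewrite piece_upd_ne //; apply: h1.
- have [->|ij] := eqVneq i j.
    by rewrite piece_upd_eq // piece_upd_ne //; lia.
  rewrite (piece_upd_ne _ _ _ jB' ij); last lia.
  have [e1|ij1] := eqVneq i.+1 j; last by rewrite piece_upd_ne //; apply: h2.
  by rewrite e1 piece_upd_eq //; apply: submx_trans VW; rewrite -e1; apply: h2.
- have [->|ij] := eqVneq i j.
    by rewrite piece_upd_eq // piece_upd_ne //; lia.
  rewrite (piece_upd_ne _ _ _ jB' ij); last lia.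
  have [e1|ij1] := eqVneq (i + k)%N j; last by rewrite piece_upd_ne //; apply: h3.
  by rewrite e1 piece_upd_eq //; apply: submx_trans VW; rewrite -e1; apply: h3.
Qed.

Definition gen (j : nat) (v : point) : 'M[F]_(D + D, D) :=
  col_mx (piece v j.-1) (piece v (j - k) *m shY).

Lemma inX_down e j m v U : (k < j)%N -> (j + k + 1 <= B)%N -> inX (raise e j m) v ->
  cform U = U -> (gen j v <= U)%MS -> (U <= piece v j)%MS -> \rank U = e j ->
  inX e (upd v j U).
Proof.
move=> kj jB vX cU; rewrite col_mx_sub => /andP [U1 U2] UV rU.
have jB' : (j <= B)%N by lia.
have /inXP [h1 h2 h3] := vX; apply/inXP; split=> i iB.
- have [] := h1 i iB; rewrite /raise; have [->|ij] := eqVneq i j.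
    by rewrite piece_upd_eq // => _ _ l; split=> //; apply: submx_trans l.
  by rewrite piece_upd_ne.
- have [->|ij] := eqVneq i j.
    rewrite piece_upd_eq // piece_upd_ne //; try lia.
    by apply: submx_trans UV _; apply: h2; lia.
  rewrite (piece_upd_ne _ _ _ jB' ij); last lia.
  have [e1|ij1] := eqVneq i.+1 j; last by rewrite piece_upd_ne //; apply: h2.
  by rewrite e1 piece_upd_eq //; move: U1; rewrite -e1.
- have [->|ij] := eqVneq i j.
    rewrite piece_upd_eq // piece_upd_ne //; try lia.
    by apply: submx_trans (submxMr _ UV) _; apply: h3; lia.
  rewrite (piece_upd_ne _ _ _ jB' ij); last lia.
  have [e1|ij1] := eqVneq (i + k)%N j; last by rewrite piece_upd_ne //; apply: h3.
  by rewrite e1 piece_upd_eq //; move: U2; rewrite -e1 addnK.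
Qed.

Lemma gen_sub e j v : (k < j)%N -> (j <= B)%N -> inX e v -> (gen j v <= piece v j)%MS.
Proof.
move=> kj jB /inXP [_ h2 h3]; rewrite col_mx_sub.
have := h2 j.-1; rewrite prednK; last lia; move=> -> /=; last lia.
by have := h3 (j - k)%N; rewrite subnK; [apply|]; lia.
Qed.

(* Multiplication by y identifies the common multiples of x and y in the
   generated part with the socle elements of degree j - 1 - k. *)
Lemma rank_gen e j v : (k < j)%N -> (j <= B)%N -> inX e v ->
  (\rank (gen j v) + \rank (soc (j - k.+1) v) = e j.-1 + e (j - k))%N.
Proof.
move=> kj jB vX; have /inXP [h1 h2 h3] := vX.
have [|_ r1 l1] := h1 j.-1; first lia.
have [|_ r2 l2] := h1 (j - k)%N; first lia.
have ltr : (rho (j - k) < D)%N by apply: rho_ltD; lia.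
rewrite -r1 -r2 -(rank_mulY ltr l2) -[RHS]mxrank_sum_cap addsmxE; congr (_ + _)%N.
have sl : (soc (j - k.+1) v <= piece v (j - k))%MS.
  have : (soc (j - k.+1) v <= soc (j - k.+1) v)%MS by [].
  by rewrite sub_soc (_ : (j - k.+1).+1 = j - k)%N; [case/andP | lia].
rewrite -(rank_mulY ltr (submx_trans sl l2)); apply/eqmx_rank/andP; split.
  have : (soc (j - k.+1) v <= soc (j - k.+1) v)%MS by [].
  rewrite sub_soc (_ : j - k.+1 + k = j.-1)%N; last lia.
  by case/andP => _ s2; rewrite sub_capmx s2 submxMr.
have /submxP [x xE] := capmxSr (piece v j.-1) (piece v (j - k) *m shY).
rewrite xE mulmxA; apply: submxMr; rewrite sub_soc -mulmxA -xE.
rewrite (_ : j - k.+1 + k = j.-1)%N; last lia.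
by rewrite capmxSl (_ : (j - k.+1).+1 = j - k)%N ?submxMl //; lia.
Qed.

Lemma dmap_upd j : dmap (fun x : point * 'M[F]_D => (upd x.1 j x.2, piece x.1 j) : point * 'M[F]_D).
Proof.
pose TT := prod_dtype pt_dtype (mx_dtype F D D).
have h1 : dmap (T := TT) (fun x : point * 'M[F]_D => x.1) by apply: dmap_fst.
have h2 : dmx (T := TT) (fun x => x.2) by apply: dmx_dmap; apply: dmap_snd.
apply: (@dmap_pair _ TT); last first.
  by apply: (@dmap_mx _ TT); apply: (dmx_comp h1 (dmx_piece j)).
apply: (@dmap_mx _ TT) => i c; rewrite /upd.
case ij : (i == inord j).
  case/mxvec_indexP: c => a b; apply: dfun_ext (h2 a b) => x.
  by rewrite mxE ij mxvecE.
apply: dfun_ext (dmx_dmap h1 i c) => x.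
by rewrite [RHS]mxE ij mxE.
Qed.

Lemma mu_switch e j m : (k < j)%N -> (j + k + 1 <= B)%N ->
  mu (sandwich (T := pt_dtype) (inX e) (fun v => piece v j) (soc j) (e j + m)%N) =
  mu (sandwich (T := pt_dtype) (inX (raise e j m)) (gen j) (fun v => piece v j) (e j)).
Proof.
move=> kj jB; have jB' : (j <= B)%N by lia.
apply: (mu_bij (f := fun x => (upd x.1 j x.2, piece x.1 j)) (g := fun x => (upd x.1 j x.2, piece x.1 j))).
- by apply: dpred_sandwich; [apply: dpred_inX | apply: dmx_piece | apply: dmx_soc].
- apply: dpred_sandwich; [exact: dpred_inX | | exact: dmx_piece].
  apply: dmx_col_mx; first exact: dmx_piece.
  by apply: dmx_mul; [apply: dmx_piece | apply: dmx_const].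
- exact: dmap_upd.
- exact: dmap_upd.
- move=> [v W] /and5P [/= vX /eqP cW VW WS /eqP rW]; split; last first.
    by rewrite upd_upd // piece_upd_eq.
  have /inXP [h1 h2 h3] := vX; have [c1 r1 _] := h1 j jB'.
  rewrite /sandwich /= (inX_up jB vX) // c1 r1 !eqxx piece_upd_eq // VW andbT /=.
  have := gen_sub kj jB' vX; rewrite /gen.
  have e1 : piece (upd v j W) j.-1 = piece v j.-1 by apply: piece_upd_ne; lia.
  have e2 : piece (upd v j W) (j - k) = piece v (j - k) by apply: piece_upd_ne; lia.
  by rewrite e1 e2 => ->.
- move=> [v U] /and5P [/= vX /eqP cU GU UV /eqP rU]; split; last first.
    by rewrite upd_upd // piece_upd_eq.
  have /inXP [h1 h2 h3] := vX; have [c1 r1 _] := h1 j jB'.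
  rewrite /sandwich /= (inX_down kj jB vX) // c1 r1 /raise !eqxx piece_upd_eq // UV soc_upd //.
  by rewrite (sub_piece_soc jB vX).
Qed.

Lemma sum_strat e j m N : (j + k + 1 <= B)%N -> (D < N)%N ->
  \sum_(t < N) mu (T := pt_dtype) (strat e j t) * qb LL t m =
  mu (sandwich (T := pt_dtype) (inX e) (fun v => piece v j) (soc j) (e j + m)%N).
Proof.
move=> jB DN; have hp := dmx_piece j; have hs := dmx_soc j; have hX := dpred_inX e.
have h1 : dmap (fun x : pt_dtype * 'M[F]_D => x.1) by apply: dmap_fst.
rewrite (@mu_partition _ _ _ (fun x => (\rank (soc j x.1) - e j)%N) N); first last.
- move=> [v W] _ /=; have := rank_leq_col (soc j v); lia.
- move=> i; have := dnat_rank (dmx_comp h1 hs) (i + e j)%N.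
  by congr dpred; apply/funext => x; rewrite ltn_subRL addnC.
- exact: dpred_sandwich.
apply: eq_bigr => t _; rewrite -(mu_sandwich m (S := strat e j t) (T := pt_dtype) (A := fun v => piece v j) (B := soc j) (a := e j)) //.
- apply: mu_ext => -[v W]; rewrite /sandwich /strat /=.
  case vX: (inX e v) => //=; rewrite andbC.
  have /inXP [hr _ _] := vX; have [|_ rj _] := hr j; first lia.
  have := mxrankS (sub_piece_soc jB vX); rewrite rj => le; congr (_ && _); apply/eqP/eqP; lia.
- by apply: dpredI => //; apply: dnat_eq; apply: dnat_rank.
- move=> v /andP [vX /eqP rs]; split=> //; first exact: sub_piece_soc jB vX.
  by have /inXP [hr _ _] := vX; have [|_ rj _] := hr j; first lia.
Qed.

Lemma sum_strat' e j m N : (k < j)%N -> (j + k + 1 <= B)%N -> (D < N)%N ->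
  let e' := raise e j m in let i := (j - k.+1)%N in
  mu (sandwich (T := pt_dtype) (inX e') (gen j) (fun v => piece v j) (e j)) =
  \sum_(t < N) mu (T := pt_dtype) (strat e' i t) *
    qb LL (e j + m - e j.-1 - (e (j - k)%N - e i - t))%N m.
Proof.
move=> kj jB DN e' i; have hp := dmx_piece j; have hs := dmx_soc i; have hX := dpred_inX e'.
have hg : dmx (T := pt_dtype) (gen j).
  apply: dmx_col_mx; first exact: dmx_piece.
  by apply: dmx_mul; [apply: dmx_piece | apply: dmx_const].
have h1 : dmap (fun x : pt_dtype * 'M[F]_D => x.1) by apply: dmap_fst.
rewrite (@mu_partition _ _ _ (fun x => (\rank (soc i x.1) - e' i)%N) N); first last.
- move=> [v W] _ /=; have := rank_leq_col (soc i v); lia.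
- move=> l; have := dnat_rank (dmx_comp h1 hs) (l + e' i)%N.
  by congr dpred; apply/funext => x; rewrite ltn_subRL addnC.
- exact: dpred_sandwich.
have iB : (i + k + 1 <= B)%N by rewrite /i; lia.
have e'i : e' i = e i by rewrite /e' /raise (_ : (i == j) = false) // /i; lia.
have e'j : e' j = (e j + m)%N by rewrite /e' /raise eqxx.
have e'1 : e' j.-1 = e j.-1 by rewrite /e' /raise (_ : (j.-1 == j) = false) //; lia.
have e'2 : e' (j - k)%N = e (j - k)%N by rewrite /e' /raise (_ : (j - k == j)%N = false) //; lia.
apply: eq_bigr => t _.
transitivity (mu (sandwich (T := pt_dtype) (strat e' i t) (gen j) (fun v => piece v j) (e j))).
  apply: mu_ext => -[v W]; rewrite /sandwich /strat /=.
  case vX: (inX e' v) => //=; rewrite andbC.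
  have /inXP [hr _ _] := vX; have [|_ ri _] := hr i; first lia.
  have := mxrankS (sub_piece_soc iB vX); rewrite ri => le; congr (_ && _); apply/eqP/eqP; lia.
case: (pselect (exists v, strat e' i t v)) => [[v0 v0X]|nv]; last first.
  have nv' v : strat e' i t v = false by apply/negP => h; apply: nv; exists v.
  by rewrite !mu_false ?mul0r // => [v|[v W]]; rewrite ?/sandwich /= ?nv'.
have hst v : strat e' i t v -> [/\ (gen j v <= piece v j)%MS,
    (\rank (gen j v) + (e i + t) = e j.-1 + e (j - k))%N,
    (\rank (gen j v) <= e j + m)%N, \rank (piece v j) = (e j + m)%N & (e i + t <= e (j - k))%N].
  move=> /andP [vX /eqP rs]; have jB' : (j <= B)%N by lia.
  have gs := gen_sub kj jB' vX; have rg := rank_gen kj jB' vX.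
  have /inXP [hr _ _] := vX; have [_ rj _] := hr j jB'; have [|_ rk _] := hr (j - k)%N; first lia.
  split=> //.
  - by rewrite -e'i -rs -e'1 -e'2.
  - by rewrite -e'j -rj; apply: mxrankS.
  - by rewrite rj.
  - rewrite -e'i -rs -e'2 -rk; apply: mxrankS.
    have : (soc i v <= soc i v)%MS by [].
    by rewrite sub_soc /i (_ : (j - k.+1).+1 = j - k)%N; [case/andP | lia].
have [_ q1 q2 _ q3] := hst _ v0X.
set a := (e j.-1 + e (j - k) - (e i + t))%N.
have dS : dpred (T := pt_dtype) (strat e' i t).
  by apply: dpredI => //; apply: dnat_eq; apply: dnat_rank.
have hra v : strat e' i t v -> [/\ (gen j v <= piece v j)%MS, \rank (gen j v) = a &
    \rank (piece v j) = (a + (e j + m - a))%N].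
  by move=> /hst [s1 s2 s3 s4 s5]; split=> //; rewrite /a ?s4; lia.
have -> : (e j + m - e j.-1 - (e (j - k) - e i - t) = e j + m - a)%N by rewrite /a; lia.
case: (leqP a (e j)) => aj.
  have := mu_sandwich (e j - a) dS hg hp hra; rewrite subnKC // => ->.
  congr (_ * _); have -> : (e j + m - a = (e j - a) + m)%N by lia.
  exact: qb_sym.
rewrite mu_false; last first.
  move=> [v W]; apply/negP => /and5P [/= vS _ gW _ /eqP rW].
  by have [_ rg _] := hra _ vS; have := mxrankS gW; rewrite rW rg; lia.
by rewrite qb_gt ?mulr0 //; rewrite /a in aj q2 *; lia.
Qed.

Lemma inX_admissible e v : (forall i, (B < i + k + 1)%N -> e i = rho i) ->
  (k < B)%N -> inX e v -> admissible e.
Proof.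
move=> htail kB /inXP [h1 h2 h3].
have hle i : (e i <= rho i)%N.
  case: (leqP i B) => iB; last by rewrite htail //; lia.
  have [_ <- l] := h1 i iB; rewrite -[leqRHS](@rank_low (rho i)) ?mxrankS //.
  by rewrite ltnW // rho_ltD.
have hmono i : (e i <= e i.+1)%N.
  case: (leqP i.+1 B) => iB; last by rewrite !htail ?rho_mono //; lia.
  have [_ <- _] := h1 i (ltnW iB); have [_ <- _] := h1 i.+1 iB.
  exact/mxrankS/h2.
split=> // i ei; case: (leqP (i + k) B) => iB; last first.
  have i0 : (0 < i)%N by case: (i) iB kB => //; lia.
  by rewrite !htail ?rhoDk //; lia.
have [|_ r1 l1] := h1 i; first lia.
have [_ r2 _] := h1 (i + k)%N iB.
have sub l : (i + l <= B)%N -> (piece v i <= piece v (i + l))%MS.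
  elim: l => [|l IH] lB; first by rewrite addn0.
  by rewrite addnS; apply: submx_trans (IH _) (h2 _ _); lia.
rewrite -r1 -r2 ltn_neqAle (mxrankS (sub _ iB)) andbT.
have [_ ->] := mxrank_leqif_sup (sub _ iB).
apply/negP => s; have := Y_stable0 (rho_ltD _) l1 (submx_trans (h3 _ iB) s).
have -> : (i <= B)%N by lia.
by move=> /(_ isT) p0; move: ei; rewrite -r1 p0 mxrank0.
Qed.

End Model.

Lemma qb_disjoint (A : comPzRingType) (q : A) n x m :
  qb q n x * qb q (n - x) m = qb q n m * qb q (n - m) x.
Proof.
have h1 := qb_trinomial q n (leq_addl x m); have h2 := qb_trinomial q n (leq_addr m x).
by move: h1 h2; rewrite addnK addKn qb_sym => <- <-.
Qed.

Section Count.
Variables (F : closedFieldType) (k B D : nat).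
Hypothesis k_gt0 : (0 < k)%N.
Hypothesis ltD : (rho k B < D)%N.
Hypothesis ltkB : (k < B)%N.
Local Notation LL := (K0class (affine_line F)).
Local Notation Q := (qb LL).
Local Notation adm := (admissible k B).
Local Notation PT := (pt_dtype F B D).

Local Arguments qb : simpl never.

Definition step (e : nat -> nat) i := (e i.+1 - e i)%N.
Definition excess (e : nat -> nat) i := (e (i + 1 + k)%N - e i.+1 - 1)%N.
Definition excess1 (e : nat -> nat) i := (e (i + k)%N - e i - 1)%N.
Definition fac e i : K0 F := Q (step e i + excess e i) (step e i).
Definition facs e : K0 F := \prod_(i < B) fac e i.
Definition facs1 e j : K0 F := \prod_(i < B | i != j :> nat) fac e i.

(* The class of the stratum of socle dimension t in degree j. *)
Definition weight e j t : K0 F :=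
  if (t <= step e j)%N then
    LL ^+ ((excess1 e j - t) * (step e j - t)) * Q (excess1 e j) t *
    Q (step e (j + k)%N) (step e j - t) * facs1 e j
  else 0.

Definition moment e j m : K0 F :=
  if (m <= step e j)%N then
    Q (excess1 e j) m * Q (step e j - m + excess e j) (step e j - m) * facs1 e j
  else 0.

Lemma facsD1 e j : (j < B)%N -> facs e = fac e j * facs1 e j.
Proof. by move=> jB; rewrite /facs (bigD1 (Ordinal jB)). Qed.

Lemma sum_upto (g : nat -> K0 F) a N : (a < N)%N ->
  \sum_(t < N) (if (t <= a)%N then g t else 0) = \sum_(t < a.+1) g t.
Proof.
by move=> aN; rewrite -big_mkcond [RHS](big_ord_widen N g aN).
Qed.

Lemma weight_moment e j m N : adm e -> (step e j < N)%N ->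
  \sum_(t < N) weight e j t * Q t m = moment e j m.
Proof.
move=> [h1 h2 h3 h4] jN.
pose g t := LL ^+ ((excess1 e j - t) * (step e j - t)) * Q (excess1 e j) t *
    Q (step e (j + k)%N) (step e j - t) * Q t m * facs1 e j.
transitivity (\sum_(t < N) (if (t <= step e j)%N then g t else 0)).
  by apply: eq_bigr => t _; rewrite /weight /g; case: ifP => _; [ring | rewrite mul0r].
rewrite sum_upto // -mulr_suml qb_moment /moment; case: leqP => mM; last by rewrite mul0r.
case: (leqP m (excess1 e j)) => mn; last by rewrite qb_gt // !mul0r.
congr (_ * _ * _).
have := h2 j; have := h2 (j + k)%N; have := h3 j; have := h3 j.+1.
have [e0|e0] := posnP (step e j); first by rewrite (_ : (step e j - m = 0)%N) ?qbn0 // e0.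
move=> a1 a2 a3 a4; congr qb; move: e0 mM mn; rewrite /step /excess /excess1.
rewrite (_ : (j + 1 + k)%N = (j + k).+1); last lia.
rewrite addSn in a1; move=> e0 mM mn.
have [z|z] := posnP (e j).
  have : (e j.+1 <= e (j + k)%N)%N.
    have mono l : (e j.+1 <= e (j.+1 + l))%N.
      by elim: l => [|l IH]; rewrite ?addn0 // addnS (leq_trans IH).
    by have := mono k.-1; rewrite addSnnS prednK.
  by move: a1; lia.
by move: a1; lia.
Qed.

Lemma adm_mono e i j : adm e -> (i <= j)%N -> (e i <= e j)%N.
Proof.
move=> [_ h2 _ _] ij; rewrite -(subnKC ij); elim: (j - i)%N => [|l IH]; first by rewrite addn0.
by rewrite addnS (leq_trans IH).
Qed.

Lemma adm_bmp e j m : adm e -> (j + k + 1 <= B)%N -> (0 < m)%N ->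
  (m <= step e j)%N -> (m <= excess1 e j)%N -> adm (raise e j m) /\ (k < j)%N.
Proof.
move=> /[dup] he [h1 h2 h3 h4] jB m0; rewrite /step /excess1 => mM mn.
have rj : (e j + m <= rho k j)%N.
  have := rho_leDk k_gt0 j; have := h1 (j + k)%N; lia.
have kj : (k < j)%N by rewrite ltnNge; apply/negP => /(rho_small k_gt0) r0; lia.
split=> //; split=> i; rewrite /raise.
- by case: eqP => [->|_].
- have := h2 i; case: (i =P j) => [->|_]; case: eqP => [e1|_]; try lia.
  by rewrite e1; lia.
- case: (i =P j) => [->|_]; case: eqP => [e1|_]; try lia; try exact: h3.
  by move=> /h3; rewrite e1; lia.
- by move=> iB; rewrite (_ : (i == j) = false) ?h4 //; lia.
Qed.

Lemma facs_raise e j m : (0 < m)%N -> adm e -> adm (raise e j m) -> (k < j)%N -> (j < B)%N ->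
  let i := (j - k.+1)%N in let e' := raise e j m in
  Q (e j + m - e j.-1) m * Q (excess1 e' i + (e j + m - e j.-1 - m)) (step e' i) *
    facs1 e' i = moment e j m.
Proof.
move=> m0 he he' kj jB i e'.
have iB : (i < B)%N by rewrite /i; lia.
have j1B : (j.-1 < B)%N by lia.
pose P l := [&& l != i, l != j.-1 & l != j].
pose rest (e1 : nat -> nat) := \prod_(l < B | P l) fac e1 l.
have E1 (e1 : nat -> nat) : facs1 e1 i = fac e1 j.-1 * (fac e1 j * rest e1).
  rewrite /facs1 (bigD1 (Ordinal j1B)) /=; last by rewrite /i; lia.
  rewrite (bigD1 (Ordinal jB)) /=; last by rewrite -!val_eqE /= /i; lia.
  congr (_ * (_ * _)); apply: eq_bigl => l; rewrite /P -!val_eqE /= -andbA.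
  by [].
have E2 (e1 : nat -> nat) : facs1 e1 j = fac e1 j.-1 * (fac e1 i * rest e1).
  rewrite /facs1 (bigD1 (Ordinal j1B)) /=; last lia.
  rewrite (bigD1 (Ordinal iB)) /=; last by rewrite -!val_eqE /= /i; lia.
  congr (_ * (_ * _)); apply: eq_bigl => l; rewrite /P -!val_eqE /=.
  by case: eqP; case: eqP; case: eqP.
have e'j : e' j = (e j + m)%N by rewrite /e' /raise eqxx.
have e'n l : l != j -> e' l = e l by move=> /negbTE h; rewrite /e' /raise h.
have rr : rest e' = rest e.
  apply: eq_bigr => l /and3P [l1 l2 l3]; rewrite /fac /step /excess !e'n //.
  - by move: l1; rewrite /i; lia.
  - by move: l2; lia.
have [h1 h2 h3 h4] := he; have [g1 g2 g3 g4] := he'.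
have s1 : step e' j = (step e j - m)%N.
  by rewrite /step e'j e'n; lia.
have s2 : excess e' j = excess e j.
  by rewrite /excess !e'n //; lia.
have mM : (m <= step e j)%N.
  by have := g2 j; rewrite -/e' e'j e'n /step; lia.
rewrite /moment mM E1 E2 rr.
have -> : fac e' j = Q (step e j - m + excess e j) (step e j - m) by rewrite /fac s1 s2.
set X := Q (step e j - m + _) _; set R := rest e.
suff H : Q (e j + m - e j.-1) m * Q (excess1 e' i + (e j + m - e j.-1 - m)) (step e' i) *
    fac e' j.-1 = Q (excess1 e j) m * fac e j.-1 * fac e i.
  transitivity (Q (e j + m - e j.-1) m * Q (excess1 e' i + (e j + m - e j.-1 - m)) (step e' i) *
    fac e' j.-1 * (X * R)); first by ring.
  by rewrite H; ring.
have ej1 : (e j.-1 <= e j)%N by apply: (adm_mono he); lia.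
have -> : Q (excess1 e' i + (e j + m - e j.-1 - m)) (step e' i) = fac e i.
  rewrite /fac (_ : step e' i = step e i); last by rewrite /step !e'n // /i; lia.
  have [z|z] := posnP (step e i); first by rewrite z !qbn0.
  congr qb; move: z; rewrite /step /excess /excess1 !e'n; try (rewrite /i; lia).
  have -> : (i + 1 + k = j)%N by rewrite /i; lia.
  have -> : (i + k = j.-1)%N by rewrite /i; lia.
  have -> : (i.+1 = j - k)%N by rewrite /i; lia.
  move=> z; have a1 := h3 (j - k)%N; have a2 := h3 i.
  rewrite (_ : i + k = j.-1)%N in a2; last by rewrite /i; lia.
  rewrite subnK in a1; last lia.
  have a3 : (e (j - k) <= e j.-1)%N by apply: (adm_mono he); lia.
  by lia.
suff H : Q (e j + m - e j.-1) m * fac e' j.-1 = Q (excess1 e j) m * fac e j.-1.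
  by rewrite mulrAC H.
have mn : (e j + m < e (j + k)%N)%N.
  have := g3 j; rewrite -/e' e'j e'n; last lia.
  by apply; lia.
have -> : fac e' j.-1 = Q (e j + m - e j.-1 + (e (j + k)%N - e j - 1 - m)) (e j + m - e j.-1).
  rewrite /fac /step /excess prednK; last lia.
  rewrite e'j !e'n; try lia.
  have -> : (j.-1 + 1 + k = j + k)%N by lia.
  congr qb; lia.
have -> : fac e j.-1 = Q (e j - e j.-1 + (e (j + k)%N - e j - 1)) (e j - e j.-1).
  rewrite /fac /step /excess prednK; last lia.
  by have -> : (j.-1 + 1 + k = j + k)%N by lia.
rewrite /excess1; set n := (e (j + k)%N - e j - 1)%N.
have [N' nE] : exists N', n = (m + N')%N by exists (n - m)%N; rewrite /n; lia.
rewrite nE addKn; have -> : (e j + m - e j.-1 = m + (e j - e j.-1))%N by lia.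
move: (e j - e j.-1)%N => M.
rewrite mulrC qb_multinomial; have -> : (M + (m + N') = m + N' + M)%N by lia.
have -> : Q (m + N' + M) M = Q (m + N' + M) (m + N') by rewrite addnC qb_sym.
rewrite [RHS]mulrC qb_multinomial.
have -> : (m + N' + M = m + M + N')%N by lia.
by rewrite [(N' + M)%N]addnC qb_sym.
Qed.

Lemma weight_sum e i C m N : (step e i < N)%N -> step e (i + k) = C -> (m <= C)%N ->
  \sum_(t < N) weight e i t * Q (C - (step e i - t)) m =
  Q C m * Q (excess1 e i + (C - m)) (step e i) * facs1 e i.
Proof.
move=> aN hC mC.
pose g t := LL ^+ ((excess1 e i - t) * (step e i - t)) * Q (excess1 e i) t *
    Q (C - m) (step e i - t).
transitivity (\sum_(t < N) (if (t <= step e i)%N then Q C m * g t * facs1 e i else 0)).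
  apply: eq_bigr => t _; rewrite /weight hC /g; case: ifP => _; last by rewrite mul0r.
  have := qb_disjoint LL C (step e i - t) m => h.
  transitivity (LL ^+ ((excess1 e i - t) * (step e i - t)) * Q (excess1 e i) t *
    (Q C (step e i - t) * Q (C - (step e i - t)) m) * facs1 e i); first by ring.
  by rewrite h; ring.
rewrite (sum_upto (fun t => Q C m * g t * facs1 e i)) // -mulr_suml -mulr_sumr.
by rewrite -qb_vandermonde.
Qed.

Definition count_ok e := mu (T := PT) (inX k e) = facs e /\
  forall j, (j + k + 1 <= B)%N -> forall t, (t <= D)%N ->
    mu (T := PT) (strat k e j t) = weight e j t.

Lemma adm_le_D e j : adm e -> (j <= B)%N -> (e j <= D)%N.
Proof. by move=> [h1 _ _ _] jB; have := rho_ltD k_gt0 ltD jB; have := h1 j; lia. Qed.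

Lemma strat_moment e j m : adm e -> (0 < m)%N -> (j + k + 1 <= B)%N ->
  (forall e', adm e' -> (forall i, e i <= e' i)%N -> (e j < e' j)%N -> count_ok e') ->
  \sum_(t < D.+1) mu (T := PT) (strat k e j t) * Q t m = moment e j m.
Proof.
move=> he m0 jB IH; rewrite (sum_strat F k_gt0 ltD) //.
have [[ha kj]|nha] := pselect (adm (raise e j m) /\ (k < j)%N); last first.
  rewrite mu_false; last first.
    move=> [v W]; apply/negP => /and5P [/= vX /eqP cW VW WS /eqP rW]; apply: nha.
    have vX' := inX_up k_gt0 ltD jB vX cW VW WS rW.
    have [h1 h2 h3 h4] := he.
    have ha : adm (raise e j m).
      apply: (inX_admissible k_gt0 ltD) vX' => // i iB.
      by rewrite /raise (_ : (i == j) = false) ?h4 //; lia.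
    split=> //; rewrite ltnNge; apply/negP => /(rho_small k_gt0) r0.
    by have [/(_ j)] := ha; rewrite /raise eqxx r0; lia.
  rewrite /moment; case: ifP => // mM; case: (leqP m (excess1 e j)) => mn.
    by case: nha; apply: adm_bmp.
  by rewrite qb_gt // !mul0r.
rewrite (mu_switch F k_gt0 ltD) // (@sum_strat' _ _ _ _ k_gt0 ltD _ _ _ D.+1) //.
set i := (j - k.+1)%N; set e' := raise e j m.
have le' l : (e l <= e' l)%N by rewrite /e' /raise; case: eqP => // ->; rewrite leq_addr.
have lt' : (e j < e' j)%N by rewrite /e' /raise eqxx; lia.
have [_ hw] := IH _ ha le' lt'.
have ej : (e' j = e j + m)%N by rewrite /e' /raise eqxx.
have en l : l != j -> e' l = e l by move=> /negbTE h; rewrite /e' /raise h.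
have si : step e' i = (e (j - k) - e i)%N.
  rewrite /step (_ : i.+1 = j - k)%N; last by rewrite /i; lia.
  by rewrite !en // /i; lia.
have sik : step e' (i + k) = (e j + m - e j.-1)%N.
  rewrite /step (_ : i + k = j.-1)%N; last by rewrite /i; lia.
  by rewrite prednK ?ej ?en //; lia.
have ej1 : (e j.-1 <= e j)%N by apply: (adm_mono he); lia.
rewrite -(facs_raise m0 he ha kj) //; last lia.
rewrite -/i -/e' -(@weight_sum e' i (e j + m - e j.-1) m D.+1) //.
- by apply: eq_bigr => t _; rewrite hw ?si // ?/i; [lia | rewrite -ltnS].
- rewrite /step ltnS (leq_trans (leq_subr _ _)) //; apply: (adm_le_D ha); rewrite /i; lia.
- by lia.
Qed.

Lemma inX_full e (v : point F B D) : adm e -> inX k e v ->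
  forall i, (i <= B)%N -> e i = rho k i -> (piece v i :=: low F D (rho k i))%MS.
Proof.
move=> he /(inXP k_gt0) [h1 _ _] i iB ei; have [_ r l] := h1 i iB.
apply/eqmxP; rewrite l /=; have [_ <-] := mxrank_leqif_sup l.
by rewrite r rank_low ?ei // ltnW // (rho_ltD k_gt0 ltD).
Qed.

Lemma low_mulY r s : (r = 0 \/ r < s)%N -> (low F D r *m shY F D <= low F D s)%MS.
Proof.
move=> rs; apply/row_subP => l; apply/lowP => j sj; rewrite row_mul mxE big1 // => a _.
rewrite !mxE; case: eqP => [la|_]; last by rewrite mul0r.
case: ltnP => lr; last by rewrite mul0r.
by case: eqP => [ja|]; rewrite ?mulr0 //; lia.
Qed.

Lemma full_point (e : nat -> nat) : adm e -> (forall i, e i = rho k i) -> mu (T := PT) (inX k e) = 1.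
Proof.
move=> he er.
pose v0 : point F B D := \matrix_(i < B.+1) mxvec (cform (low F D (rho k i))).
have p0 i : (i <= B)%N -> piece v0 i = cform (low F D (rho k i)).
  by move=> iB; rewrite /piece rowK mxvecK inordK.
apply: (mu_point (t0 := v0)); first exact: dpred_inX.
move=> v; split=> [vX|->].
  apply: piece_inj => i iB; rewrite p0 //.
  have /(inXP k_gt0) [/(_ i iB) [<- _ _] _ _] := vX; apply: cform_eq.
  by apply/eqmxP; apply: (inX_full he vX).
apply/(inXP k_gt0); split=> i iB.
- rewrite p0 // cform_id cform_eqmx rank_low; last by apply/ltnW/(rho_ltD k_gt0 ltD).
  by rewrite cform_eqmx submx_refl er.
- by rewrite !p0 ?cform_eqmx ?low_mono ?(rho_mono k_gt0) //; lia.
- rewrite !p0 //; last lia.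
  have s : (cform (low F D (rho k i)) <= low F D (rho k i))%MS by rewrite cform_eqmx.
  apply: submx_trans (submxMr _ s) _; rewrite cform_eqmx.
  apply: low_mulY; case: i iB {s} => [|i] iB; first by left; rewrite /rho div0n.
  by right; rewrite rhoDk.
Qed.

Lemma count_all e : adm e -> count_ok e.
Proof.
pose size_of e := (\sum_(i < B) (rho k i - e i))%N.
have [s hs] := ubnP (size_of e); elim: s e hs => // s IH e hs he.
have IH' e' : adm e' -> (forall i, e i <= e' i)%N -> forall j, (e j < e' j)%N -> count_ok e'.
  move=> he' le j lt; apply: IH => //; have [h1 _ _ h4] := he; have [g1 _ _ g4] := he'.
  have jB : (j < B)%N by rewrite ltnNge; apply/negP => Bj; move: lt; rewrite h4 ?g4 ?ltnn //; lia.
  suff : (size_of e' < size_of e)%N by lia.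
  rewrite /size_of (bigD1 (Ordinal jB)) //= [X in (_ < X)%N](bigD1 (Ordinal jB)) //=.
  rewrite -addSn leq_add //; first by have := g1 j; lia.
  by apply: leq_sum => i _; have := le i; lia.
have hm j m : (0 < m)%N -> (j + k + 1 <= B)%N ->
    \sum_(t < D.+1) mu (T := PT) (strat k e j t) * Q t m = moment e j m.
  by move=> m0 jB; apply: strat_moment => // e' he' le; apply: IH'.
have [h1 h2 h3 h4] := he.
have facs1E j : (j < B)%N -> fac e j = 1 -> facs1 e j = facs e.
  by move=> jB fj; rewrite (facsD1 e jB) fj mul1r.
have hX : mu (T := PT) (inX k e) = facs e.
  have [full|nfull] := pselect (forall i, e i = rho k i).
    rewrite full_point // /facs big1 // => i _.
    rewrite /fac (_ : excess e i = 0)%N ?addn0 ?qbnn // /excess !full.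
    by rewrite addn1 rhoDk //; lia.
  pose P i := (e i < rho k i)%N.
  have exP : exists i, P i.
    apply: contrapT => h; apply: nfull => i; apply/eqP; rewrite eqn_leq h1 /= leqNgt.
    by apply/negP => lt; apply: h; exists i.
  have ubP i : P i -> (i <= B)%N.
    by rewrite /P => lt; rewrite leqNgt; apply/negP => Bi; move: lt; rewrite h4 ?ltnn //; lia.
  have [j Pj jmax] := ex_maxnP exP ubP.
  have above i : (j < i)%N -> e i = rho k i.
    move=> ji; apply/eqP; rewrite eqn_leq h1 /= leqNgt; apply/negP => /jmax; lia.
  have jB : (j + k + 1 <= B)%N.
    by rewrite leqNgt; apply/negP => Bj; move: Pj; rewrite /P h4 ?ltnn //; lia.
  have j0 : (0 < j)%N by rewrite lt0n; apply/eqP => j0; move: Pj; rewrite /P j0 /rho div0n ltn0.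
  set m := (rho k j - e j)%N.
  have m0 : (0 < m)%N by rewrite subn_gt0.
  have es1 : e j.+1 = rho k j.+1 by apply: above.
  have esk : e (j + k)%N = (rho k j).+1 by rewrite above ?rhoDk //; lia.
  have rj1 : (rho k j <= rho k j.+1)%N by apply: (rho_mono k_gt0).
  have := hm j m m0 jB.
  have -> : moment e j m = facs e.
    have e0 : excess e j = 0%N.
      rewrite /excess es1 above; last lia.
      by rewrite addn1 rhoDk //; lia.
    rewrite /moment (_ : (m <= step e j)%N); last by rewrite /step es1 /m; lia.
    rewrite (_ : excess1 e j = m); last by rewrite /excess1 esk /m; lia.
    rewrite e0 addn0 !qbnn !mul1r facs1E //; first lia.
    by rewrite /fac e0 addn0 qbnn.
  move=> <-.
  have socE (v : point F B D) : inX k e v -> \rank (soc k j v) = rho k j.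
    move=> vX; have sl := soc_low k_gt0 ltD jB vX.
    have rl : (rho k j <= D)%N by apply/ltnW/(rho_ltD k_gt0 ltD); lia.
    apply/eqP; rewrite eqn_leq -{1}(rank_low F rl) (mxrankS sl) /=.
    rewrite -{1}(rank_low F rl) mxrankS // sub_soc.
    have -> : (low F D (rho k j) <= piece v j.+1)%MS.
      by rewrite (inX_full he vX _ es1) ?low_mono //; lia.
    rewrite (inX_full he vX (i := j + k)) //=; try lia.
      by apply: low_mulY; right; rewrite rhoDk.
    by rewrite esk rhoDk.
  have mD : (m < D.+1)%N.
    by have := rho_ltD k_gt0 ltD (i := j); rewrite /m; lia.
  rewrite (bigD1 (Ordinal mD)) //= qbnn mulr1 big1 ?addr0 => [|t tm].
    apply: mu_ext => v; rewrite /strat; case vX: (inX k e v) => //=.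
    by rewrite socE // /m subnKC // eqxx.
  rewrite mu_false ?mul0r // => v; apply/negP => /andP [vX /eqP].
  rewrite socE // => re; case/eqP: tm; apply: val_inj => /=; rewrite /m re; lia.
split=> // j jB t tD; apply/eqP; rewrite -subr_eq0; apply/eqP.
apply: (@qb_moment_inj _ LL D.+1 (fun t => mu (T := PT) (strat k e j t) - weight e j t)) => // m.
under eq_bigr do rewrite mulrBl.
have sD : (step e j < D.+1)%N.
  by have := adm_le_D he (j := j.+1); rewrite /step; lia.
rewrite sumrB weight_moment //; case: m => [|m]; last by rewrite hm ?subrr.
rewrite /moment leq0n !qbn0 mul1r subn0 -/(fac e j) -facsD1; last lia.
rewrite -hX; apply/eqP; rewrite subr_eq0; apply/eqP.
under eq_bigr do rewrite qbn0 mulr1.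
have hsoc := @dmx_soc F k B D j.
rewrite (@mu_partition _ _ _ (fun v => (\rank (soc k j v) - e j)%N) D.+1); first last.
- by move=> v _ /=; have := rank_leq_col (soc k j v); lia.
- move=> i; have := dnat_rank hsoc (i + e j)%N.
  by congr dpred; apply/funext => x; rewrite ltn_subRL addnC.
- exact: dpred_inX.
apply: eq_bigr => i _; apply: mu_ext => v; rewrite /strat; case vX: (inX k e v) => //=.
have := mxrankS (sub_piece_soc k_gt0 ltD jB vX); have /(inXP k_gt0) [hr _ _] := vX.
have [|_ rj _] := hr j; first lia.
by rewrite rj => le; apply/eqP/eqP; lia.
Qed.

End Count.

(** * Presentations of ideals of finite colength *)

Section Presentations.
Variables (F : closedFieldType) (n : nat).
Implicit Types (A : 'X_{1..2} -> 'rV[F]_n) (s : 'I_n -> 'X_{1..2}).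

Definition ev A (f : {mpoly F[2]}) : 'rV[F]_n := \sum_(m <- msupp f) f@_m *: A m.

Lemma ev_wide A f N : (msize f <= N)%N ->
  ev A f = \sum_(m : 'X_{1..2 < N}) f@_m *: A m.
Proof.
move=> fN; pose I : subFinType _ := 'X_{1..2 < N}.
rewrite /ev (big_mksub I) //=; first last.
  by move=> x /msize_mdeg_lt /leq_trans; apply.
  by rewrite msupp_uniq.
by rewrite big_rmcond //= => i; move/memN_msupp_eq0 ->; rewrite scale0r.
Qed.

Lemma ev_is_linear A : linear (ev A).
Proof.
move=> c f g; pose N := maxn (msize (c *: f + g)) (maxn (msize f) (msize g)).
have h1 : (msize (c *: f + g) <= N)%N by rewrite leq_maxl.
have h2 : (msize f <= N)%N by rewrite /N !leq_max leqnn orbT.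
have h3 : (msize g <= N)%N by rewrite /N !leq_max leqnn !orbT.
rewrite (ev_wide A h1) (ev_wide A h2) (ev_wide A h3) scaler_sumr -big_split.
by apply: eq_bigr => m _; rewrite mcoeffD mcoeffZ scalerDl scalerA.
Qed.

HB.instance Definition _ A := GRing.isLinear.Build F {mpoly F[2]} 'rV[F]_n _ (ev A) (ev_is_linear A).

Lemma evX A m : ev A 'X_[m] = A m.
Proof. by rewrite /ev msuppX big_seq1 mcoeffX eqxx scale1r. Qed.

Definition idl A : set {mpoly F[2]} := [set f | ev A f = 0].

Record pres (k : nat) (H : nat -> nat) A s : Prop := Pres {
  pres_basis : forall l, A (s l) = delta_mx 0 l;
  pres_graded : forall m l, A m 0 l != 0 -> wdeg k m = wdeg k (s l);
  pres_mul : forall i m, A (U_(i) + m)%MM = \sum_l A m 0 l *: A (U_(i) + s l)%MM;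
  pres_card : forall d, #|[pred l | wdeg k (s l) == d]| = H d }.

Section Fixed.
Variables (k : nat) (H : nat -> nat) (A : 'X_{1..2} -> 'rV[F]_n) (s : 'I_n -> 'X_{1..2}).
Hypothesis k_gt0 : (0 < k)%N.
Hypothesis hA : pres k H A s.

Lemma mnm_split (m : 'X_{1..2}) : m != 0%MM -> exists i m', m = (U_(i) + m')%MM.
Proof.
move=> m0; have [i mi] : exists i, m i != 0%N.
  apply: contrapT => h; case/eqP: m0; apply/mnmP => i; rewrite mnmE; apply/eqP.
  by apply/negPn/negP => mi; apply: h; exists i.
exists i, (m - U_(i))%MM; rewrite addmC submK //; apply/mnm_lepP => j; rewrite mnm1E.
by case: eqP => //= <-; rewrite lt0n.
Qed.

Lemma mnm_ind2 (P : 'X_{1..2} -> Prop) : P 0%MM ->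
  (forall i m, P m -> P (U_(i) + m)%MM) -> forall m, P m.
Proof.
move=> P0 PS m; have [N] := ubnP (mdeg m); elim: N m => // N IH m.
have [->|/mnm_split [i [m' ->]]] := eqVneq m 0%MM; first by [].
by rewrite mdegD mdeg1 add1n ltnS => /IH; apply: PS.
Qed.

Lemma ev_mulX i f : ev A ('X_i * f) = \sum_l ev A f 0 l *: A (U_(i) + s l)%MM.
Proof.
rewrite {1}[f]mpolyE mulr_sumr linear_sum /=.
under [RHS]eq_bigr do rewrite /ev summxE scaler_suml.
rewrite exchange_big /=; apply: eq_bigr => m _.
rewrite -scalerAr linearZ /= -mpolyXD evX (pres_mul hA) scaler_sumr.
by apply: eq_bigr => l _; rewrite mxE scalerA.
Qed.

Lemma idl_ideal : is_ideal (idl A).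
Proof.
split=> [|f g f0 g0|f g g0].
- exact: linear0.
- by rewrite /idl /= linearD /= f0 g0 addr0.
- rewrite /idl /= [f]mpolyE mulr_suml linear_sum big1 //= => m _.
  rewrite -scalerAl linearZ /= (_ : ev A ('X_[m] * g) = 0) ?scaler0 //.
  elim/mnm_ind2: m => [|i m IH]; first by rewrite mpolyX0 mul1r.
  rewrite mpolyXD -mulrA ev_mulX; apply: big1 => l _.
  by rewrite IH mxE scale0r.
Qed.

Lemma ev_comb (c : 'rV[F]_n) : ev A (\sum_j c 0 j *: 'X_[s j]) = c.
Proof.
rewrite linear_sum [RHS](matrix_sum_delta c) big_ord1; apply: eq_bigr => j _.
by rewrite linearZ /= evX (pres_basis hA).
Qed.

Lemma idl_quot : quot_basis setT (idl A) (fun l => 'X_[s l]).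
Proof.
split=> // f _; exists (ev A f); split=> [|c]; rewrite /idl /= linearB /= ev_comb ?subrr //.
by move=> /eqP; rewrite subr_eq0 => /eqP.
Qed.

Lemma ev_pihomog d f l :
  ev A (pihomog (wdeg k) d f) 0 l = if wdeg k (s l) == d then ev A f 0 l else 0.
Proof.
rewrite pihomogE linear_sum summxE /ev summxE big_mkcond /=.
rewrite (_ : (if _ then _ else _) =
  \sum_(m <- msupp f) (if wdeg k (s l) == d then (f@_m *: A m) 0 l else 0)); last first.
  by case: eqP => // _; rewrite big1_eq.
apply: eq_bigr => m _; rewrite -/(ev A _) linearZ /= evX !mxE.
have [Am|/(pres_graded hA) ->] := eqVneq (A m 0 l) 0; last by case: eqP.
by rewrite Am mulr0; case: ifP; case: ifP.
Qed.

Lemma idl_qh : quasi_homogeneous k (idl A).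
Proof.
move=> f f0 d; apply/rowP => l; rewrite ev_pihomog f0 !mxE; by case: eqP.
Qed.

Lemma idl_quotH d : quot_dim (qhomog_part k d) (idl A) (H d).
Proof.
rewrite -(pres_card hA d); pose S := [pred l | wdeg k (s l) == d]; rewrite -/S.
exists (fun j : 'I_#|S| => 'X_[s (enum_val j)]); split.
  by move=> j; have := enum_valP j; rewrite inE /qhomog_part /= dhomogX.
move=> f fd.
have f0 l : l \notin S -> ev A f 0 l = 0.
  by rewrite inE => /negPf ld; rewrite -(pihomog_dE fd) ev_pihomog ld.
have ec (c : 'rV[F]_#|S|) l : ev A (\sum_j c 0 j *: 'X_[s (enum_val j)]) 0 l =
    \sum_j c 0 j * (l == enum_val j)%:R.
  rewrite linear_sum summxE; apply: eq_bigr => j _.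
  by rewrite linearZ /= evX (pres_basis hA) !mxE eqxx eq_sym.
have ec1 (c : 'rV[F]_#|S|) j : ev A (\sum_j c 0 j *: 'X_[s (enum_val j)]) 0 (enum_val j) = c 0 j.
  rewrite ec (bigD1 j) //= eqxx mulr1 big1 ?addr0 // => j' jj.
  by rewrite (inj_eq enum_val_inj) eq_sym (negPf jj) mulr0.
exists (\row_j ev A f 0 (enum_val j)); split.
  rewrite /idl /= linearB /=; apply/rowP => l; rewrite mxE [in X in _ + X]mxE mxE.
  case lS: (l \in S).
    by rewrite -(enum_rankK_in lS lS) ec1 mxE subrr.
  rewrite f0 ?lS // ec big1 ?subrr // => j _; case: eqP => [e|]; last by rewrite mulr0.
  by move: lS; rewrite e enum_valP.
move=> c; rewrite /idl /= linearB /= => /rowP h; apply/rowP => j.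
by have := h (enum_val j); rewrite mxE [in X in _ + X]mxE ec1 !mxE => /eqP; rewrite subr_eq0 => /eqP.
Qed.

Lemma ev_torus t f l :
  ev A (torus_subst t (t ^+ k) f) 0 l = t ^+ wdeg k (s l) * ev A f 0 l.
Proof.
rewrite /torus_subst comp_mpolyE linear_sum summxE /ev summxE mulr_sumr.
apply: eq_bigr => m _; rewrite -/(ev A _).
have -> : \prod_(i < 2) tnth [tuple t *: 'X_0; t ^+ k *: 'X_1] i ^+ m i = t ^+ wdeg k m *: 'X_[m].
  rewrite big_ord_recl big_ord1 /= !(tnth_nth 0) /=.
  rewrite !exprZn -scalerAl -scalerAr scalerA -exprM -exprD.
  have -> : 'X_[m] = 'X_0 ^+ m 0 * 'X_1 ^+ m 1 :> {mpoly F[2]}.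
    rewrite !mpolyXn -mpolyXD; congr 'X_[_]; apply/mnmP => i.
    rewrite mnmDE !mulmnE !mnm1E.
    by case: i => [[|[|]] // hi]; rewrite /= ?mul1n ?mul0n ?addn0 ?add0n; congr (m _); apply: val_inj.
  rewrite /wdeg; congr (_ ^+ (m _ + k * m _) *: ('X_0 ^+ m _ * 'X_1 ^+ m _)); exact: val_inj.
rewrite !linearZ /= evX !mxE.
have [Am|/(pres_graded hA) ->] := eqVneq (A m 0 l) 0; first by rewrite Am !mulr0.
by rewrite mulrCA mulrA.
Qed.

Lemma pres_hilb : hilb_fixH k n H (idl A).
Proof.
split; [split; first split|exact: idl_qh|exact: idl_quotH].
- exact: idl_ideal.
- by exists (fun l => 'X_[s l]); apply: idl_quot.
- move=> t t0; apply/seteqP; split=> f; rewrite /idl /= => /rowP h; apply/rowP => l.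
    have := h l; rewrite ev_torus !mxE => /eqP; rewrite mulf_eq0 expf_eq0 (negPf t0) andbF.
    by move=> /eqP.
  by rewrite ev_torus h !mxE mulr0.
Qed.

(* The weights of the divisors of m along a chain are distinct. *)
Lemma pres_mdeg m : A m != 0 -> (mdeg m < n)%N.
Proof.
move=> Am; suff : (mdeg m < #|[pred l | (wdeg k (s l) <= wdeg k m)%N]|)%N.
  by move=> /leq_trans; apply; rewrite -[leqRHS]card_ord max_card.
have exl m' : A m' != 0 -> exists l, wdeg k (s l) = wdeg k m'.
  by move=> /rV0Pn [l /(pres_graded hA) ->]; exists l.
elim/mnm_ind2: m Am => [|i m IH] Am.
  have [l el] := exl _ Am; rewrite mdeg0; apply/card_gt0P; exists l.
  by rewrite inE el.
have Am' : A m != 0.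
  apply: contraNneq Am => Am0; rewrite (pres_mul hA) big1 // => l _.
  by rewrite Am0 mxE scale0r.
have [l el] := exl _ Am; rewrite mdegD mdeg1 add1n.
have lt : (wdeg k m < wdeg k (U_(i) + m))%N.
  rewrite wdegD -[ltnLHS]add0n ltn_add2r /wdeg !mnm1E.
  by case: i {Am l el} => [[|[|]]] //= _; rewrite muln1 ?add0n.
apply: leq_ltn_trans (IH Am') _; apply: proper_card; apply/properP; split.
  by apply/fintype.subsetP => l'; rewrite !inE => h; apply: leq_trans h (ltnW lt).
by exists l; rewrite !inE el // -ltnNge.
Qed.

End Fixed.

End Presentations.

Lemma mulmx_rowE (R : pzRingType) m n p (A : 'M[R]_(m, n)) (B : 'M[R]_(n, p)) i j :
  (A *m B) i j = (row i A *m B) 0 j.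
Proof. by rewrite -row_mul [RHS]mxE. Qed.

(** * Equations of the Plucker image *)

Section PluckerEquations.
Variables (F : closedFieldType) (n k : nat) (H : nat -> nat).
Hypothesis k_gt0 : (0 < k)%N.
Local Notation PI := (plucker_index n).
Local Notation N := #|PI|.
Implicit Types (A : 'X_{1..2} -> 'rV[F]_n) (z : 'rV[F]_N) (s t : PI).

Definition Pl A : 'rV[F]_N := \row_t \det (\matrix_(i < n) A ((enum_val t : PI) i)).
Definition Zc z t : F := z 0 (enum_rank t).

Lemma ZcPl c A t : Zc (c *: Pl A) t = c * \det (\matrix_(i < n) A (t i)).
Proof. by rewrite /Zc !mxE enum_rankK. Qed.

Lemma plucker_pres A (s : 'I_n -> 'X_{1..2}) z : pres k H A s ->
  plucker (idl A) z <-> exists2 c, c != 0 & z = c *: Pl A.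
Proof.
move=> hA; split=> [[b [A' [c [hb hA' c0 ->]]]]|[c c0 ->]]; last first.
  exists (fun l => 'X_[s l]), (fun m => A m), c; split=> //.
  - exact: idl_quot hA.
  - by move=> m; rewrite /idl /= linearB /= (ev_comb hA) evX subrr.
  - by apply/rowP => t; rewrite !mxE.
pose E : 'M[F]_n := \matrix_j ev A (b j).
have evb (u : 'rV[F]_n) : ev A (\sum_j u 0 j *: b j) = u *m E.
  rewrite (linear_sum (ev A)) mulmx_sum_row; apply: eq_bigr => j _.
  by rewrite linearZ /= rowK.
have uE : E \in unitmx.
  rewrite -row_free_unit; apply: inj_row_free => u uE0.
  have [_ /(_ 0 I) [c0' [_ uniq]]] := hb.
  have key (w : 'rV_n) : w *m E = 0 -> idl A (0 - \sum_j w 0 j *: b j).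
    by move=> w0; rewrite /idl /= linearB /= linear0 evb w0 subr0.
  by rewrite -(uniq _ (key _ uE0)); apply: uniq; apply: key; rewrite mul0mx.
have AE (m : 'X_{1..2 < n.+1}) : A m = A' m *m E.
  have := hA' m; rewrite /idl /= linearB /= evX evb => /eqP.
  by rewrite subr_eq0 => /eqP.
have dE : \det E != 0 by rewrite unitmxE unitfE in uE.
exists (c / \det E); first by rewrite mulf_neq0 ?invr_eq0.
apply/rowP => t; rewrite !mxE -mulrA; congr (_ * _).
have -> : \matrix_(i < n) A ((enum_val t : PI) i) = (\matrix_(i < n) A' ((enum_val t : PI) i)) *m E.
  by apply/row_matrixP => i; rewrite row_mul !rowK AE.
by rewrite det_mulmx mulrCA mulVf // mulr1.
Qed.

Definition rep s (l : 'I_n) (m : 'X_{1..2 < n.+1}) : PI :=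
  [ffun i => if i == l then m else s i].

Lemma det_rep (S : 'M[F]_n) (v : 'rV[F]_n) l :
  \det (\matrix_i (if i == l then v else row i S)) = (v *m \adj S) 0 l.
Proof.
rewrite (expand_det_row _ l) mxE; apply: eq_bigr => j _; rewrite !mxE eqxx; congr (_ * _).
rewrite /cofactor; congr (_ * \det _); apply/matrixP => a b; rewrite !mxE.
by rewrite eq_sym (negPf (neq_lift _ _)) !mxE.
Qed.

Lemma Zc_rep c A s l (m : 'X_{1..2 < n.+1}) :
  Zc (c *: Pl A) (rep s l m) = c * (A m *m \adj (\matrix_i A (s i))) 0 l.
Proof.
rewrite ZcPl -det_rep; congr (_ * \det _); apply/row_matrixP => i; rewrite !rowK ffunE.
by case: eqP.
Qed.

Definition bnd (m0 : 'X_{1..2 < n.+1}) (m : 'X_{1..2}) : 'X_{1..2 < n.+1} := insubd m0 m.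

Lemma bndE m0 m : (mdeg m <= n)%N -> bnd m0 m = m :> 'X_{1..2}.
Proof. by move=> h; rewrite val_insubd ltnS h. Qed.

Definition xv t : {mpoly F[N]} := 'X_(enum_rank t).

Definition good t := (forall p, (mdeg (t p) < n)%N) /\
  forall d, #|[pred p | wdeg k (t p) == d]| = H d.

(* If z_s != 0, the monomials s form a basis of the quotient, and the l-th
   coordinate of m in this basis is z_(s[l := m]) / z_s. [eq_det] recovers z from
   these coordinates, and [eq_mul] says that x_i (m + I) is computed on the basis. *)
Definition eq_det t s : {mpoly F[N]} :=
  xv t * xv s ^+ n - xv s * \det (\matrix_(p, l) xv (rep s l (t p))).
Definition eq_mul s p (m : 'X_{1..2 < n.+1}) i : {mpoly F[N]} :=
  xv (rep s p (bnd m (U_(i) + m)%MM)) * xv s -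
  \sum_l xv (rep s l m) * xv (rep s p (bnd m (U_(i) + s l)%MM)).

Definition pl_eqs : set {mpoly F[N]} := [set q |
  [\/ exists t s, q = eq_det t s, exists2 t, ~ good t & q = xv t |
      exists s p (m : 'X_{1..2 < n.+1}) i, [/\ good s, (mdeg m < n)%N & q = eq_mul s p m i]]].

Lemma xv_homog t : xv t \is 1.-homog.
Proof. exact: homogX. Qed.

Lemma pl_eqs_homog q : pl_eqs q -> q \is homog mdeg.
Proof.
case=> [[t [s ->]]|[t _ ->]|[s [p [m [i [_ _ ->]]]]]]; apply/homogP.
- exists (1 + n)%N; apply: rpredB.
    by apply: dhomogM; [apply: xv_homog | have := dhomogMn n (xv_homog s); rewrite mul1n].
  apply: dhomogM; first exact: xv_homog.
  apply: rpred_sum => sg _.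
  suff h : \prod_(i < n) (\matrix_(p, l) xv (rep s l (t p))) i (sg i) \is n.-homog.
    by case: (odd_perm sg); rewrite ?expr0 ?expr1 ?mul1r ?mulN1r ?rpredN.
  suff : \prod_(i < n) (\matrix_(p, l) xv (rep s l (t p))) i (sg i) \is (\sum_(i < n) 1)%N.-homog.
    by rewrite sum1_card card_ord.
  elim/big_rec2: _ => [|i q' e _ h]; first exact: dhomog1.
  by apply: dhomogM => //; rewrite mxE; apply: xv_homog.
- by exists 1%N; apply: xv_homog.
- exists (1 + 1)%N; apply: rpredB; first by apply: dhomogM; apply: xv_homog.
  by apply: rpred_sum => l _; apply: dhomogM; apply: xv_homog.
Qed.

Lemma meval_xv z t : (xv t).@[z 0] = Zc z t.
Proof. exact: mevalXU. Qed.

Lemma meval_det z t s : (eq_det t s).@[z 0] =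
  Zc z t * Zc z s ^+ n - Zc z s * \det (\matrix_(p, l) Zc z (rep s l (t p))).
Proof.
rewrite mevalB !mevalM rmorphXn /= !meval_xv; congr (_ - _ * _).
rewrite -det_map_mx; congr (\det _); apply/matrixP => p l; rewrite !mxE.
exact: meval_xv.
Qed.

Lemma meval_mul z s p m i : (eq_mul s p m i).@[z 0] =
  Zc z (rep s p (bnd m (U_(i) + m)%MM)) * Zc z s -
  \sum_l Zc z (rep s l m) * Zc z (rep s p (bnd m (U_(i) + s l)%MM)).
Proof.
rewrite mevalB mevalM !meval_xv (raddf_sum (meval (z 0))); congr (_ - _); apply: eq_bigr => l _ /=.
by rewrite mevalM !meval_xv.
Qed.

Lemma pres_good A (s0 : 'I_n -> 'X_{1..2}) t : pres k H A s0 ->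
  \det (\matrix_(i < n) A (t i)) != 0 -> good t.
Proof.
move=> hA dt; split=> [p|d].
  apply: (pres_mdeg k_gt0 hA); apply: contraNneq dt => Ap.
  by rewrite (expand_det_row _ p) big1 // => j _; rewrite mxE Ap mxE mul0r.
have [sg hsg] : exists sg : 'S_n, forall i, A (t i) 0 (sg i) != 0.
  apply: contrapT => h; case/eqP: dt; rewrite /determinant big1 // => sg _.
  have [i hi] : exists i, A (t i) 0 (sg i) = 0.
    apply: contrapT => h'; apply: h; exists sg => i; apply/eqP => e; apply: h'.
    by exists i.
  by rewrite (bigD1 i) //= mxE hi mul0r mulr0.
rewrite -(pres_card hA d) -(fintype.card_image (@perm_inj _ sg)); apply: eq_card => l.
apply/fintype.imageP/idP => [[p]|]; rewrite !inE.
  by move=> /eqP <- ->; rewrite (pres_graded hA (hsg p)).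
move=> /eqP <-; exists (sg^-1%g l); last by rewrite permKV.
by rewrite inE (pres_graded hA (hsg _)) permKV.
Qed.

Lemma pres_eqs A (s0 : 'I_n -> 'X_{1..2}) c : pres k H A s0 -> c != 0 ->
  closed_cone pl_eqs (c *: Pl A).
Proof.
move=> hA c0; split=> [|q].
  have sn l : (mdeg (s0 l) <= n)%N.
    apply/ltnW/(pres_mdeg k_gt0 hA); rewrite (pres_basis hA).
    by apply/rV0Pn; exists l; rewrite mxE !eqxx oner_eq0.
  pose t0 : PI := [ffun l => bnd bm0 (s0 l)].
  apply: (@coord_nz _ _ _ (enum_rank t0)); rewrite -/(Zc _ t0) ZcPl mulf_neq0 //.
  rewrite (_ : (\matrix_i A (t0 i)) = 1%:M) ?det1 ?oner_eq0 //.
  apply/row_matrixP => i; rewrite rowK row1 ffunE bndE ?sn //.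
  exact: pres_basis hA _.
pose M t := \matrix_(i < n) A (t i).
case=> [[t [s ->]]|[t nt ->]|[s [p [m [i [gs mn ->]]]]]].
- rewrite meval_det !ZcPl -/(M t) -/(M s).
  have -> : \matrix_(p, l) Zc (c *: Pl A) (rep s l (t p)) = c *: (M t *m \adj (M s)).
    apply/matrixP => p l; rewrite [LHS]mxE Zc_rep [RHS]mxE; congr (_ * _).
    by rewrite [RHS]mulmx_rowE /M rowK.
  rewrite detZ det_mulmx.
  have e : \det (M s) * \det (\adj (M s)) = \det (M s) ^+ n.
    by rewrite -det_mulmx mul_mx_adj det_scalar.
  rewrite exprMn -e; ring.
- rewrite meval_xv ZcPl; have [->|dt] := eqVneq (\det (\matrix_i A (t i))) 0; first by rewrite mulr0.
  by case: nt; exact: (pres_good hA dt).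
- pose X : 'M[F]_n := \matrix_l A (U_(i) + s0 l)%MM.
  have AX (m' : 'X_{1..2}) : A (U_(i) + m')%MM = A m' *m X.
    by rewrite (pres_mul hA) mulmx_sum_row; apply: eq_bigr => l _; rewrite rowK.
  have bd (m' : 'X_{1..2}) : (mdeg m' < n)%N -> bnd m (U_(i) + m')%MM = (U_(i) + m')%MM :> 'X_{1..2}.
    by move=> h; rewrite bndE // mdegD mdeg1.
  rewrite meval_mul Zc_rep bd // AX ZcPl -/(M s).
  under eq_bigr => l _ do rewrite !Zc_rep bd ?gs.1 // AX -/(M s).
  apply/eqP; rewrite subr_eq0; apply/eqP.
  transitivity (c * c * (A m *m \adj (M s) *m (M s *m X *m \adj (M s))) 0 p).
    rewrite !mulmxA -[_ *m _ *m M s]mulmxA mul_adj_mx -!mulmxA mul_scalar_mx -scalemxAr.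
    rewrite [in RHS]mxE; ring.
  rewrite mxE mulr_sumr; apply: eq_bigr => l _.
  have -> : (M s *m X *m \adj (M s)) l p = (A (s l) *m X *m \adj (M s)) 0 p.
    by rewrite -[in LHS]mulmxA [LHS]mulmx_rowE /M rowK mulmxA.
  by ring.
Qed.

Definition pres_chart z s (m : 'X_{1..2}) : 'rV[F]_n :=
  if (mdeg m <= n)%N then \row_l (Zc z (rep s l (bnd bm0 m)) / Zc z s) else 0.

Section EquationsToPres.
Variables (z : 'rV[F]_N) (s : PI).
Hypotheses (hz : closed_cone pl_eqs z) (zs : Zc z s != 0).

Lemma Zc_good t : Zc z t != 0 -> good t.
Proof.
move=> zt; apply: contrapT => nt; have /hz.2 : pl_eqs (xv t) by constructor 2; exists t.
by rewrite meval_xv => e; rewrite e eqxx in zt.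
Qed.

Lemma pres_chart_small (m : 'X_{1..2 < n.+1}) : pres_chart z s m = \row_l (Zc z (rep s l m) / Zc z s).
Proof.
have mn : (mdeg m <= n)%N by rewrite -ltnS bmdeg.
rewrite /pres_chart mn; apply/rowP => l; rewrite !mxE; congr (Zc z (rep s l _) / _).
by apply: val_inj; exact: bndE.
Qed.

Lemma pres_chart_big (m : 'X_{1..2}) : (n <= mdeg m)%N -> pres_chart z s m = 0.
Proof.
move=> mn; rewrite /pres_chart; case: ifP => // mn'; apply/rowP => l; rewrite !mxE.
apply/eqP; rewrite mulf_eq0; apply/orP; left; apply: contraT => /Zc_good [/(_ l)].
by rewrite ffunE eqxx bndE // ltnNge mn.
Qed.

Lemma Zc_det t : Zc z t = Zc z s * \det (\matrix_p pres_chart z s (t p)).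
Proof.
have /hz.2 : pl_eqs (eq_det t s) by constructor 1; exists t, s.
rewrite meval_det => /eqP; rewrite subr_eq0 => /eqP e.
have -> : \matrix_p pres_chart z s (t p) =
    (Zc z s)^-1 *: \matrix_(p, l) Zc z (rep s l (t p)).
  by apply/matrixP => p l; rewrite mxE pres_chart_small !mxE mulrC.
by rewrite detZ mulrCA -e mulrC exprVn mulfK // expf_neq0.
Qed.

Lemma pres_chart_basis l : pres_chart z s (s l) = delta_mx 0 l.
Proof.
rewrite pres_chart_small; apply/rowP => j; rewrite !mxE eqxx /=.
have [->|jl] := eqVneq j l.
  rewrite (_ : rep s l (s l) = s) ?divff //.
  by apply/ffunP => i; rewrite ffunE; case: eqP => // ->.
rewrite Zc_det (determinant_alternate jl) ?mulr0 ?mul0r // => i; rewrite !mxE.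
by rewrite !ffunE eqxx eq_sym (negPf jl).
Qed.

Lemma eqs_pres : pres k H (pres_chart z s) (fun l => s l).
Proof.
have gs := Zc_good zs; split=> [l|m l|i m|d]; [exact: pres_chart_basis| | |exact: gs.2].
- rewrite /pres_chart; case: ifP => [mn|_]; last by rewrite mxE eqxx.
  rewrite mxE mulf_eq0 negb_or => /andP [/Zc_good [_ c] _].
  apply: contraTeq isT => /= mw; have := c (wdeg k (s l)); rewrite -(gs.2 (wdeg k (s l))).
  move=> /eqP; rewrite eqn_leq andbC; suff : (#|[pred p | wdeg k (rep s l (bnd bm0 m) p) == wdeg k (s l)]| <
    #|[pred p | wdeg k (s p) == wdeg k (s l)]|)%N by rewrite ltnNge => /negPf ->.
  apply: proper_card; apply/properP; split.
    apply/fintype.subsetP => p; by rewrite !inE ffunE; have [->|] := eqVneq p l.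
  by exists l; rewrite !inE ?eqxx // ffunE eqxx bndE.
- have [mn|mn] := leqP n (mdeg m).
    rewrite !pres_chart_big // ?mdegD ?mdeg1 ?(leq_trans mn) ?leq_addl // big1 // => l _.
    by rewrite mxE scale0r.
  pose m' := bnd bm0 m; have mE : m = m' :> 'X_{1..2} by rewrite bndE // ltnW.
  have AE (m1 : 'X_{1..2}) p : (mdeg m1 < n)%N ->
      pres_chart z s (U_(i) + m1)%MM 0 p = Zc z (rep s p (bnd m' (U_(i) + m1)%MM)) / Zc z s.
    move=> h; have {1}<- : bnd m' (U_(i) + m1)%MM = (U_(i) + m1)%MM :> 'X_{1..2}.
      by rewrite bndE // mdegD mdeg1.
    by rewrite pres_chart_small mxE.
  apply/rowP => p; rewrite summxE AE //.
  have /hz.2 : pl_eqs (eq_mul s p m' i) by constructor 3; exists s, p, m', i; rewrite -mE.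
  rewrite meval_mul => /eqP; rewrite subr_eq0 -mE => /eqP e.
  apply: (mulIf (mulf_neq0 zs zs)); rewrite mulrA divfK // e mulr_suml.
  apply: eq_bigr => l _; rewrite mxE AE ?(gs.1 l) // mE pres_chart_small mxE.
  by field.
Qed.

Lemma eqs_Pl : z = Zc z s *: Pl (pres_chart z s).
Proof.
apply/rowP => j; rewrite !mxE -Zc_det /Zc enum_valK //.
Qed.

End EquationsToPres.

Lemma ev_mulmx A (Q : 'M[F]_n) f : ev (fun m => A m *m Q) f = ev A f *m Q.
Proof. by rewrite /ev mulmx_suml; apply: eq_bigr => m _; rewrite scalemxAl. Qed.

Lemma idl_mulmx A (Q : 'M[F]_n) : Q \in unitmx -> idl (fun m => A m *m Q) = idl A.
Proof.
move=> uQ; apply/seteqP; split=> f; rewrite /idl /= ev_mulmx; last by move->; exact: mul0mx.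
by move=> e; rewrite -(mulmxK uQ (ev A f)) e mul0mx.
Qed.

Lemma pres_chart_Pl A (s0 : 'I_n -> 'X_{1..2}) c s : pres k H A s0 -> c != 0 ->
  Zc (c *: Pl A) s != 0 -> idl (pres_chart (c *: Pl A) s) = idl A.
Proof.
move=> hA c0 zs; set z := c *: Pl A.
pose S := \matrix_i A (s i).
have dS : \det S != 0.
  by move: zs; rewrite ZcPl -/S mulf_eq0 negb_or => /andP [].
rewrite -(@idl_mulmx A (invmx S)); last by rewrite unitmx_inv unitmxE unitfE.
congr idl; apply/funext => m; rewrite /pres_chart; case: ifP => [mn|mn].
  apply/rowP => l; rewrite mxE Zc_rep ZcPl -/S bndE // /invmx unitmxE unitfE dS.
  by rewrite -scalemxAr [RHS]mxE -mulf_div divff // mul1r mulrC.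
have [->|Am] := eqVneq (A m) 0; first by rewrite mul0mx.
by have := pres_mdeg k_gt0 hA Am => /ltnW; rewrite mn.
Qed.

End PluckerEquations.

(** * Ideals and their graded parts *)

Section ModelIdeal.
Variables (F : closedFieldType) (k B D n : nat) (H : nat -> nat).
Hypothesis k_gt0 : (0 < k)%N.
Hypothesis ltD : (rho k B < D)%N.
Hypothesis ltkB : (k < B)%N.
Implicit Types (v : point F B D) (I : set {mpoly F[2]}) (A : 'X_{1..2} -> 'rV[F]_n).

Definition mono (d b : nat) : 'X_{1..2} := [multinom (if i == 0%R then d - k * b else b)%N | i < 2].

Lemma mono0 d b : mono d b 0%R = (d - k * b)%N.
Proof. by rewrite mnmE eqxx. Qed.

Lemma mono1 d b : mono d b 1%R = b.
Proof. by rewrite mnmE. Qed.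

Lemma rho_shift d : rho k (d + k.+1) = (d %/ k).+1.
Proof. by rewrite -addSnnS rhoDk. Qed.

Lemma lt_rho d b : (b < rho k (d + k.+1))%N = (k * b <= d)%N.
Proof. by rewrite rho_shift ltnS leq_divRL // mulnC. Qed.

Lemma wdeg_mono d b : (k * b <= d)%N -> wdeg k (mono d b) = d.
Proof. by move=> h; rewrite /wdeg mono0 mono1 subnK. Qed.

Lemma monoE m : m = mono (wdeg k m) (m 1%R).
Proof.
apply/mnmP => i; rewrite mnmE /wdeg addnK; case: eqP => [->|] //.
by case: i => [[|[|]]] // p; move=> h; [case: h; apply: val_inj | congr (m _); apply: val_inj].
Qed.

Lemma monoX d b : (k * b <= d)%N -> (U_(0%R) + mono d b)%MM = mono d.+1 b.
Proof.
move=> h; apply/mnmP => i; rewrite mnmDE !mnmE eq_sym.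
by case: eqP => //= _; rewrite subSn.
Qed.

Lemma monoY d b : (U_(1%R) + mono d b)%MM = mono (d + k) b.+1.
Proof.
apply/mnmP => i; rewrite mnmDE !mnmE mulnS [(k + _)%N]addnC subnDr eq_sym.
by case: i => [[|[|]]].
Qed.

Definition erow (b : nat) : 'rV[F]_D := \row_(c < D) (c == b :> nat)%:R.

Lemma erow_shY b : erow b *m shY F D = erow b.+1.
Proof.
apply/rowP => c; rewrite !mxE; have [cb|cb] := eqVneq (c : nat) b.+1.
  have bD : (b < D)%N by apply: ltnW; rewrite -cb.
  rewrite (bigD1 (Ordinal bD)) //= big1 => [|j jb]; rewrite !mxE /=.
    by rewrite cb !eqxx mulr1 addr0.
  by rewrite (_ : (j == b :> nat) = false) ?mul0r //; apply/negbTE.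
rewrite big1 // => j _; rewrite !mxE.
by case: eqP => [->|]; rewrite ?(negPf cb) ?mulr0 ?mul0r.
Qed.

Lemma erowM p (b : 'I_D) (M : 'M[F]_(D, p)) : erow b *m M = row b M.
Proof.
apply/rowP => c; rewrite !mxE (bigD1 b) //= big1 => [|j jb]; rewrite !mxE.
  by rewrite eqxx mul1r addr0.
by rewrite (_ : (j == b :> nat) = false) ?mul0r //; apply/negbTE.
Qed.

Lemma row_erow (u : 'rV[F]_D) : u = \sum_b u 0 b *: erow b.
Proof.
apply/rowP => c; rewrite summxE (bigD1 c) //= big1 => [|j jb]; rewrite !mxE.
  by rewrite eqxx mulr1 addr0.
by rewrite eq_sym (_ : (j == c :> nat) = false) ?mulr0 //; apply/negbTE.
Qed.

Definition pvec (d : nat) (u : 'rV[F]_D) : {mpoly F[2]} := \sum_b u 0 b *: 'X_[mono d b].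

Lemma pvec_homog d u : (u <= low F D (rho k (d + k.+1)))%MS -> qhomog_part k d (pvec d u).
Proof.
move=> /lowP hu; apply: rpred_sum => b _; have [lt|le] := ltnP b (rho k (d + k.+1)).
  by apply: rpredZ; rewrite dhomogX /= wdeg_mono // -lt_rho.
by rewrite hu // scale0r rpred0.
Qed.

Lemma pvecX d u : (u <= low F D (rho k (d + k.+1)))%MS -> 'X_0 * pvec d u = pvec d.+1 u.
Proof.
move=> /lowP hu; rewrite /pvec mulr_sumr; apply: eq_bigr => b _.
have [lt|le] := ltnP b (rho k (d + k.+1)); last by rewrite hu // !scale0r mulr0.
by rewrite -scalerAr -mpolyXD monoX // -lt_rho.
Qed.

Lemma pvec_linear d : linear (pvec d).
Proof.
move=> c u w; rewrite /pvec scaler_sumr -big_split; apply: eq_bigr => b _.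
by rewrite !mxE scalerDl scalerA.
Qed.

HB.instance Definition _ d := GRing.isLinear.Build F 'rV[F]_D {mpoly F[2]} _ (pvec d) (pvec_linear d).

Lemma pvec_erow d (b : 'I_D) : pvec d (erow b) = 'X_[mono d b].
Proof.
rewrite /pvec (bigD1 b) //= big1 => [|c cb]; rewrite !mxE.
  by rewrite eqxx scale1r addr0.
by rewrite (_ : (c == b :> nat) = false) ?scale0r //; apply/negbTE.
Qed.

Lemma pvecY d u : (u <= low F D D.-1)%MS -> 'X_1 * pvec d u = pvec (d + k) (u *m shY F D).
Proof.
move=> /lowP hu; rewrite {2}[u]row_erow mulmx_suml linear_sum /pvec mulr_sumr.
apply: eq_bigr => b _; rewrite -scalemxAl linearZ /= erow_shY.
have [lt|le] := ltnP b D.-1; last by rewrite hu // !scale0r mulr0.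
have bD : (b.+1 < D)%N by lia.
by rewrite (pvec_erow (d + k) (Ordinal bD)) -scalerAr -mpolyXD monoY.
Qed.

Lemma pvec_coord d f : qhomog_part k d f -> (d + k.+1 <= B)%N ->
  exists2 u, (u <= low F D (rho k (d + k.+1)))%MS & f = pvec d u.
Proof.
move=> fd dB; have rD : (rho k (d + k.+1) < D)%N by apply: leq_ltn_trans ltD; exact: rho_mono.
exists (\row_(b < D) (if (b < rho k (d + k.+1))%N then f@_(mono d b) else 0)).
  by apply/lowP => j; rewrite mxE ltnNge => ->.
apply/mpolyP => m; rewrite /pvec linear_sum /=.
under eq_bigr do rewrite mcoeffZ mcoeffX mxE.
have [dm|dm] := eqVneq (wdeg k m) d; last first.
  rewrite big1 => [|b _]; first by apply: (dhomog_nemf_coeff fd); exact: dm.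
  case: ifP => [h|_]; last by rewrite mul0r.
  by case: eqP => [e|]; rewrite ?mulr0 //; rewrite -e wdeg_mono -?lt_rho ?eqxx in dm.
have lt1 : (m 1%R < rho k (d + k.+1))%N by rewrite lt_rho -dm /wdeg leq_addl.
have mD : (m 1%R < D)%N by apply: ltn_trans rD.
rewrite (bigD1 (Ordinal mD)) //= lt1 -dm -monoE eqxx mulr1 big1 ?addr0 // => b bm.
case: eqP => [e|]; rewrite ?mulr0 //; case/eqP: bm; apply: val_inj => /=.
by rewrite -[m in RHS]e mono1.
Qed.

Definition link I v := forall d, (d + k.+1 <= B)%N ->
  forall u, (u <= low F D (rho k (d + k.+1)))%MS ->
    ((u <= piece v (d + k.+1))%MS <-> I (pvec d u)).

Definition normp v := forall i, (i <= B)%N ->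
  cform (piece v i) = piece v i /\ (piece v i <= low F D (rho k i))%MS.

Lemma inX_reduced e v : inX k e v -> normp v.
Proof. by move=> /(inXP k_gt0) [h _ _] i /h []. Qed.

Lemma link_inj I v v' : normp v -> normp v' -> link I v -> link I v' -> v = v'.
Proof.
move=> h h' l l'; apply: piece_inj => i iB.
have [c lo] := h i iB; have [c' lo'] := h' i iB.
have [ik|ki] := leqP i k.
  rewrite -c -c'; apply: cform_eq.
  rewrite (submx_trans lo) ?(submx_trans lo') // (rho_small k_gt0) //.
    by rewrite /low pid_mx_0 sub0mx.
  by rewrite /low pid_mx_0 sub0mx.
have iE : i = (i - k.+1 + k.+1)%N by rewrite subnK.
rewrite iE in iB lo lo' c c' *; rewrite -c -c'; apply: cform_eq; apply/andP; split.
  apply/row_subP => b; apply/(l' _ iB); first exact: submx_trans (row_sub _ _) lo.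
  by apply/(l _ iB); [exact: submx_trans (row_sub _ _) lo | exact: row_sub].
apply/row_subP => b; apply/(l _ iB); first exact: submx_trans (row_sub _ _) lo'.
by apply/(l' _ iB); [exact: submx_trans (row_sub _ _) lo' | exact: row_sub].
Qed.

Lemma idealZ I c f : is_ideal I -> I f -> I (c *: f).
Proof. by move=> hI If; rewrite -mul_mpolyC; apply: idealM. Qed.

Lemma ideal_sum I (T : Type) (r : seq T) (P : pred T) (f : T -> {mpoly F[2]}) : is_ideal I ->
  (forall i, P i -> I (f i)) -> I (\sum_(i <- r | P i) f i).
Proof.
move=> hI h; elim/big_rec: _ => [|i x Pi Ix]; first exact: ideal0.
by apply: idealD => //; apply: h.
Qed.

Hypothesis Htail : forall d, (B < d + k.+1)%N -> H d = 0%N.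

Lemma hilb_tail I d f : hilb_fixH k n H I -> (B < d + k.+1)%N -> qhomog_part k d f -> I f.
Proof.
move=> [_ _ hq] Bd fd; have [b [_ /(_ _ fd) [c [hc _]]]] := hq d.
rewrite big1 ?subr0 in hc => // j; have hj : (0 < H d)%N by exact: leq_ltn_trans (ltn_ord j).
by exfalso; rewrite Htail in hj.
Qed.

Lemma link_sub I J v : hilb_fixH k n H I -> hilb_fixH k n H J -> link I v -> link J v -> I `<=` J.
Proof.
move=> hI hJ lI lJ f If; have [[[iJ _] _] _ _] := hJ; have [_ qI _] := hI.
rewrite (@pihomog_partitionE _ _ (wdeg k) _ f (leqnn _)); apply: ideal_sum => // d _.
have Ifd := qI _ If d; have fd : qhomog_part k d (pihomog (wdeg k) d f) by apply: pihomogP.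
have [dB|Bd] := leqP (d + k.+1) B; last exact: hilb_tail hJ Bd fd.
have [u ul fu] := pvec_coord fd dB; rewrite fu in Ifd *.
by apply/(lJ d dB u ul); apply/(lI d dB u ul).
Qed.

Lemma link_eq I J v : hilb_fixH k n H I -> hilb_fixH k n H J -> link I v -> link J v -> I = J.
Proof. by move=> hI hJ lI lJ; apply/seteqP; split; [apply: link_sub lI lJ|apply: link_sub lJ lI]. Qed.

Lemma hilb_piece I d : hilb_fixH k n H I -> (d + k.+1 <= B)%N ->
  exists W : 'M[F]_D, [/\ cform W = W, (W <= low F D (rho k (d + k.+1)))%MS,
    (H d + \rank W = rho k (d + k.+1))%N &
    forall u, (u <= low F D (rho k (d + k.+1)))%MS -> (u <= W)%MS <-> I (pvec d u)].
Proof.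
move=> [[[hI _] _] _ hq] dB; set r := rho k (d + k.+1).
have rD : (r < D)%N by apply: leq_ltn_trans ltD; exact: rho_mono.
have [b [hb hc]] := hq d.
have /choice [C hC] : forall a : 'I_D, exists c : 'rV[F]_(H d),
    (a < r)%N -> I ('X_[mono d a] - \sum_j c 0 j *: b j).
  move=> a; have [ar|ra] := ltnP a r; last by exists 0.
  have [|c [? _]] := hc 'X_[mono d a]; last by exists c.
  by rewrite /qhomog_part /= dhomogX /= wdeg_mono -?lt_rho.
pose M := \matrix_a C a.
have key u : (u <= low F D r)%MS -> I (pvec d u - \sum_j (u *m M) 0 j *: b j).
  move=> /lowP hu; have -> : \sum_j (u *m M) 0 j *: b j = \sum_a u 0 a *: \sum_j C a 0 j *: b j.
    under eq_bigr do rewrite mxE scaler_suml.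
    rewrite exchange_big /=; apply: eq_bigr => a _; rewrite scaler_sumr.
    by apply: eq_bigr => j _; rewrite !mxE scalerA.
  rewrite /pvec -sumrB; apply: ideal_sum => // a _.
  have [ar|ra] := ltnP a r; last by rewrite hu // !scale0r subr0; apply: ideal0.
  by rewrite -scalerBr; apply: idealZ => //; apply: hC.
have uM u : (u <= low F D r)%MS -> u *m M = 0 <-> I (pvec d u).
  move=> hu; split=> [e|Iu].
    by have := key u hu; rewrite e big1 ?subr0 // => j _; rewrite mxE scale0r.
  have [c [_ uniq]] := hc _ (pvec_homog hu).
  rewrite -(uniq _ (key u hu)); apply: uniq.
  by rewrite big1 ?subr0 // => j _; rewrite mxE scale0r.
have rk : \rank (low F D r *m M) = H d.
  apply/eqP; rewrite eqn_leq rank_leq_col -{1}(mxrank1 F (H d)); apply: mxrankS.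
  apply/row_subP => j; rewrite row1.
  have [w wl bw] := pvec_coord (hb j) dB.
  have [c [_ uniq]] := hc _ (hb j).
  suff -> : delta_mx 0 j = w *m M by apply: submxMr.
  rewrite -(uniq (w *m M)); last by rewrite {1}bw; apply: key.
  apply/esym/uniq; rewrite (bigD1 j) //= mxE !eqxx scale1r big1 => [|l lj].
    by rewrite addr0 subrr; apply: ideal0.
  by rewrite mxE eqxx (negPf lj) scale0r.
exists (cform (low F D r :&: kermx M)%MS); split.
- exact: cform_id.
- by rewrite cform_eqmx capmxSl.
- by rewrite cform_eqmx -{1}rk mxrank_mul_ker rank_low // ltnW.
- move=> u hu; rewrite cform_eqmx sub_capmx hu /= -(uM u hu); split=> [/sub_kermxP //|e].
  exact/sub_kermxP.
Qed.

Definition ideal_dim i := (rho k i - (if i <= k then 0 else H (i - k.+1)))%N.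

Lemma ideal_dimE d : ideal_dim (d + k.+1) = (rho k (d + k.+1) - H d)%N.
Proof. by rewrite /ideal_dim addnK leqNgt addnS ltnS leq_addl. Qed.

Lemma hilb_le I d : hilb_fixH k n H I -> (H d <= rho k (d + k.+1))%N.
Proof.
move=> hI; have [dB|Bd] := leqP (d + k.+1) B; last by rewrite Htail.
by have [W [_ _ <- _]] := hilb_piece hI dB; rewrite leq_addr.
Qed.

Lemma submx_rows m m' p (M : 'M[F]_(m, p)) (N : 'M[F]_(m', p)) :
  (forall u : 'rV_p, (u <= M)%MS -> (u <= N)%MS) -> (M <= N)%MS.
Proof. by move=> h; apply/row_subP => i; apply: h; apply: row_sub. Qed.

Lemma hilb_model I : hilb_fixH k n H I -> exists2 v, inX k ideal_dim v & link I v.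
Proof.
move=> hI; have [[[iI _] _] _ _] := hI.
have /choice [W hW] : forall d, exists W : 'M[F]_D, (d + k.+1 <= B)%N ->
   [/\ cform W = W, (W <= low F D (rho k (d + k.+1)))%MS,
    (H d + \rank W = rho k (d + k.+1))%N &
    forall u, (u <= low F D (rho k (d + k.+1)))%MS -> (u <= W)%MS <-> I (pvec d u)].
  by move=> d; have [/(hilb_piece hI) [W h]|//] := leqP (d + k.+1) B; [exists W | exists 0].
pose V i := if (i <= k)%N then 0 else W (i - k.+1)%N.
pose v : point F B D := \matrix_i mxvec (V i).
have pE i : (i <= B)%N -> piece v i = V i.
  by move=> iB; rewrite /piece rowK mxvecK inordK.
have VE d : V (d + k.+1)%N = W d by rewrite /V addnK leqNgt addnS ltnS leq_addl.
have split_i i : (i <= k)%N \/ exists d, i = (d + k.+1)%N.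
  by have [|ki] := leqP i k; [left | right; exists (i - k.+1)%N; rewrite subnK].
have V0 i : (i <= k)%N -> V i = 0 by rewrite /V => ->.
exists v; last by move=> d dB u hu; rewrite pE // VE; have [_ _ _] := hW d dB; apply.
apply/(inXP k_gt0); split=> [i iB|i iB|i iB].
- rewrite pE //; have [ik|[d di]] := split_i i.
    rewrite V0 // mxrank0 /ideal_dim (rho_small k_gt0 ik) sub0mx; split=> //.
    by apply/eqP; rewrite -submx0 cform_eqmx submx_refl.
  rewrite di in iB *; rewrite VE ideal_dimE; have [c l r _] := hW d iB.
  by split=> //; rewrite -r addKn.
- rewrite !pE ?(ltnW iB) //; have [ik|[d di]] := split_i i; first by rewrite V0 // sub0mx.
  rewrite di in iB *; rewrite -addSn !VE; have [_ l _ h] := hW d (ltnW iB).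
  have [_ _ _ h'] := hW d.+1 iB; apply: submx_rows => u uW.
  have ul := submx_trans uW l; have ul' : (u <= low F D (rho k (d.+1 + k.+1)))%MS.
    by apply: submx_trans ul _; apply: low_mono; apply: (rho_mono k_gt0); lia.
  by apply/h' => //; rewrite -pvecX //; apply: idealM => //; apply/h.
- rewrite !pE ?(leq_trans (leq_addr _ _) iB) //.
  have [ik|[d di]] := split_i i; first by rewrite V0 // mul0mx sub0mx.
  have iB' : (i <= B)%N by apply: leq_trans iB; apply: leq_addr.
  rewrite di in iB iB' *; rewrite addnAC in iB *; rewrite !VE.
  have [_ l _ h] := hW d iB'; have [_ _ _ h'] := hW _ iB.
  apply: submx_rows => _ /submxP [x ->]; rewrite mulmxA.
  have uW : (x *m W d <= W d)%MS by apply: submxMl.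
  have ul := submx_trans uW l.
  have rD : (rho k (d + k.+1) < D)%N by apply: leq_ltn_trans ltD; exact: rho_mono.
  have ul' : (x *m W d *m shY F D <= low F D (rho k (d + k + k.+1)))%MS.
    apply: submx_trans (submxMr _ ul) _; apply: (low_mulY F k_gt0 ltD ltkB); right.
    by rewrite addnAC rhoDk // addnS.
  apply/h' => //; rewrite -pvecY; first by apply: idealM => //; apply/h.
  by apply: submx_trans ul _; apply: low_mono; rewrite -ltnS prednK //; lia.
Qed.

(* The standard monomials: an echelon form has a diagonal entry 1 at the pivots
   and 0 elsewhere. *)
Definition inbox v (p : 'I_B.+1 * 'I_D) :=
  (p.2 < rho k p.1)%N && (piece v p.1 p.2 p.2 == 0).

Lemma cform_pivots (K : 'M[F]_D) r : cform K = K -> (K <= low F D r)%MS ->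
  exists S : {set 'I_D}, [/\ K *m selmx F S = selmx F S, selmx F S *m K = K,
    #|S| = \rank K & forall b, (b \in S) = (b < r)%N && (K b b != 0)].
Proof.
move=> cK Kr; have [S [e1 e2 rS]] : exists S : {set 'I_D}, [/\ K *m selmx F S = selmx F S, selmx F S *m K = K & #|S| = \rank K].
  move: cK; rewrite {1}/cform; case: pickP => [S pS|/(_ _)]; last first.
    by have [S pS] := pivots_ex K => /(_ S); rewrite pS.
  have [e1 e2 _] := pivots_form pS => cK; rewrite cK in e1 e2.
  by exists S; split=> //; have /andP [_ /eqP] := pS.
exists S; split=> // b; have Kbb : K b b = (b \in S)%:R.
  have [bS|bS] := boolP (b \in S).
    have := congr1 (fun M : 'M[F]_D => M b b) e1; rewrite selmxE eqxx bS /= => <-.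
    rewrite [RHS]mxE (bigD1 b) //= selmxE eqxx bS mulr1 big1 ?addr0 // => j jb.
    by rewrite selmxE (negPf jb) mulr0.
  have := congr1 (fun M : 'M[F]_D => M b b) e2; rewrite mxE => <-.
  by rewrite big1 // => j _; rewrite selmxE; case: eqP => [<-|]; rewrite ?(negPf bS) mul0r.
rewrite Kbb; case bS: (b \in S); rewrite ?eqxx ?andbF // oner_eq0 andbT.
apply/esym/idP; rewrite ltnNge; apply/negP => rb; move: Kbb; rewrite bS.
have /lowP/(_ _ rb) := submx_trans (row_sub b K) Kr; rewrite mxE => -> /esym /eqP.
by rewrite oner_eq0.
Qed.

Lemma card_inbox v (i : 'I_B.+1) : inX k ideal_dim v ->
  #|[pred b | inbox v (i, b)]| = (rho k i - ideal_dim i)%N.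
Proof.
move=> /(inXP k_gt0) [/(_ i) hp _ _]; have [|cK rK Kl] := hp; first by rewrite -ltnS.
have [S [_ _ cS SE]] := cform_pivots cK Kl; rewrite -rK -cS.
have rD : (rho k i <= D)%N by apply/ltnW/(rho_ltD k_gt0 ltD); rewrite -ltnS.
have -> : rho k i = #|[pred b : 'I_D | (b < rho k i)%N]|.
  by rewrite -sum1_card -(big_ord_widen _ (fun=> 1%N) rD) sum1_card card_ord.
rewrite -(cardID (mem S) [pred b : 'I_D | (b < rho k i)%N]) addnC.
rewrite (_ : #|predI _ _| = #|S|); last by apply: eq_card => b; rewrite !inE SE; case: leqP.
by rewrite addnK; apply: eq_card => b; rewrite !inE SE /inbox /=; case: (b < _)%N; rewrite ?negbK ?andbT ?andbF.
Qed.

Definition config := {ffun 'I_n -> 'I_B.+1 * 'I_D}.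

Definition is_config v (c : config) :=
  injectiveb c && [forall p, inbox v p == [exists l, c l == p]].

(* As [piece v i] is idempotent, 1 - [piece v i] sends u to its normal form. *)
Definition pres_at (c : config) v (m : 'X_{1..2}) : 'rV[F]_n :=
  \row_l (if (wdeg k m + k.+1)%N == (c l).1
          then (erow (m 1%R) *m (1%:M - piece v (c l).1)) 0 (c l).2 else 0).

Definition sc (c : config) l := mono ((c l).1 - k.+1) (c l).2.

Section AtPoint.
Variables (v : point F B D) (c : config).
Hypotheses (hv : inX k ideal_dim v) (hc : is_config v c).
Hypothesis Hle : forall d, (H d <= rho k (d + k.+1))%N.

Let c_inj : injective c.
Proof. by have /andP [/injectiveP] := hc. Qed.

Let c_box p : inbox v p <-> exists l, c l = p.
Proof.
have /andP [_ /forallP /(_ p) /eqP ->] := hc.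
by split=> [/existsP [l /eqP e]|[l <-]]; [exists l | apply/existsP; exists l].
Qed.

Lemma c_spec l : exists2 d, ((c l).1 = d + k.+1 :> nat)%N & (k * (c l).2 <= d)%N.
Proof.
have /andP [lt _] : inbox v (c l) by apply/c_box; exists l.
have ki : (k < (c l).1)%N.
  by rewrite ltnNge; apply/negP => /(rho_small k_gt0) e; rewrite e in lt.
by exists ((c l).1 - k.+1)%N; rewrite ?subnK // -lt_rho subnK.
Qed.

Lemma wdeg_sc l : (wdeg k (sc c l) + k.+1 = (c l).1)%N.
Proof. by rewrite /sc; have [d -> h] := c_spec l; rewrite addnK wdeg_mono. Qed.

Lemma sum_box (i : 'I_B.+1) (x : 'rV[F]_D) (y : 'I_D -> F) : 
  (x <= low F D (rho k i))%MS -> \sum_(l | (c l).1 == i) (x *m (1%:M - piece v i)) 0 (c l).2 * y (c l).2 =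
  \sum_b (x *m (1%:M - piece v i)) 0 b * y b.
Proof.
move=> xl; set w := x *m _.
have /(inXP k_gt0) [/(_ i) hp _ _] := hv; have [|cK rK Kl] := hp; first by rewrite -ltnS.
have [S [e1 e2 _ SE]] := cform_pivots cK Kl.
have w0 b : ~~ inbox v (i, b) -> w 0 b = 0.
  have wl : (w <= low F D (rho k i))%MS.
    by rewrite /w mulmxBr mulmx1 addmx_sub // eqmx_opp (submx_trans _ Kl) ?submxMl.
  rewrite negb_and -leqNgt /= => /orP [rb|Kb]; first by move/lowP: wl; apply.
  have [rb|br] := leqP (rho k i) b; first by move/lowP: wl; apply.
  have bS : b \in S by rewrite SE br.
  have : w *m selmx F S = 0 by rewrite /w -mulmxA mulmxBl mul1mx e1 subrr mulmx0.
  move=> /rowP /(_ b); rewrite mxE (bigD1 b) //= selmxE eqxx bS mulr1 big1 ?addr0 ?mxE //.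
  by move=> j jb; rewrite selmxE (negPf jb) mulr0.
pose f b := w 0 b * y b.
have -> : \sum_b f b = \sum_b \sum_(l | c l == (i, b)) f (c l).2.
  apply: eq_bigr => b _; have [bb|/w0 wb] := boolP (inbox v (i, b)); last first.
    by rewrite /f wb mul0r big1 // => l /eqP -> /=; rewrite wb mul0r.
  have [l cl] := (c_box (i, b)).1 bb.
  rewrite (big_pred1 l) ?cl // => l'; apply/eqP/eqP => [|-> //].
  by rewrite -cl => /c_inj.
rewrite (exchange_big_dep (fun l => (c l).1 == i)) /= => [|b l _ /eqP -> //].
apply: eq_bigr => l /eqP li; rewrite (big_pred1 (c l).2) // => b /=.
by rewrite -li [c l]surjective_pairing xpair_eqE eqxx.
Qed.

Lemma pres_at_pres : pres k H (pres_at c v) (sc c).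
Proof.
have /(inXP k_gt0) [hp hX hY] := hv.
have ltB l : ((c l).1 <= B)%N by rewrite -ltnS.
split.
- move=> l; apply/rowP => l'; rewrite mxE [RHS]mxE eqxx /= wdeg_sc.
  have [cK _ Kl] := hp _ (ltB l); have [S [e1 e2 _ SE]] := cform_pivots cK Kl.
  have [e|ne] := eqVneq ((c l).1 : nat) (c l').1; last first.
    by have [e|] := eqVneq l' l; rewrite ?andbF //; move: ne; rewrite e eqxx.
  rewrite -(val_inj e) /sc mono1 erowM mxE [LHS]mxE [X in X + _]mxE [X in _ + X]mxE.
  have /andP [bl K0] : inbox v (c l) by apply/c_box; exists l.
  have -> : piece v (c l).1 (c l).2 (c l').2 = 0.
    have bS : (c l).2 \notin S by rewrite SE bl (eqP K0) eqxx.
    rewrite -e2 mxE big1 // => j _; rewrite selmxE; case: eqP => [<-|]; rewrite ?(negPf bS) mul0r //.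
  rewrite subr0 eq_sym; congr (_%:R); congr nat_of_bool; apply/eqP/eqP => [e'|-> //].
  by apply: c_inj; rewrite [c l']surjective_pairing [c l]surjective_pairing -e' -(val_inj e).
- move=> m l; rewrite mxE; case: ifP => [/eqP e _|]; last by rewrite eqxx.
  by apply/eqP; rewrite -(eqn_add2r k.+1) e wdeg_sc.
- move=> i m; apply/rowP => l'; rewrite mxE summxE.
  pose T := if i == 0%R then 1%:M else shY F D.
  pose w := wdeg k (U_(i)%MM).
  have eT (m' : 'X_{1..2}) : erow ((U_(i) + m')%MM 1%R) = erow (m' 1%R) *m T.
    rewrite /T mnmDE mnm1E; case: (i) => [[|[|//]] hi] /=; first by rewrite mulmx1.
    by rewrite add1n erow_shY.
  have Ac0 l : (pres_at c v m 0 l *: pres_at c v (U_(i) + sc c l)) 0 l' =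
     if (c l).1 == (wdeg k m + k.+1)%N :> nat then
       if (w + wdeg k m + k.+1)%N == (c l').1 :> nat then
         (erow (m 1%R) *m (1%:M - piece v (c l).1)) 0 (c l).2 * 
           (erow (c l).2 *m T *m (1%:M - piece v (c l').1)) 0 (c l').2 else 0 else 0.
    rewrite !mxE; rewrite [(c l).1 == _ :> nat]eq_sym; case: eqP => [e|_]; last by rewrite mul0r.
    rewrite wdegD -addnA wdeg_sc -e -/w addnA; case: eqP => [_|]; last by rewrite mulr0.
    by rewrite eT /sc mono1.
  under eq_bigr do rewrite Ac0.
  rewrite wdegD -/w; case: eqP => [e|_]; last by rewrite big1 // => l _; case: ifP.
  rewrite -big_mkcond /= eT.
  have wB : (wdeg k m + k.+1 < B.+1)%N.
    by rewrite ltnS; apply: leq_trans (ltB l'); rewrite -e -addnA leq_addl.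
  pose i0 := Ordinal wB; pose x := erow (m 1%R).
  have xl : (x <= low F D (rho k i0))%MS.
    apply/lowP => j rj; rewrite mxE; case: eqP => // jm.
    have : (m 1%R < rho k i0)%N by rewrite lt_rho /wdeg leq_addl.
    by rewrite -jm ltnNge rj.
  pose y (b : 'I_D) := (erow b *m T *m (1%:M - piece v (c l').1)) 0 (c l').2.
  rewrite (eq_bigr (fun l => (x *m (1%:M - piece v i0)) 0 (c l).2 * y (c l).2)); last first.
    by move=> l /eqP ->.
  rewrite (eq_bigl (fun l => (c l).1 == i0)) // (sum_box y xl).
  have -> : \sum_b (x *m (1%:M - piece v i0)) 0 b * y b
    = (x *m (1%:M - piece v i0) *m T *m (1%:M - piece v (c l').1)) 0 (c l').2.
    rewrite -[x *m _ *m T *m _]mulmxA [RHS]mxE; apply: eq_bigr => b _; congr (_ * _).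
    by rewrite /y -mulmxA erowM [LHS]mxE.
  congr (fun_of_matrix _ 0 _); set K' := piece v (c l').1.
  have KK : (piece v i0 *m T <= K')%MS.
    rewrite /K' -e -addnA -[X in piece v (_ + X)%N]/(i0 : nat) /T /w /wdeg !mnm1E.
    have := ltB l'; rewrite -e -addnA /w /wdeg !mnm1E.
    case: (i) => [[|[|//]] hi] /=; rewrite ?mulmx1 ?muln1 ?muln0 ?addn0 ?add0n.
      exact: hX.
    by move=> h; rewrite [(k + _)%N]addnC; apply: hY; rewrite addnC.
  have [cK' _ _] := hp _ (ltB l').
  have zK : x *m piece v i0 *m T *m K' = x *m piece v i0 *m T.
    apply/eqP; rewrite -[K' in _ *m K']cK' cform_proj; apply: submx_trans KK.
    by rewrite -mulmxA submxMl.
  by rewrite [x *m (1%:M - piece v i0)]mulmxBr mulmx1 !mulmxBl [X in _ = _ - X]mulmxBr mulmx1 zK subrr subr0.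
- move=> d; have [dB|Bd] := leqP (d + k.+1) B; last first.
    rewrite Htail // eq_card0 // => l; rewrite !inE; apply/negP => /eqP e.
    by have := ltB l; rewrite -wdeg_sc e leqNgt Bd.
  have dB' : (d + k.+1 < B.+1)%N by rewrite ltnS.
  pose i := Ordinal dB'; have := card_inbox i hv; rewrite ideal_dimE subKn //.
  move=> <-; rewrite -(@fintype.card_in_image _ _ (fun l => (c l).2)); last first.
    move=> l l'; rewrite !inE => /eqP e /eqP e' el; apply: c_inj.
    rewrite [c l]surjective_pairing [c l']surjective_pairing el; congr pair.
    by apply: val_inj; rewrite /= -!wdeg_sc e e'.
  apply: eq_card => b; apply/fintype.imageP/idP => [[l]|].
    rewrite !inE => /eqP e ->; rewrite (_ : (i, (c l).2) = c l); first by apply/c_box; exists l.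
    by rewrite [RHS]surjective_pairing; congr pair; apply: val_inj; rewrite /= -wdeg_sc e.
  rewrite inE => /c_box [l cl]; exists l; last by rewrite cl.
  by rewrite inE -(eqn_add2r k.+1) wdeg_sc cl.
Qed.

Lemma pres_at_link : link (idl (pres_at c v)) v.
Proof.
move=> d dB u ul; have /(inXP k_gt0) [hp _ _] := hv.
have dB' : (d + k.+1 < B.+1)%N by rewrite ltnS.
pose i : 'I_B.+1 := Ordinal dB'.
have evE l : ev (pres_at c v) (pvec d u) 0 l =
    if (c l).1 == i then (u *m (1%:M - piece v i)) 0 (c l).2 else 0.
  rewrite /pvec linear_sum summxE.
  transitivity (\sum_b u 0 b * (if (c l).1 == i then (1%:M - piece v i) b (c l).2 else 0)).
    apply: eq_bigr => b _; rewrite linearZ /= evX mxE; have [lt|le] := ltnP b (rho k i).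
      rewrite mxE wdeg_mono -?lt_rho // [X in if X then _ else _]eq_sym -[_ == _ :> nat]/((c l).1 == i).
      by case: eqP => [->|//]; rewrite mono1 erowM mxE.
    by move/lowP: ul => /(_ _ le) ->; rewrite !mul0r.
  case: eqP => _; last by rewrite big1 // => b _; rewrite mulr0.
  by rewrite [RHS]mxE.
have [cK _ Kl] := hp _ dB.
rewrite -(cform_proj (piece v i)) cK /idl /=; split=> [/eqP e|/rowP e].
  by apply/rowP => l; rewrite evE mulmxBr mulmx1 e subrr !mxE; case: ifP.
apply/eqP/esym/eqP; rewrite -subr_eq0 -[X in X - _]mulmx1 -mulmxBr; apply/eqP/rowP => b0.
rewrite [RHS]mxE; transitivity (\sum_b (u *m (1%:M - piece v i)) 0 b * (b == b0)%:R).
  rewrite (bigD1 b0) //= eqxx mulr1 big1 ?addr0 // => b /negPf ->; exact: mulr0.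
rewrite -(sum_box (i := i) (fun b => (b == b0)%:R) ul) big1 // => l li.
by have := e l; rewrite evE li [RHS]mxE => ->; exact: mul0r.
Qed.

End AtPoint.

Lemma cfg_ex v : n = (\sum_(i < B.+1) (rho k i - ideal_dim i))%N -> inX k ideal_dim v -> exists c, is_config v c.
Proof.
move=> nE hv; have bn : #|[pred p | inbox v p]| = n.
  rewrite nE -sum1_card (eq_bigr (fun i : 'I_B.+1 => \sum_(b | inbox v (i, b)) 1)%N) => [|i _].
    by rewrite pair_big_dep; apply: eq_bigl => -[i b].
  by rewrite -(card_inbox i hv) sum1_card.
exists [ffun l => enum_val (cast_ord (esym bn) l)]; apply/andP; split.
  by apply/injectiveP => l l'; rewrite !ffunE => /enum_val_inj /cast_ord_inj.
apply/forallP => p; apply/eqP; apply/idP/existsP => [bp|[l /eqP <-]]; last first.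
  by rewrite ffunE; have := enum_valP (cast_ord (esym bn) l).
have bp' : p \in [pred p | inbox v p] by [].
exists (cast_ord bn (enum_rank_in bp' p)); rewrite ffunE cast_ordK.
by rewrite enum_rankK_in.
Qed.

Definition pres_of v (m : 'X_{1..2}) : 'rV[F]_n :=
  if [pick c | is_config v c] is Some c then pres_at c v m else 0.

Lemma pres_of_pres v : n = (\sum_(i < B.+1) (rho k i - ideal_dim i))%N ->
  (forall d, (H d <= rho k (d + k.+1))%N) -> inX k ideal_dim v ->
  (exists s, pres k H (pres_of v) s) /\ link (idl (pres_of v)) v.
Proof.
move=> nE Hle hv; rewrite /pres_of; case: pickP => [c hc|h]; last first.
  by have [c] := cfg_ex nE hv; rewrite h.
split; last exact: pres_at_link hv hc.
by exists (sc c); apply: pres_at_pres.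
Qed.

Definition point_at A : point F B D := \matrix_(i < B.+1) mxvec (cform
  (capmx_gen (low F D (rho k i)) (kermx (\matrix_b A (mono (i - k.+1) b))))).

Lemma piece_point_at A i : (i <= B)%N -> piece (point_at A) i = cform
  (capmx_gen (low F D (rho k i)) (kermx (\matrix_b A (mono (i - k.+1) b)))).
Proof. by move=> iB; rewrite /piece rowK mxvecK inordK. Qed.

Lemma point_at_reduced A : normp (point_at A).
Proof.
move=> i iB; rewrite piece_point_at // cform_id; split=> //.
by rewrite cform_eqmx -capmxE capmxSl.
Qed.

Lemma point_at_link A : link (idl A) (point_at A).
Proof.
move=> d dB u ul; rewrite piece_point_at // cform_eqmx addnK sub_capmx_gen ul /=.
rewrite /idl /pvec /= (linear_sum (ev A)).
have -> : \sum_b ev A (u 0 b *: 'X_[mono d b]) = u *m \matrix_b A (mono d b).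
  by rewrite mulmx_sum_row; apply: eq_bigr => b _; rewrite linearZ /= evX rowK.
by split=> [/sub_kermxP|e //]; last exact/sub_kermxP.
Qed.

Lemma dmx_pres_of m : dmx (T := pt_dtype F B D) (fun v => pres_of v m).
Proof.
pose f (oc : option config) v := if oc is Some c then pres_at c v m else 0.
apply: (dmx_case (T := pt_dtype F B D) (c := fun v => [pick c | is_config v c]) (f := f)).
  apply: dfin_pick => c; apply: dpredI; first exact: dpred_const.
  apply: dpred_forall => p.
  have h : dpred (T := pt_dtype F B D) (fun v => inbox v p).
    apply: dpredI; first exact: dpred_const.
    by apply: dpred_eq0; apply: dmx_piece.
  case: [exists l, _]; first by have := h; congr dpred; apply/funext => v; rewrite eqb_id.
  by have := dpredN h; congr dpred; apply/funext => v; rewrite eqbF_neg.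
move=> [c|]; last exact: dmx_const.
move=> i l; pose g v := (if (wdeg k m + k.+1)%N == (c l).1
          then (erow (m 1%R) *m (1%:M - piece v (c l).1)) 0 (c l).2 else 0).
apply: (dfun_ext (f := g)) => [v|]; first by rewrite mxE.
rewrite /g; case: ((wdeg k m + k.+1)%N == (c l).1); last exact: dfun_const.
have h : dmx (T := pt_dtype F B D) (fun v => erow (m 1%R) *m (1%:M - piece v (c l).1)).
  apply: dmx_mul; first exact: dmx_const.
  by apply: dmx_sub; [apply: dmx_const | apply: dmx_piece].
exact: h.
Qed.

Lemma dmap_point_at (T : dtype F) (A : T -> 'X_{1..2} -> 'rV[F]_n) :
  (forall m, dmx (fun t => A t m)) -> dmap (U := pt_dtype F B D) (fun t => point_at (A t)).
Proof.
move=> hA; apply: dmap_mx => i j; case/mxvec_indexP: j => a b.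
have h : dmx (fun t => cform
    (capmx_gen (low F D (rho k i)) (kermx (\matrix_b A t (mono (i - k.+1) b))))).
  apply: dmx_cform; apply: dmx_cap; first exact: dmx_const.
  apply: dmx_ker => c l; apply: dfun_ext (hA (mono (i - k.+1) c) 0 l) => t.
  by rewrite mxE.
by apply: dfun_ext (h a b) => t; rewrite mxE mxvecE.
Qed.

End ModelIdeal.

(** * The class of the Hilbert scheme *)

Section Normalize.
Variables (F : closedFieldType) (N : nat).
Implicit Types w z : 'rV[F]_N.

Definition leading w (i : 'I_N) := (w 0 i != 0) && [forall j : 'I_N, (j < i)%N ==> (w 0 j == 0)].

Definition nrm w : 'rV[F]_N := if [pick i | leading w i] is Some i then (w 0 i)^-1 *: w else 0.

Lemma leading_ex w : w != 0 -> exists i, leading w i.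
Proof.
move=> /nz_coord [i0 wi0]; case: (arg_minnP (P := fun i => w 0 i != 0) (fun i => i : nat) wi0) => i wi imin.
exists i; rewrite /leading wi; apply/forallP => j; apply/implyP => ji.
by apply/negPn/negP => /imin; rewrite leqNgt ji.
Qed.

Lemma leading_uniq w i j : leading w i -> leading w j -> i = j.
Proof.
move=> /andP [wi /forallP hi] /andP [wj /forallP hj]; case: (ltngtP i j) => [lt|lt|/val_inj //].
  by have := hj i; rewrite lt (negPf wi).
by have := hi j; rewrite lt (negPf wj).
Qed.

Lemma nrmP w : w != 0 -> normalized (nrm w) /\ exists2 c, c != 0 & nrm w = c *: w.
Proof.
move=> /leading_ex [i0 h0]; rewrite /nrm; case: pickP => [i /andP [wi /forallP hi]|/(_ i0)]; last by rewrite h0.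
split; last by exists (w 0 i)^-1; rewrite ?invr_eq0.
apply/existsP; exists i; rewrite mxE mulVf // eqxx; apply/forallP => j; apply/implyP => ji.
by have := hi j; rewrite ji mxE => /eqP ->; rewrite mulr0.
Qed.

Lemma nrm_id c z : normalized z -> c != 0 -> nrm (c *: z) = z.
Proof.
move=> /existsP [i /andP [/eqP zi /forallP hi]] c0.
have li : leading (c *: z) i.
  rewrite /leading !mxE zi mulr1 c0; apply/forallP => j; apply/implyP => ji.
  by have := hi j; rewrite ji mxE => /eqP ->; rewrite mulr0.
rewrite /nrm; case: pickP => [j /leading_uniq/(_ li) ->|/(_ i)]; last by rewrite li.
by rewrite mxE zi mulr1 scalerA mulVf // scale1r.
Qed.

Lemma dmx_nrm (T : dtype F) (w : T -> 'rV[F]_N) : dmx w -> dmx (fun t => nrm (w t)).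
Proof.
move=> hw; pose f (oi : option 'I_N) t := if oi is Some i then (w t 0 i)^-1 *: w t else 0.
apply: (dmx_case (c := fun t => [pick i | leading (w t) i]) (f := f)).
  apply: dfin_pick => i; apply: dpredI; first exact: dpred_neq0.
  apply: dpred_forall => j; apply: dpred_imply; exact: dpred_eq0.
by case=> [i|]; [apply: dmx_scale => //; apply: dfun_inv | apply: dmx_const].
Qed.

End Normalize.

Section HilbertClass.
Variables (F : closedFieldType) (k B D n : nat) (H : nat -> nat).
Hypothesis k_gt0 : (0 < k)%N.
Hypothesis ltD : (rho k B < D)%N.
Hypothesis ltkB : (k < B)%N.
Hypothesis Htail : forall d, (B < d + k.+1)%N -> H d = 0%N.
Hypothesis Hle : forall d, (H d <= rho k (d + k.+1))%N.
Hypothesis nE : n = (\sum_(i < B.+1) (rho k i - ideal_dim k H i))%N.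
Local Notation PI := (plucker_index n).
Local Notation N := #|PI|.
Local Notation PT := (pt_dtype F B D).
Local Notation ZT := (rv_dtype F N).
Local Notation e := (ideal_dim k H).
Implicit Types (v : point F B D) (z : 'rV[F]_N).

Definition point_of z : point F B D :=
  point_at k B D (fun m => if [pick s : PI | Zc z s != 0] is Some s then pres_chart z s m else 0).

Definition cone_of v : 'rV[F]_N := nrm (Pl (pres_of k n v)).

Lemma model_hilb v : inX k e v -> exists s, [/\ pres k H (pres_of k n v) s,
  hilb_fixH k n H (idl (pres_of k n v)), link k (idl (pres_of k n v)) v & Pl (pres_of k n v) != 0].
Proof.
move=> hv; have [[s hs] l] := pres_of_pres k_gt0 ltD Htail nE Hle hv; exists s; split=> //.
  exact: pres_hilb hs.
by have [] := pres_eqs k_gt0 hs (oner_neq0 F); rewrite scale1r.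
Qed.

Lemma point_of_Pl v c : inX k e v -> c != 0 -> point_of (c *: Pl (pres_of k n v)) = v.
Proof.
move=> hv c0; have [s [hs _ lv nz]] := model_hilb hv.
set z := c *: _; have z0 : z != 0 by rewrite scaler_eq0 negb_or c0.
rewrite /point_of; case: pickP => [t zt|h]; last first.
  have [j zj] := nz_coord z0; have := h (enum_val j).
  by rewrite /Zc enum_valK zj.
apply: (link_inj k_gt0 (I := idl (pres_of k n v))) => //.
- exact: point_at_reduced.
- exact: inX_reduced hv.
- by rewrite -(pres_chart_Pl k_gt0 hs c0 zt); apply: point_at_link.
Qed.

Lemma hilb_coneE (z : 'rV[F]_N) : hilb_cone (hilb_fixH k n H) z <->
  exists2 v : point F B D, inX k e v & exists2 c, c != 0 & z = c *: Pl (pres_of k n v).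
Proof.
split=> [[I hI pz]|[v hv [c c0 ze]]]; last first.
  have [s [hs hI _ _]] := model_hilb hv; exists (idl (pres_of k n v)) => //.
  by apply/(plucker_pres z hs); exists c.
have [v hv lv] := hilb_model k_gt0 ltD ltkB hI.
have [s [hs hI' lv' _]] := model_hilb hv.
exists v => //; apply/(plucker_pres z hs).
by rewrite -(link_eq k_gt0 ltD Htail hI hI' lv lv').
Qed.

Lemma hilb_cone_closed : hilb_cone (hilb_fixH k n H) = closed_cone (@pl_eqs F n k H).
Proof.
apply/seteqP; split=> z.
  move=> /hilb_coneE [v hv [c c0 ->]]; have [s [hs _ _ _]] := model_hilb hv.
  exact: pres_eqs hs c0.
move=> hz; have [j zj] := nz_coord hz.1.
have zs : Zc z (enum_val j) != 0 by rewrite /Zc enum_valK.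
have hs := eqs_pres hz zs; exists (idl (pres_chart z (enum_val j))); first exact: pres_hilb hs.
apply/(plucker_pres z hs); exists (Zc z (enum_val j)) => //; exact: (eqs_Pl hz zs).
Qed.

Lemma hilb_cone_qproj : locally_closed (hilb_cone (hilb_fixH (F := F) k n H) : set ('rV[F]_N)).
Proof.
exists (closed_cone (@pl_eqs F n k H)), (closed_cone [set 1]); split.
- by exists (@pl_eqs F n k H) => // f; apply: pl_eqs_homog.
- by exists [set 1] => // f ->; apply/homogP; exists 0%N; apply: dhomog1.
rewrite hilb_cone_closed; apply/seteqP; split=> [z hz|z [] //]; split=> //.
by move=> [_ /(_ 1 erefl)] /eqP; rewrite meval1 oner_eq0.
Qed.

Lemma dmap_point_of : dmap (T := ZT) (U := PT) point_of.
Proof.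
apply: (@dmap_point_at F k B D n ZT (fun z m => if [pick s : PI | Zc z s != 0] is Some s then pres_chart z s m else 0)) => m.
pose f (os : option PI) z := if os is Some s then pres_chart z s m else 0.
have hZ t : dfun (T := ZT) (fun z => Zc z t) by apply: dfun_rv.
apply: (dmx_case (T := ZT) (c := fun z => [pick s : PI | Zc z s != 0]) (f := f)).
  by apply: (@dfin_pick _ ZT) => s; apply: dpred_neq0.
case=> [s|]; last exact: dmx_const.
rewrite /f /pres_chart; case: (mdeg m <= n)%N; last exact: dmx_const.
move=> i l; apply: (@dfun_ext F ZT (fun z => Zc z (rep s l (bnd bm0 m)) / Zc z s)).
  by move=> z; rewrite mxE.
by apply: dfun_mul => //; apply: dfun_inv.
Qed.

Lemma dmx_cone_of : dmx (T := PT) cone_of.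
Proof.
apply: dmx_nrm => i j.
apply: (@dfun_ext F PT (fun v => \det (\matrix_i pres_of k n v ((enum_val j : PI) i)))) => [v|].
  by rewrite mxE.
apply: dfun_det => a b; apply: dfun_ext (@dmx_pres_of F k B D n ((enum_val j : PI) a) 0 b) => v.
by rewrite mxE.
Qed.

Lemma hilb_class : admissible k B e ->
  K0class (QProj hilb_cone_qproj) = facs F k B e.
Proof.
move=> he; have [<- _] := count_all F k_gt0 ltD ltkB he.
pose S z := inX k e (point_of z) && (cone_of (point_of z) == z).
have hS : dpred (T := ZT) S.
  apply: dpredI; first exact: (dpred_comp dmap_point_of (dpred_inX F k B D e)).
  apply: dpred_mxeq; last by move=> i j; rewrite (ord1 i); apply: dfun_rv.
  exact: (dmx_comp dmap_point_of dmx_cone_of).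
have cone_ofE v : inX k e v -> normalized (cone_of v) /\ exists2 c, c != 0 & cone_of v = c *: Pl (pres_of k n v).
  by move=> hv; have [s [_ _ _ nz]] := model_hilb hv; apply: nrmP.
rewrite (@K0class_normal F N _ S hS); last first.
  move=> z; split=> [/andP [hv /eqP ze]|[/hilb_coneE [v hv [c c0 ze]] nz]].
    have [nz [c c0 ce]] := cone_ofE _ hv; rewrite -ze; split=> //=.
    by apply/hilb_coneE; exists (point_of z) => //; exists c.
  have pv : point_of z = v by rewrite ze; apply: point_of_Pl.
  rewrite /S pv hv /=; apply/eqP; rewrite /cone_of.
  have -> : Pl (pres_of k n v) = c^-1 *: z by rewrite ze scalerA mulVf // scale1r.
  by apply: nrm_id; rewrite ?invr_eq0.
apply: (@mu_bij F ZT PT _ _ point_of cone_of) => //.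
- exact: dpred_inX.
- exact: dmap_point_of.
- move=> i; exact: (dmx_cone_of 0 i).
- by move=> z /andP [hv /eqP].
- move=> v hv; have [_ [c c0 ce]] := cone_ofE _ hv.
  have pv : point_of (cone_of v) = v by rewrite ce; apply: point_of_Pl.
  by rewrite /S pv hv eqxx.
Qed.

End HilbertClass.

(** * The product formula *)

Section Numerics.
Variables (k : nat) (H : nat -> nat).
Hypothesis k_gt0 : (0 < k)%N.
Local Notation e := (ideal_dim k H).

Definition true_degree (i : nat) : int := i%:Z - k.+1%:Z.

Lemma true_degreeD d : true_degree (d + k.+1) = d%:Z.
Proof. by rewrite /true_degree PoszD addrK. Qed.

Lemma true_degree_k : true_degree k = -1.
Proof. by rewrite /true_degree; lia. Qed.

Lemma ideal_dim_low i : (i <= k)%N -> e i = 0%N.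
Proof. by move=> ik; rewrite /ideal_dim (rho_small k_gt0 ik). Qed.

Hypothesis Hle : forall d, (H d <= rho k (d + k.+1))%N.

Lemma tau_nat d : (tau k d%:Z + d %/ k = d.+1 %/ k)%N.
Proof. by rewrite /tau -PoszD addn1 divnS // dvdzE. Qed.

Lemma step_ideal_dim i : (k <= i)%N ->
  step e i = (Hext H (true_degree i) + tau k (true_degree i) - Hext H (true_degree i + 1))%N.
Proof.
rewrite leq_eqVlt => /orP [/eqP <-|ki].
  rewrite true_degree_k addNr /= /step (ideal_dim_low (leqnn k)) subn0 -[k.+1]add0n ideal_dimE (rho_shift k_gt0) div0n.
  by rewrite /tau addNr dvdz0.
rewrite -(subnK ki); set d := (i - k.+1)%N.
rewrite true_degreeD -PoszD addn1 /step -addSn !ideal_dimE !(rho_shift k_gt0) /= -tau_nat.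
have := Hle d; have := Hle d.+1; rewrite !(rho_shift k_gt0) -tau_nat; lia.
Qed.

Lemma excess_ideal_dim i : (k <= i)%N ->
  excess k e i = (Hext H (true_degree i + 1) - Hext H (true_degree i + 1 + k%:Z))%N.
Proof.
rewrite leq_eqVlt => /orP [/eqP <-|ki].
  have e1 : e k.+1 = (1 - H 0)%N.
    by rewrite -[k.+1]add0n ideal_dimE (rho_shift k_gt0) div0n.
  have e2 : e (k + 1 + k)%N = (2 - H k)%N.
    by rewrite -addnA add1n ideal_dimE (rho_shift k_gt0) divnn k_gt0.
  rewrite true_degree_k addNr add0r /= /excess e1 e2; have := Hle k; have := Hle 0.
  rewrite !(rho_shift k_gt0) div0n divnn k_gt0 /=; lia.
rewrite -(subnK ki); set d := (i - k.+1)%N.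
rewrite true_degreeD -!PoszD addn1 /excess -addSn (_ : (d + k.+1 + 1 + k = (d.+1 + k) + k.+1)%N); last by lia.
have dk : ((d.+1 + k) %/ k = (d.+1 %/ k).+1)%N by rewrite divnDr // divnn k_gt0 addn1.
have := Hle (d.+1 + k)%N; have := Hle d.+1; rewrite !ideal_dimE !(rho_shift k_gt0) dk /=; lia.
Qed.

Lemma eta_spec : eta_index k H = -1 \/
  exists2 i : nat, eta_index k H = i%:Z & H i = (i %/ k).+1.
Proof.
rewrite /eta_index; case: xgetP => [_ _ [i [-> Hi _]]|_]; last by left.
by right; exists i.
Qed.

Variables (F : closedFieldType) (B : nat).
Local Notation LL := (K0class (affine_line F)).
Hypothesis ltkB : (k < B)%N.
Hypothesis adm : admissible k B e.
Hypothesis Hbig : forall d, (B <= d + k.+1)%N -> H d = 0%N.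

Lemma facs_product :
  \big[*%R/1]_(i \in [set i : int | eta_index k H <= i])
      poly_eval (gauss_poly (Hext H i + tau k i - Hext H (i + 1))
        (Hext H (i + 1) - Hext H (i + 1 + k%:Z))) LL = facs F k B e.
Proof.
set G := fun i : int => poly_eval _ LL.
have eta_ge : -1 <= eta_index k H by case: eta_spec => [->|[i -> _]].
pose r := [seq true_degree i | i <- iota 0 B & eta_index k H <= true_degree i].
rewrite (fsbigE r); first last.
- move=> j /= etaj jr; have j1 : -1 <= j := le_trans eta_ge etaj.
  pose i := absz (j + k.+1%:Z); have ij : true_degree i = j by rewrite /true_degree /i; lia.
  have iB : (B <= i)%N.
    rewrite leqNgt; apply/negP => lt; move/negP: jr; apply; rewrite -ij.
    by apply: map_f; rewrite mem_filter ij etaj mem_iota.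
  have ki : (k < i)%N by apply: leq_trans iB.
  rewrite -ij -(subnK ki) true_degreeD /G poly_eval_gauss -!PoszD /=.
  by rewrite !Hbig ?addn0 ?qbnn //; lia.
- move=> j /= jr; have : all (fun j' => eta_index k H <= j') r.
    by rewrite all_map; apply/allP => i; rewrite mem_filter => /andP [].
  by move/allP; apply.
- rewrite map_inj_uniq ?filter_uniq ?iota_uniq // => i i'; rewrite /true_degree; lia.
have memE j : (j \in [set i : int | eta_index k H <= i]) = (eta_index k H <= j).
  by apply/idP/idP => [/set_mem //|h]; exact/mem_set.
rewrite /r big_map big_filter_cond big_mkcond /facs /= -(big_mkord xpredT) /= /index_iota subn0.
apply: eq_big_seq => i; rewrite mem_iota add0n memE andbb => /= iB.
have [_ mono _ _] := adm.
have e0 d : (i < d)%N -> e d = 0%N -> fac F k e i = 1.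
  move=> id ed; rewrite /fac (_ : step e i = 0%N) ?qbn0 // /step.
  have : (e i.+1 <= e d)%N.
    rewrite -(subnK id); elim: (d - i.+1)%N => // m IH.
    by rewrite addSn (leq_trans IH).
  lia.
case: ifP => [etai|/negbT]; last rewrite -ltNge.
  have ki : (k <= i)%N by have := le_trans eta_ge etai; rewrite /true_degree; lia.
  by rewrite /G poly_eval_gauss -step_ideal_dim // -excess_ideal_dim.
case: eta_spec => [->|[E -> HE]] lt.
  by rewrite (e0 i.+1) ?ideal_dim_low //; move: lt; rewrite /true_degree; lia.
rewrite (e0 (E + k.+1)%N) //; first by move: lt; rewrite /true_degree; lia.
by rewrite ideal_dimE (rho_shift k_gt0) HE subnn.
Qed.

Lemma sum_ideal_dim : \big[addn/0%N]_(i \in [set: nat]) H i = (\sum_(i < B.+1) (rho k i - e i))%N.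
Proof.
rewrite (fsbigE (iota 0 (B - k))) ?iota_uniq //; last first.
  by move=> i _; rewrite mem_iota add0n => h; apply: Hbig; lia.
rewrite -(big_mkord xpredT (fun i => rho k i - e i)%N) (@big_cat_nat _ _ _ k.+1) //=; last by lia.
rewrite [X in _ = (X + _)%N]big_nat_cond [X in _ = (X + _)%N]big1 ?add0n; last first.
  by move=> i /andP [/andP [_ ik] _]; rewrite (rho_small k_gt0).
rewrite -{1}[k.+1]add0n big_addn subSS /index_iota subn0 big_mkcond /=.
apply: eq_bigr => i _; rewrite ideal_dimE subKn // ifT //; exact: mem_set.
Qed.

End Numerics.

Lemma finite_support_bound (H : nat -> nat) : finite_set [set i | H i != 0%N] ->
  exists d0, forall d, (d0 <= d)%N -> H d = 0%N.
Proof.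
move=> /finite_seqP [s hs]; exists (\max_(i <- s) i).+1 => d dd; apply/eqP/negPn/negP => Hd.
have ds : d \in s by have : [set i | H i != 0%N] d by []; rewrite hs.
by move: dd; rewrite ltnNge (leq_bigmax_seq (F := fun i => i) _ ds).
Qed.

Theorem theorem1p2 (R : realType) (k : nat) (hk : (1 <= k)%N) (H : nat -> nat)
    (hH : finite_set [set i | H i != 0%N]) (n : nat)
    (hn : n = \big[addn/0%N]_(i \in [set: nat]) H i)
    (hne : hilb_fixH (F := R[i]) k n H !=set0) :
  exists X : qproj R[i] #|plucker_index n|,
    qpts X = hilb_cone (hilb_fixH k n H) /\
    K0class X = \big[*%R/1]_(i \in [set i : int | eta_index k H <= i])
      poly_eval (gauss_poly (Hext H i + tau k i - Hext H (i + 1))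
        (Hext H (i + 1) - Hext H (i + 1 + k%:Z))) (K0class (affine_line R[i])).
Proof.
have [d0 hd0] := finite_support_bound hH.
pose B := (d0 + 3 * k + 3)%N; pose D := (rho k B).+1.
have ltD : (rho k B < D)%N by [].
have ltkB : (k < B)%N by rewrite /B; lia.
have Hbig d : (B <= d + k.+1)%N -> H d = 0%N by rewrite /B => h; apply: hd0; lia.
have Htail d : (B < d + k.+1)%N -> H d = 0%N by move=> h; apply/Hbig/ltnW.
have [I hI] := hne.
have Hle d : (H d <= rho k (d + k.+1))%N := hilb_le hk ltD Htail d hI.
have nE : n = (\sum_(i < B.+1) (rho k i - ideal_dim k H i))%N by rewrite hn -sum_ideal_dim.
have [v hv _] := hilb_model hk ltD ltkB hI.
have adm : admissible k B (ideal_dim k H).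
  apply: (inX_admissible hk ltD _ ltkB hv) => i iB.
  rewrite /ideal_dim leqNgt (_ : (k < i)%N) /=; last by move: iB; rewrite /B; lia.
  by rewrite hd0 ?subn0 //; move: iB; rewrite /B; lia.
exists (QProj (hilb_cone_qproj R[i] hk ltD ltkB Htail Hle nE)); split=> //.
by rewrite (facs_product hk Hle _ ltkB adm Hbig) hilb_class.
Qed.
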